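(* Let $n\ge2$. The algebra isomorphism $\mathrm{Sk}_q(\Sigma_{0,n+1})\to\mathrm{AW}(n)$ given by $s_A\mapsto-\Lambda_A$ commutes with the actions of the braid group $B_n$ on both sides.
   Context: All algebras are over $\mathbb C(q^{1/4})$, $q$ generic. $B_n=\langle\beta_1,\dots,\beta_{n-1}\mid\beta_i\beta_{i+1}\beta_i=\beta_{i+1}\beta_i\beta_{i+1},\ \beta_i\beta_j=\beta_j\beta_i\ (|i-j|>1)\rangle$. **Quantum group.** $U=\mathcal U_q(\mathfrak{sl}_2)$ is generated by $K^{\pm1},E,F$ with $KE=q^2EK$, $KF=q^{-2}FK$, $[E,F]=\frac{K-K^{-1}}{q-q^{-1}}$, $\Delta(K)=K\otimes K$, $\Delta(E)=E\otimes K+1\otimes E$, $\Delta(F)=F\otimes1+K^{-1}\otimes F$; graded by $|E|=1,|F|=-1,|K|=0$; Casimir $\Lambda=(q-q^{-1})^2FE+qK+q^{-1}K^{-1}$. **Askey--Wilson algebra.** $\mathcal I_L\subset U$ is the subalgebra generated by $E,FK,K,\Lambda$; $\tau_L:\mathcal I_L\to U\otimes\mathcal I_L$ is the algebra morphism $E\mapsto K\otimes E$, $FK\mapsto K^{-1}\otimes FK-qF\otimes\Lambda+q(q+q^{-1})F\otimes K-q^{-1}(q-q^{-1})^2F^2K\otimes E$, $K\mapsto1\otimes K-q^{-1}(q-q^{-1})^2FK\otimes E$, $\Lambda\mapsto1\otimes\Lambda$. For $\emptyset\ne A=\{i_1<\dots<i_k\}\subseteq\{1,\dots,n\}$, $\Lambda_A=\big((\mathrm{id}^{\otimes(i_k-2)}\otimes\alpha_{i_k-1})\circ\cdots\circ\alpha_1(\Lambda)\big)\otimes1^{\otimes(n-i_k)}$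 with $\alpha_i=\Delta$ if $i\in A$, $\alpha_i=\tau_L$ otherwise; $\mathrm{AW}(n)\subset U^{\otimes n}$ is generated by the $\Lambda_A$. **Braid action on $\mathrm{AW}(n)$.** Let $\Theta=\sum_{i\ge0}q^{i(i-1)/2}\frac{(q-q^{-1})^i}{[i]!}E^i\otimes F^i$ with $[j]=\frac{q^j-q^{-j}}{q-q^{-1}}$, and let $\Psi$ be the automorphism $\Psi(x\otimes y)=xK^{-|y|}\otimes K^{-|x|}y$ of $U\otimes U$ ($x,y$ homogeneous). For $x\in U\otimes U$ put $\beta(x)=\sigma\big(\Psi^{-1}(\Theta x\Theta^{-1})\big)$, $\sigma(a\otimes b)=b\otimes a$, in a completion of $U\otimes U$ (e.g. the algebra of natural endomorphisms of the functors $(V_1,V_2)\mapsto V_1\otimes V_2$ on finite-dimensional type 1 weight modules). The generator $\beta_i$ acts by $\mathrm{id}^{\otimes(i-1)}\otimes\beta\otimes\mathrm{id}^{\otimes(n-i-1)}$. This gives an action of $B_n$ by algebra automorphisms on the completion of $U^{\otimes n}$ which restricts to $\mathrm{AW}(n)$. **Skein algebra.** $\Sigma_{0,n+1}$ is the plane with punctures $1,\dots,n$ on a horizontal line from left to right, the last puncture being at infinity. $\mathrm{Sk}_q(\Sigma)$ is spanned by isotopy classes of framed links in $\Sigma\times[0,1]$ modulo: contractible circle $=-q-q^{-1}$; a crossing whose over-strand runs from lower left to upper right equals $q^{1/2}$ times the smoothing joining the two upper ends and the two lower ends, plus $q^{-1/2}$ times the smoothing joining the two left ends and the two right ends. $XY$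 is $Y$ stacked above $X$. $s_A$ is the simple closed curve enclosing exactly the punctures in $A$ and passing below those not in $A$; $s_A\mapsto-\Lambda_A$ defines an algebra isomorphism onto $\mathrm{AW}(n)$. **Braid action on the skein algebra.** $\beta_i$ acts by the half Dehn twist exchanging the punctures $i$ and $i+1$ by an anti-clockwise rotation, links being continuously deformed along. *)

(* Defs.v *)
From HB Require Import structures.
From mathcomp Require Import all_boot all_order all_algebra all_fingroup.
From mathcomp Require Import generic_quotient complex.
From mathcomp Require Import all_classical all_reals all_analysis.

Set Implicit Arguments.
Unset Strict Implicit.
Unset Printing Implicit Defensive.

Import Order.TTheory GRing.Theory Num.Theory.
Import numFieldNormedType.Exports.

Local Open Scope classical_set_scope.
Local Open Scope ring_scope.
Local Open Scope quotient_scope.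

(** * Ground field *)

Definition qfield (R : realType) : fieldType := {fraction {poly R[i]}}.

Section Scalars.
Variable R : realType.
Definition qroot4 : qfield R := tofrac 'X.
Definition qhalf : qfield R := qroot4 ^+ 2.
Definition q : qfield R := qroot4 ^+ 4.
Definition qint (j : nat) : qfield R := (q ^+ j - q ^- j) / (q - q^-1).
Definition qfact (i : nat) : qfield R := \prod_(1 <= j < i.+1) qint j.
End Scalars.
Arguments qroot4 {R}.
Arguments qhalf {R}.
Arguments q {R}.
Arguments qint {R}.
Arguments qfact {R}.

(** * Algebras given by generators and relations *)

Inductive pterm (F : fieldType) (X : Type) : Type :=
| PGen of X
| PScal of F
| PAdd of pterm F X & pterm F X
| PMul of pterm F X & pterm F X.
Arguments PGen {F X}.
Arguments PScal {F X}.

Declare Scope pterm_scope.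
Delimit Scope pterm_scope with PT.
Bind Scope pterm_scope with pterm.
Notation "s + t" := (PAdd s t) : pterm_scope.
Notation "s * t" := (PMul s t) : pterm_scope.
Notation "s - t" := (PAdd s (PMul (PScal (-1)) t)) : pterm_scope.
Notation "c %:S" := (PScal c%R) (at level 2, format "c %:S") : pterm_scope.

HB.instance Definition _ (F : fieldType) X := gen_eqMixin (pterm F X).
HB.instance Definition _ (F : fieldType) X := gen_choiceMixin (pterm F X).

Section PresentedAlgebra.
Variables (F : fieldType) (X : Type).
Implicit Types s t u : pterm F X.
Variable r : pterm F X -> pterm F X -> Prop.

(* The least congruence containing r and the axioms of unital associative
   F-algebras, the scalar c being identified with c times the unit. *)
Inductive peq : pterm F X -> pterm F X -> Prop :=
| peq_rel s t : r s t -> peq s t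
| peq_refl s : peq s s
| peq_sym s t : peq s t -> peq t s
| peq_trans s t u : peq s t -> peq t u -> peq s u
| peq_add s s' t t' : peq s s' -> peq t t' -> peq (s + t) (s' + t')
| peq_mul s s' t t' : peq s s' -> peq t t' -> peq (s * t) (s' * t')
| peq_addA s t u : peq (s + (t + u)) (s + t + u)
| peq_addC s t : peq (s + t) (t + s)
| peq_add0 s : peq (0%:S + s) s
| peq_addN s : peq (s - s) 0%:S
| peq_mulA s t u : peq (s * (t * u)) (s * t * u)
| peq_mul1l s : peq (1%:S * s) s
| peq_mulDl s t u : peq ((s + t) * u) (s * u + t * u)
| peq_mulDr s t u : peq (s * (t + u)) (s * t + s * u)
| peq_scalD (a b : F) : peq ((a + b)%:S) (a%:S + b%:S)
| peq_scalM (a b : F) : peq ((a * b)%:S) (a%:S * b%:S)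
| peq_scalC (a : F) s : peq (a%:S * s) (s * a%:S).

Definition peqb s t := `[< peq s t >].

Lemma peqb_refl : reflexive peqb.
Proof. by move=> s; apply/asboolP/peq_refl. Qed.

Lemma peqb_sym : symmetric peqb.
Proof. by move=> s t; apply/asboolP/asboolP => /peq_sym. Qed.

Lemma peqb_trans : transitive peqb.
Proof.
by move=> t s u /asboolP st /asboolP tu; apply/asboolP/(peq_trans st tu).
Qed.

Canonical peq_equiv := EquivRel peqb peqb_refl peqb_sym peqb_trans.

Definition palg := {eq_quot peq_equiv}.
HB.instance Definition _ := Choice.on palg.
HB.instance Definition _ := Quotient.on palg.

Definition pcl (s : pterm F X) : palg := \pi_palg s.

Lemma pclP s t : pcl s = pcl t <-> peq s t.
Proof.
rewrite /pcl; split=> [/eqP|st].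
  by rewrite (eqmodE peq_equiv) => /asboolP.
by apply/eqP; rewrite (eqmodE peq_equiv); apply/asboolP.
Qed.

Lemma pclK (x : palg) : pcl (repr x) = x.
Proof. exact: reprK. Qed.

Lemma repr_pcl s : peq (repr (pcl s)) s.
Proof. by apply/pclP; rewrite pclK. Qed.

Definition palg_add (x y : palg) := pcl (repr x + repr y).
Definition palg_mul (x y : palg) := pcl (repr x * repr y).
Definition palg_opp (x : palg) := pcl ((-1)%:S * repr x).
Definition palg_scale (c : F) (x : palg) := pcl (c%:S * repr x).

Lemma pclD s t : palg_add (pcl s) (pcl t) = pcl (s + t).
Proof. by apply/pclP; apply: peq_add; exact: repr_pcl. Qed.
Lemma pclM s t : palg_mul (pcl s) (pcl t) = pcl (s * t).
Proof. by apply/pclP; apply: peq_mul; exact: repr_pcl. Qed.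
Lemma pclZ c s : palg_scale c (pcl s) = pcl (c%:S * s).
Proof.
by apply/pclP; apply: peq_mul; [exact: peq_refl | exact: repr_pcl].
Qed.

Lemma pclN s : palg_opp (pcl s) = pcl ((-1)%:S * s).
Proof. exact: pclZ. Qed.

Lemma palg_ind (P : palg -> Prop) : (forall s, P (pcl s)) -> forall x, P x.
Proof. by move=> Ps x; rewrite -(pclK x). Qed.

Lemma palg_addA : associative palg_add.
Proof.
elim/palg_ind=> s; elim/palg_ind=> t; elim/palg_ind=> u.
by rewrite !pclD; apply/pclP/peq_addA.
Qed.

Lemma palg_addC : commutative palg_add.
Proof.
elim/palg_ind=> s; elim/palg_ind=> t.
by rewrite !pclD; apply/pclP/peq_addC.
Qed.

Lemma palg_add0 : left_id (pcl 0%:S) palg_add.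
Proof. by elim/palg_ind=> s; rewrite pclD; apply/pclP/peq_add0. Qed.

Lemma palg_addN : left_inverse (pcl 0%:S) palg_opp palg_add.
Proof.
elim/palg_ind=> s; rewrite pclN pclD; apply/pclP.
exact: peq_trans (peq_addC _ _) (peq_addN _).
Qed.

HB.instance Definition _ :=
  GRing.isZmodule.Build palg palg_addA palg_addC palg_add0 palg_addN.

Lemma palg_mulA : associative palg_mul.
Proof.
elim/palg_ind=> s; elim/palg_ind=> t; elim/palg_ind=> u.
by rewrite !pclM; apply/pclP/peq_mulA.
Qed.

Lemma palg_mul1l : left_id (pcl 1%:S) palg_mul.
Proof. by elim/palg_ind=> s; rewrite pclM; apply/pclP/peq_mul1l. Qed.

Lemma palg_mul1r : right_id (pcl 1%:S) palg_mul.
Proof.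
elim/palg_ind=> s; rewrite pclM; apply/pclP.
exact: peq_trans (peq_sym (peq_scalC _ _)) (peq_mul1l _).
Qed.

Lemma palg_mulDl : left_distributive palg_mul +%R.
Proof.
elim/palg_ind=> s; elim/palg_ind=> t; elim/palg_ind=> u.
rewrite /GRing.add /= pclD !pclM pclD; exact/pclP/peq_mulDl.
Qed.

Lemma palg_mulDr : right_distributive palg_mul +%R.
Proof.
elim/palg_ind=> s; elim/palg_ind=> t; elim/palg_ind=> u.
rewrite /GRing.add /= pclD !pclM pclD; exact/pclP/peq_mulDr.
Qed.

HB.instance Definition _ := GRing.Zmodule_isPzRing.Build palg
  palg_mulA palg_mul1l palg_mul1r palg_mulDl palg_mulDr.

Lemma palg_scaleA (a b : F) x :
  palg_scale a (palg_scale b x) = palg_scale (a * b) x.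
Proof.
elim/palg_ind: x => s; rewrite !pclZ; apply/pclP.
apply: peq_trans (peq_mulA _ _ _) _; apply: peq_mul (peq_refl _).
exact: peq_sym (peq_scalM _ _).
Qed.

Lemma palg_scale1 : left_id 1 palg_scale.
Proof. by elim/palg_ind=> s; rewrite pclZ; apply/pclP/peq_mul1l. Qed.

Lemma palg_scaleDr : right_distributive palg_scale +%R.
Proof.
move=> a; elim/palg_ind=> s; elim/palg_ind=> t.
rewrite /GRing.add /= pclD !pclZ pclD; exact/pclP/peq_mulDr.
Qed.

Lemma palg_scaleDl x : {morph palg_scale^~ x : a b / a + b}.
Proof.
move=> a b; elim/palg_ind: x => s.
rewrite /GRing.add /= !pclZ pclD; apply/pclP.
exact: peq_trans (peq_mul (peq_scalD _ _) (peq_refl _)) (peq_mulDl _ _ _).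
Qed.

HB.instance Definition _ := GRing.Zmodule_isLmodule.Build F palg
  palg_scaleA palg_scale1 palg_scaleDr palg_scaleDl.

Lemma palg_scaleAl (a : F) (x y : palg) : a *: (x * y) = a *: x * y.
Proof.
change (palg_scale a (palg_mul x y) = palg_mul (palg_scale a x) y).
elim/palg_ind: x => s; elim/palg_ind: y => t.
by rewrite pclM !pclZ pclM; apply/pclP/peq_mulA.
Qed.

Lemma palg_scaleAr (a : F) (x y : palg) : a *: (x * y) = x * (a *: y).
Proof.
change (palg_scale a (palg_mul x y) = palg_mul x (palg_scale a y)).
elim/palg_ind: x => s; elim/palg_ind: y => t.
rewrite pclM !pclZ pclM; apply/pclP.
apply: peq_trans (peq_mulA _ _ _) _.
apply: peq_trans (peq_mul (peq_scalC _ _) (peq_refl _)) _.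
exact: peq_sym (peq_mulA _ _ _).
Qed.

Definition pgen (x : X) : palg := pcl (PGen x).

(* The subalgebra generated by a set. *)
Inductive subalg (S : palg -> Prop) : palg -> Prop :=
| subalg_gen x : S x -> subalg S x
| subalg_scal (c : F) : subalg S (c *: (1 : palg))
| subalg_add x y : subalg S x -> subalg S y -> subalg S (x + y)
| subalg_mul x y : subalg S x -> subalg S y -> subalg S (x * y).

End PresentedAlgebra.

(* The subalgebra of A x B generated by a relation G between A and B.  If a
   morphism f from the subalgebra of A generated by the domain of G to B takes
   the values prescribed by G, then [alg_graph G x y] means y = f x. *)
Inductive alg_graph (F : fieldType) (X Y : Type)
    (r : pterm F X -> pterm F X -> Prop) (s : pterm F Y -> pterm F Y -> Prop)
    (G : palg r -> palg s -> Prop) : palg r -> palg s -> Prop :=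
| graph_gen x y : G x y -> alg_graph G x y
| graph_scal (c : F) : alg_graph G (c *: (1 : palg r)) (c *: (1 : palg s))
| graph_add x y x' y' : alg_graph G x y -> alg_graph G x' y' ->
    alg_graph G (x + x') (y + y')
| graph_mul x y x' y' : alg_graph G x y -> alg_graph G x' y' ->
    alg_graph G (x * x') (y * y').

Definition alg_morphism (F : fieldType) (X Y : Type)
    (r : pterm F X -> pterm F X -> Prop) (s : pterm F Y -> pterm F Y -> Prop)
    (f : palg r -> palg s) : Prop :=
  linear f /\ monoid_morphism f.

(** * The tensor powers of U_q(sl_2) *)

Inductive ugen := gE | gF | gK | gKi.

Section TensorPower.
Variables (R : realType) (m : nat).

Local Notation T i a := (PGen (i, a) : pterm (qfield R) ('I_m * ugen)).

(* The m-th tensor power of U_q(sl_2), presented by one copy of the generators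
   of U_q(sl_2) for each tensor factor, distinct factors commuting. *)
Inductive urel : pterm (qfield R) ('I_m * ugen) ->
                 pterm (qfield R) ('I_m * ugen) -> Prop :=
| urel_KKi i : urel (T i gK * T i gKi) 1%:S
| urel_KiK i : urel (T i gKi * T i gK) 1%:S
| urel_KE i : urel (T i gK * T i gE) ((q ^+ 2)%:S * (T i gE * T i gK))
| urel_KF i : urel (T i gK * T i gF) ((q ^- 2)%:S * (T i gF * T i gK))
| urel_EF i : urel (T i gE * T i gF - T i gF * T i gE)
                   (((q - q^-1)^-1)%:S * (T i gK - T i gKi))
| urel_comm i j a b : i != j -> urel (T i a * T j b) (T j b * T i a).

Definition Utens := palg urel.

Definition ug (a : ugen) (i : 'I_m) : Utens := pgen urel (i, a).
Definition casimir (i : 'I_m) : Utens :=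
  (q - q^-1) ^+ 2 *: (ug gF i * ug gE i) + q *: ug gK i + q^-1 *: ug gKi i.

End TensorPower.
Arguments ug {R m}.
Arguments casimir {R m}.

(** * Askey-Wilson algebra *)

Section AskeyWilson.
Variable R : realType.

Definition wd m (i : 'I_m) : 'I_m.+1 := widen_ord (leqnSn m) i.

(* Graph of id^(m-1) (x) Delta on generators; the last tensor factor of
   U^(x)m is the one of index i with i.+1 = m. *)
Inductive delta_gen (m : nat) : Utens R m -> Utens R m.+1 -> Prop :=
| delta_keep (i : 'I_m) a : (i.+1 < m)%N -> delta_gen (ug a i) (ug a (wd i))
| delta_E (i : 'I_m) : i.+1 = m ->
    delta_gen (ug gE i) (ug gE (wd i) * ug gK ord_max + ug gE ord_max)
| delta_F (i : 'I_m) : i.+1 = m ->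
    delta_gen (ug gF i) (ug gF (wd i) + ug gKi (wd i) * ug gF ord_max)
| delta_K (i : 'I_m) : i.+1 = m ->
    delta_gen (ug gK i) (ug gK (wd i) * ug gK ord_max)
| delta_Ki (i : 'I_m) : i.+1 = m ->
    delta_gen (ug gKi i) (ug gKi (wd i) * ug gKi ord_max).

(* Graph of id^(m-1) (x) tau_L on generators of U^(x)(m-1) (x) I_L. *)
Inductive tau_gen (m : nat) : Utens R m -> Utens R m.+1 -> Prop :=
| tau_keep (i : 'I_m) a : (i.+1 < m)%N -> tau_gen (ug a i) (ug a (wd i))
| tau_E (i : 'I_m) : i.+1 = m ->
    tau_gen (ug gE i) (ug gK (wd i) * ug gE ord_max)
| tau_FK (i : 'I_m) : i.+1 = m ->
    tau_gen (ug gF i * ug gK i)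
      (ug gKi (wd i) * (ug gF ord_max * ug gK ord_max)
       - q *: (ug gF (wd i) * casimir ord_max)
       + (q * (q + q^-1)) *: (ug gF (wd i) * ug gK ord_max)
       - (q^-1 * (q - q^-1) ^+ 2) *:
           (ug gF (wd i) ^+ 2 * ug gK (wd i) * ug gE ord_max))
| tau_K (i : 'I_m) : i.+1 = m ->
    tau_gen (ug gK i)
      (ug gK ord_max
       - (q^-1 * (q - q^-1) ^+ 2) *:
           (ug gF (wd i) * ug gK (wd i) * ug gE ord_max))
| tau_Casimir (i : 'I_m) : i.+1 = m ->
    tau_gen (casimir i) (casimir ord_max).

(* Graph of x |-> x (x) 1 on generators. *)
Inductive pad_gen (m : nat) : Utens R m -> Utens R m.+1 -> Prop :=
| pad_intro (i : 'I_m) a : pad_gen (ug a i) (ug a (wd i)).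

(* [is_Lambda A m y]: y is the element of U^(x)m obtained from the Casimir by
   the first m - 1 steps of the definition of Lambda_A.  The elements of A are
   numbered from 0, so the m-th step (alpha_m if m is less than the largest
   element i_k of A, and x |-> x (x) 1 otherwise) depends on whether m.-1 is
   in A, and m < i_k means that A has an element j >= m. *)
Inductive is_Lambda (A : pred nat) : forall m, Utens R m -> Prop :=
| Lambda_start : is_Lambda A (casimir (ord0 : 'I_1))
| Lambda_delta m (x : Utens R m) (y : Utens R m.+1) : is_Lambda A x ->
    A m.-1 -> (exists2 j, A j & (m <= j)%N) ->
    alg_graph (@delta_gen m) x y -> is_Lambda A y
| Lambda_tau m (x : Utens R m) (y : Utens R m.+1) : is_Lambda A x ->
    ~~ A m.-1 -> (exists2 j, A j & (m <= j)%N) ->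
    alg_graph (@tau_gen m) x y -> is_Lambda A y
| Lambda_pad m (x : Utens R m) (y : Utens R m.+1) : is_Lambda A x ->
    ~ (exists2 j, A j & (m <= j)%N) ->
    alg_graph (@pad_gen m) x y -> is_Lambda A y.

Definition Lambda n (A : {set 'I_n}) : Utens R n :=
  xget 0 [set y | is_Lambda [pred j | [exists k in A, val k == j]] y].

Definition AW n : Utens R n -> Prop :=
  subalg (fun y => exists2 A : {set 'I_n}, A != finset.set0 & y = Lambda A).

End AskeyWilson.
Arguments Lambda {R n}.
Arguments AW {R n}.

(** * Braid groups *)

Section BraidGroup.
Variable n : nat.

(* (i, true) is the i-th Artin generator (numbered from 0), (i, false) its
   inverse. *)
Definition bword := seq ('I_n.-1 * bool).

Inductive beq : bword -> bword -> Prop :=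
| beq_refl u : beq u u
| beq_sym u v : beq u v -> beq v u
| beq_trans u v w : beq u v -> beq v w -> beq u w
| beq_cat u u' v v' : beq u u' -> beq v v' -> beq (u ++ v) (u' ++ v')
| beq_inv i b : beq [:: (i, b); (i, ~~ b)] [::]
| beq_braid (i j : 'I_n.-1) : j = i.+1 :> nat ->
    beq [:: (i, true); (j, true); (i, true)]
        [:: (j, true); (i, true); (j, true)]
| beq_far (i j : 'I_n.-1) : (i.+1 < j)%N ->
    beq [:: (i, true); (j, true)] [:: (j, true); (i, true)].

Definition beqb u v := `[< beq u v >].

Lemma beqb_refl : reflexive beqb.
Proof. by move=> u; apply/asboolP/beq_refl. Qed.

Lemma beqb_sym : symmetric beqb.
Proof. by move=> u v; apply/asboolP/asboolP => /beq_sym. Qed.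

Lemma beqb_trans : transitive beqb.
Proof.
by move=> v u w /asboolP uv /asboolP vw; apply/asboolP/(beq_trans uv vw).
Qed.

Canonical beq_equiv := EquivRel beqb beqb_refl beqb_sym beqb_trans.

Definition braid := {eq_quot beq_equiv}.
HB.instance Definition _ := Choice.on braid.
HB.instance Definition _ := Quotient.on braid.

Definition bcl (u : bword) : braid := \pi_braid u.

Lemma bclP u v : bcl u = bcl v <-> beq u v.
Proof.
rewrite /bcl; split=> [/eqP|uv].
  by rewrite (eqmodE beq_equiv) => /asboolP.
by apply/eqP; rewrite (eqmodE beq_equiv); apply/asboolP.
Qed.

Lemma bclK (x : braid) : bcl (repr x) = x.
Proof. exact: reprK. Qed.

Lemma repr_bcl u : beq (repr (bcl u)) u.
Proof. by apply/bclP; rewrite bclK. Qed.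

Definition wflip (u : bword) : bword :=
  [seq (x.1, ~~ x.2) | x <- rev u].

Lemma wflipK u : wflip (wflip u) = u.
Proof.
rewrite /wflip -map_rev revK -map_comp -[RHS]map_id.
by apply: eq_map => -[i b] /=; rewrite negbK.
Qed.

Lemma beq_flipr u : beq (u ++ wflip u) [::].
Proof.
elim: u => [|[i b] u IH] /=; first exact: beq_refl.
rewrite /wflip rev_cons map_rcons -/(wflip u) -cats1 catA /=.
apply: beq_trans (beq_inv i b).
rewrite -cat1s -[X in beq _ X]cat1s -[[:: (i, ~~ b)] in X in beq _ X]cat0s.
apply: beq_cat (beq_refl _) _; apply: beq_cat (beq_refl _).
exact: IH.
Qed.

Lemma beq_flipl u : beq (wflip u ++ u) [::].
Proof. by rewrite -{2}(wflipK u); exact: beq_flipr. Qed.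

Lemma beq_flip u v : beq u v -> beq (wflip u) (wflip v).
Proof.
move=> uv; rewrite -[wflip u]cats0.
apply: beq_trans (beq_cat (beq_refl _) (beq_sym (beq_flipr v))) _.
rewrite catA -[wflip v in X in beq _ X]cat0s.
apply: beq_cat (beq_refl _).
apply: beq_trans (beq_cat (beq_refl _) (beq_sym uv)) _.
exact: beq_flipl.
Qed.

Definition braid_one : braid := bcl [::].
Definition braid_mul (x y : braid) := bcl (repr x ++ repr y).
Definition braid_inv (x : braid) := bcl (wflip (repr x)).

Lemma bclM u v : braid_mul (bcl u) (bcl v) = bcl (u ++ v).
Proof. by apply/bclP; apply: beq_cat; exact: repr_bcl. Qed.

Lemma bclV u : braid_inv (bcl u) = bcl (wflip u).
Proof. by apply/bclP; apply: beq_flip; exact: repr_bcl. Qed.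

Lemma braid_mulA : associative braid_mul.
Proof.
by move=> x y z; rewrite -(bclK x) -(bclK y) -(bclK z) !bclM catA.
Qed.
Lemma braid_mul1 : left_id braid_one braid_mul.
Proof. by move=> x; rewrite -(bclK x) bclM. Qed.
Lemma braid_mulr1 : right_id braid_one braid_mul.
Proof. by move=> x; rewrite -(bclK x) bclM cats0. Qed.
Lemma braid_mulV : left_inverse braid_one braid_inv braid_mul.
Proof.
by move=> x; rewrite -(bclK x) bclV bclM; apply/bclP/beq_flipl.
Qed.
Lemma braid_mulVr : right_inverse braid_one braid_inv braid_mul.
Proof.
by move=> x; rewrite -(bclK x) bclV bclM; apply/bclP/beq_flipr.
Qed.

HB.instance Definition _ := isGroup.Build braid
  braid_mulA braid_mul1 braid_mulr1 braid_mulV braid_mulVr.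

Definition bgen (i : 'I_n.-1) : braid := bcl [:: (i, true)].

(* The two tensor factors, or punctures, exchanged by the i-th generator. *)
Lemma strand_lt (i : 'I_n.-1) : (i < n)%N.
Proof. exact: leq_trans (ltn_ord i) (leq_pred n). Qed.
Lemma strandS_lt (i : 'I_n.-1) : (i.+1 < n)%N.
Proof. by rewrite -ltn_predRL. Qed.
Definition strand (i : 'I_n.-1) : 'I_n := Ordinal (strand_lt i).
Definition strandS (i : 'I_n.-1) : 'I_n := Ordinal (strandS_lt i).

End BraidGroup.

Definition is_action (G : groupType) (X : Type) (act : G -> X -> X) : Prop :=
  (forall x, act 1%g x = x) /\
  (forall g h x, act (g * h)%g x = act g (act h x)).

(** * Completion of the tensor powers *)

Section TensorMatrices.
Variables (F : fieldType) (n : nat).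
Implicit Types d e : 'I_n -> nat.

(* Indices of the product basis of F^(d 0) (x) ... (x) F^(d (n-1)). *)
Definition tidx d : finType := {dffun forall i : 'I_n, 'I_(d i)}.

(* The Kronecker product of the matrices M i. *)
Definition tens d e (M : forall i, 'M[F]_(d i, e i)) : 'M[F]_(#|tidx d|, #|tidx e|) :=
  \matrix_(a, b) \prod_(i < n) M i ((enum_val a : tidx d) i) ((enum_val b : tidx e) i).

(* x acting on the i-th tensor factor. *)
Definition slot d (i : 'I_n) (x : forall j, 'M[F]_(d j)) :
    'M[F]_(#|tidx d|) :=
  tens (fun j => if j == i then x j else 1%:M).

Lemma big_dffun d (P : forall i, 'I_(d i) -> F) :
  \sum_(t : tidx d) \prod_(i < n) P i (t i) =
  \prod_(i < n) \sum_(j < d i) P i j.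
Proof.
pose T_ (i : 'I_n) : finType := 'I_(d i).
pose Pf (i : 'I_n) : {ffun T_ i -> F} := [ffun j => P i j].
have -> : \prod_(i < n) \sum_(j < d i) P i j =
          \prod_(i < n) \sum_(j : T_ i) Pf i j.
  by apply: eq_bigr => i _; apply: eq_bigr => j _; rewrite ffunE.
have tagE i : \sum_(j : T_ i) Pf i j =
    \sum_(j in tagged_with T_ i) untag 0 (Pf i) j.
  exact: (big_tag (fun i j => Pf i j) i).
rewrite (eq_bigr _ (fun i _ => tagE i)).
rewrite bigA_distr_big_dep.
rewrite (reindex (@dffun_of_fprod _ T_)) /=; last first.
  exact/onW_bij/dffun_of_fprod_bij.
transitivity (\sum_(t : fprod T_) \prod_(i < n) Pf i (t i)).
  by apply: eq_bigr => t _; apply: eq_bigr => i _; rewrite !ffunE.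
rewrite big_fprod; exact: eq_bigl.
Qed.

Lemma tens_mul d e f (M : forall i, 'M[F]_(d i, e i))
    (N : forall i, 'M[F]_(e i, f i)) :
  tens M *m tens N = tens (fun i => M i *m N i).
Proof.
apply/matrixP => a b; rewrite !mxE.
under [RHS]eq_bigr do rewrite mxE.
rewrite -(big_dffun (fun i j => M i _ j * N i j _)).
rewrite (reindex (enum_val : 'I_#|tidx e| -> tidx e)) /=; last first.
  exact/onW_bij/enum_val_bij.
by apply: eq_bigr => c _; rewrite !mxE big_split.
Qed.

Lemma eq_tens d e (M N : forall i, 'M[F]_(d i, e i)) :
  (forall i, M i = N i) -> tens M = tens N.
Proof.
by move=> MN; apply/matrixP => a b; rewrite !mxE; apply: eq_bigr => i _;
  rewrite MN.
Qed.

Lemma tens1 d : tens (fun i => 1%:M : 'M[F]_(d i)) = 1%:M.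
Proof.
apply/matrixP => a b; rewrite !mxE.
have [->|ab] := eqVneq a b.
  by rewrite big1 // => i _; rewrite mxE eqxx.
have /existsP [i abi] : [exists i, (enum_val a : tidx d) i != (enum_val b : tidx d) i].
  apply: contraNT ab => /existsPn h; apply/eqP/enum_val_inj/ffunP => i.
  by apply/eqP; have := h i; rewrite negbK.
by rewrite (bigD1 i) //= mxE (negPf abi) mul0r.
Qed.

Lemma slot_mul d i (x y : forall j, 'M[F]_(d j)) :
  slot i x *m slot i y = slot i (fun j => x j *m y j).
Proof.
rewrite /slot tens_mul; apply: eq_tens => j.
by case: eqP => // _; rewrite mul1mx.
Qed.

Lemma slot1 d i : slot i (fun j => 1%:M : 'M[F]_(d j)) = 1%:M.
Proof. by rewrite -tens1; apply: eq_tens => j; case: eqP. Qed.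

Lemma slot_comm d i j (x y : forall j, 'M[F]_(d j)) : i != j ->
  slot i x *m slot j y = slot j y *m slot i x.
Proof.
move=> ij; rewrite /slot !tens_mul; apply: eq_tens => l.
have [->|_] := eqVneq l i; first by rewrite (negPf ij) mul1mx mulmx1.
by rewrite mul1mx; case: eqP; rewrite ?mulmx1.
Qed.

Lemma slotE d i (x : forall j, 'M[F]_(d j)) a b :
  slot i x a b = x i ((enum_val a : tidx d) i) ((enum_val b : tidx d) i) *
  \prod_(j < n | j != i)
     ((enum_val a : tidx d) j == (enum_val b : tidx d) j)%:R.
Proof.
rewrite mxE (bigD1 i) //= eqxx; congr (_ * _).
by apply: eq_bigr => j ji; rewrite (negPf ji) mxE.
Qed.

Lemma slotD d i (x y : forall j, 'M[F]_(d j)) :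
  slot i x + slot i y = slot i (fun j => x j + y j).
Proof. by apply/matrixP => a b; rewrite mxE !slotE mxE mulrDl. Qed.

Lemma slotZ d i c (x : forall j, 'M[F]_(d j)) :
  c *: slot i x = slot i (fun j => c *: x j).
Proof. by apply/matrixP => a b; rewrite mxE !slotE mxE mulrA. Qed.

Lemma eq_slot d i (x y : forall j, 'M[F]_(d j)) :
  (forall j, x j = y j) -> slot i x = slot i y.
Proof. by move=> xy; apply: eq_tens => j; rewrite xy. Qed.

End TensorMatrices.

Section Completion.
Variable R : realType.
Local Notation k := (qfield R).

(* Finite-dimensional type 1 weight modules over U_q(sl_2), given in a basis of
   weight vectors: the j-th basis vector has weight q ^ (wt j), and matrices
   act on column vectors. *)
Record wmod := Wmod {
  wdim : nat;
  wt : 'I_wdim -> int;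
  wE : 'M[k]_wdim;
  wF : 'M[k]_wdim;
  wK : 'M[k]_wdim := diag_mx (\row_j q ^ wt j);
  wKi : 'M[k]_wdim := diag_mx (\row_j q ^ (- wt j));
  wKE : wK *m wE = q ^+ 2 *: (wE *m wK);
  wKF : wK *m wF = q ^- 2 *: (wF *m wK);
  wEF : wE *m wF - wF *m wE = (q - q^-1)^-1 *: (wK - wKi) }.

Definition wop (V : wmod) (a : ugen) : 'M[k]_(wdim V) :=
  match a with gE => wE V | gF => wF V | gK => wK V | gKi => wKi V end.

Definition whom (V W : wmod) (f : 'M[k]_(wdim W, wdim V)) : Prop :=
  forall a, f *m wop V a = wop W a *m f.

Variable n : nat.
Implicit Types V W : 'I_n -> wmod.

Definition tdim V := fun i => wdim (V i).
Local Notation TV V := #|tidx (tdim V)|.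

(* Families of endomorphisms of the V_1 (x) ... (x) V_n. *)
Definition family := forall V, 'M[k]_(TV V).

Definition natural (x : family) : Prop :=
  forall V W (f : forall i, 'M[k]_(wdim (W i), wdim (V i))),
    (forall i, whom (f i)) ->
    x W *m tens (d := tdim W) (e := tdim V) f =
    tens (d := tdim W) (e := tdim V) f *m x V.

(* The algebra of natural endomorphisms of (V_1, ..., V_n) |-> V_1 (x) ... (x) V_n
   on finite-dimensional type 1 weight modules. *)
Record completion := Completion {
  compl_fam :> forall V, 'M[k]_(TV V);
  compl_nat : natural compl_fam }.

Definition uop V (ia : 'I_n * ugen) : 'M[k]_(TV V) :=
  slot (d := tdim V) ia.1 (fun j => wop (V j) ia.2).

Fixpoint ueval V (t : pterm k ('I_n * ugen)) : 'M[k]_(TV V) :=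
  match t with
  | PGen x => uop V x
  | PScal c => c%:M
  | PAdd s t => ueval V s + ueval V t
  | PMul s t => ueval V s *m ueval V t
  end.

Lemma q_neq0 : q != 0 :> k.
Proof.
rewrite /q /qroot4 expf_neq0 // tofrac_eq0; by rewrite polyX_eq0.
Qed.

Lemma wKKi (V : wmod) : wK V *m wKi V = 1%:M.
Proof.
rewrite mulmx_diag -diag_const_mx; congr diag_mx.
by apply/rowP => l; rewrite !mxE -expfzDr ?q_neq0 // subrr expr0z.
Qed.

Lemma wKiK (V : wmod) : wKi V *m wK V = 1%:M.
Proof. exact: mulmx1C (wKKi V). Qed.

Lemma slotN V (i : 'I_n) (x : forall j, 'M[k]_(tdim V j)) :
  - slot i x = slot i (fun j => - x j).
Proof. by rewrite -scaleN1r slotZ; apply: eq_slot => j; rewrite scaleN1r. Qed.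

Lemma ueval_urel V s t : urel s t -> ueval V s = ueval V t.
Proof.
case=> {s t} [i|i|i|i|i|i j a b ij] /=; rewrite /uop /=.
- by rewrite slot_mul -[RHS](slot1 k (tdim V) i); apply: eq_slot => j; apply: wKKi.
- by rewrite slot_mul -[RHS](slot1 k (tdim V) i); apply: eq_slot => j; apply: wKiK.
- rewrite !slot_mul mul_scalar_mx slotZ; apply: eq_slot => j; exact: wKE.
- rewrite !slot_mul mul_scalar_mx slotZ; apply: eq_slot => j; exact: wKF.
- rewrite !slot_mul !mul_scalar_mx !slotZ !slotD slotZ.
  by apply: eq_slot => j; rewrite !scaleN1r; exact: wEF.
- exact: slot_comm.
Qed.

Lemma ueval_peq V s t : peq (@urel R n) s t -> ueval V s = ueval V t.
Proof.
elim=> {s t} /=.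
- exact: ueval_urel.
- by [].
- by [].
- by move=> s t u _ -> _ ->.
- by move=> s s' t t' _ -> _ ->.
- by move=> s s' t t' _ -> _ ->.
- by move=> s t u; rewrite addrA.
- by move=> s t; rewrite addrC.
- by move=> s; rewrite raddf0 add0r.
- by move=> s; rewrite mul_scalar_mx scaleN1r subrr raddf0.
- by move=> s t u; rewrite mulmxA.
- by move=> s; rewrite mul1mx.
- by move=> s t u; rewrite mulmxDl.
- by move=> s t u; rewrite mulmxDr.
- by move=> a b; rewrite raddfD.
- by move=> a b; rewrite mul_scalar_mx scale_scalar_mx.
- by move=> a s; rewrite scalar_mxC.
Qed.

Lemma ueval_natural t : natural (fun V => ueval V t).
Proof.
move=> V W f homf; elim: t => [[i a]|c|s IHs t IHt|s IHs t IHt] /=.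
- rewrite /uop /slot !tens_mul; apply: eq_tens => j /=.
  by case: eqP => [_|_]; rewrite ?mul1mx ?mulmx1 // homf.
- by rewrite scalar_mxC.
- by rewrite mulmxDl mulmxDr IHs IHt.
- by rewrite -mulmxA IHt !mulmxA IHs.
Qed.

(* The map from U^(x)n to its completion. *)
Definition to_completion (x : Utens R n) : completion :=
  Completion (ueval_natural (repr x)).

Lemma to_completion_pcl V t : to_completion (pcl (@urel R n) t) V = ueval V t.
Proof. by apply: ueval_peq; exact: repr_pcl. Qed.

(** * Braid group action on the completion *)

Variable i : 'I_n.-1.
Local Notation i0 := (strand i).
Local Notation i1 := (strandS i).

(* E raises weights, so its powers vanish from the dimension of V i0 on. *)
Definition Theta V : 'M[k]_(TV V) :=
  \sum_(m < wdim (V i0))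
    (q ^+ (m * m.-1)./2 * (q - q^-1) ^+ m / qfact m) *:
    slot (d := tdim V) i0 (fun j => wE (V j) ^+ m) *m
    slot (d := tdim V) i1 (fun j => wF (V j) ^+ m).

(* Psi^-1 (x (x) y) = x K^|y| (x) K^|x| y in the factors i0 and i1.  If the
   (a, b) entry of z is nonzero, then it belongs to the component of z with
   2|x| = wt(a_i0) - wt(b_i0) and 2|y| = wt(a_i1) - wt(b_i1). *)
Definition PsiInv V (z : 'M[k]_(TV V)) : 'M[k]_(TV V) :=
  \matrix_(a, b)
    let w j (c : 'I_(TV V)) : int := wt ((enum_val c : tidx (tdim V)) j) in
    qhalf ^ ((w i1 a - w i1 b) * w i0 b + (w i0 a - w i0 b) * w i1 a) * z a b.

Definition swapV V : 'I_n -> wmod := fun j => V (tperm i0 i1 j).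

(* The flip of the factors i0 and i1, from the tensor product of [swapV V] to
   that of V. *)
Definition flip V : 'M[k]_(TV V, TV (swapV V)) :=
  \matrix_(a, b) [forall j, (enum_val a : tidx (tdim V)) (tperm i0 i1 j)
                         == (enum_val b : tidx (tdim (swapV V))) j]%:R.

Definition braid_op (x : family) : family := fun V =>
  let V' := swapV V in
  flip V *m PsiInv (Theta V' *m x V' *m invmx (Theta V')) *m (flip V)^T.

End Completion.

(** * Kauffman bracket skein algebra of the punctured plane *)

Section Skein.
Variable R : realType.
Local Notation R2 := (R * R)%type.
Local Notation R3 := (R * R * R)%type.
Variable n : nat.

Definition puncture (j : nat) : R2 := (j%:R, 0).

(* Sigma_{0,n+1} x [0,1]; the last coordinate is the height. *)
Definition thick_surface : set R3 :=
  [set p | 0 <= p.2 <= 1 /\ forall j : 'I_n, p.1 <> puncture j].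

(* S^1 is [0,1] with its endpoints identified. *)
Definition circ_eq (t t' : R) : Prop :=
  t = t' \/ (t = 0 /\ t' = 1) \/ (t = 1 /\ t' = 0).

Definition strip : set R2 := [set p | 0 <= p.1 <= 1 /\ -1 <= p.2 <= 1].
Definition thick_strip : set R3 := [set p | strip p.1 /\ -1 <= p.2 <= 1].

(* A framed link is a disjoint union of annuli F c (S^1 x [-1/2,1/2] x {0}),
   where F embeds disjoint copies of S^1 x [-1,1] x [-1,1].  That the annuli
   are thickened by F makes them locally flat, so that there are no wild links
   and topological isotopy of thickened annuli is the usual isotopy of framed
   links; it also keeps the annuli in the interior of [thick_surface]. *)
Definition thick_embedding k (F : 'I_k -> R3 -> R3) : Prop :=
  [/\ forall c, {within thick_strip, continuous (F c)},
      forall c p, thick_strip p -> thick_surface (F c p),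
      forall c s u, -1 <= s <= 1 -> -1 <= u <= 1 -> F c (0, s, u) = F c (1, s, u) &
      forall c c' p p', thick_strip p -> thick_strip p' -> F c p = F c' p' ->
        [/\ c = c', circ_eq p.1.1 p'.1.1, p.1.2 = p'.1.2 & p.2 = p'.2]].

Definition annuli k (F : 'I_k -> R3 -> R3) : set R3 :=
  [set p | exists c t s,
    [/\ 0 <= t <= 1, - 2^-1 <= s <= 2^-1 & p = F c (t, s, 0)]].

Definition cores k (F : 'I_k -> R3 -> R3) : set R3 :=
  [set p | exists c t, 0 <= t <= 1 /\ p = F c (t, 0, 0)].

Record flink := FLink {
  flink_set :> set R3;
  flinkP : exists k (F : 'I_k -> R3 -> R3),
    thick_embedding F /\ flink_set = annuli F }.

Definition isotopic (L L' : flink) : Prop :=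
  exists k (G : R -> 'I_k -> R3 -> R3),
    [/\ forall t, 0 <= t <= 1 -> thick_embedding (G t),
        forall c, {within [set p : R * R3 | 0 <= p.1 <= 1 /\ thick_strip p.2],
                     continuous (fun p => G p.1 c p.2)},
        L = annuli (G 0) :> set R3 & L' = annuli (G 1) :> set R3].

(* L is an annulus contained in a horizontal plane, with core the simple closed
   curve g; in particular it has the blackboard framing. *)
Definition blackboard (L : set R3) (g : set R2) : Prop :=
  exists (f : R2 -> R2) (z : R),
    [/\ {within strip, continuous f},
        forall s, -1 <= s <= 1 -> f (0, s) = f (1, s),
        forall p p', strip p -> strip p' -> f p = f p' ->
          circ_eq p.1 p'.1 /\ p.2 = p'.2,
        L = [set p | exists t s,
          [/\ 0 <= t <= 1, - 2^-1 <= s <= 2^-1 & p = (f (t, s), z)]] &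
        g = [set p | exists2 t, 0 <= t <= 1 & p = f (t, 0)]].

Definition encloses (g : set R2) (p : R2) : Prop :=
  ~ g p /\ bounded_set (connected_component (~` g) p).

(* L represents s_A: the curve g passes below the puncture j if it does not meet
   the vertical half-line going up from j. *)
Definition is_s (A : {set 'I_n}) (L : flink) : Prop :=
  exists g : set R2,
    [/\ blackboard L g,
        forall j : 'I_n, encloses g (puncture j) <-> j \in A &
        forall j : 'I_n, j \notin A -> forall y, 0 <= y -> ~ g (j%:R, y)].

Definition below (p : R3) : R3 := (p.1, p.2 / 2).
Definition above (p : R3) : R3 := (p.1, (1 + p.2) / 2).

(** The skein relation takes place in a square of centre c and half-side r,
    with coordinates (a, b) in [-1,1]^2. *)

Definition in_box (c : R2) (r : R) (p : R2) : Prop :=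
  `|p.1 - c.1| <= r /\ `|p.2 - c.2| <= r.
Definition in_open_box (c : R2) (r : R) (p : R2) : Prop :=
  `|p.1 - c.1| < r /\ `|p.2 - c.2| < r.

(* Each picture is given by bands and by the centre lines of these bands; the
   bands have the same ends at a = -1 and a = 1 in the three pictures.  The
   strands of the crossing join the lower left end to the upper right end, and
   the upper left end to the lower right end. *)
Definition rising_band : set R2 := [set p | `|p.2 - p.1 / 2| <= 4^-1].
Definition rising_line : set R2 := [set p | p.2 = p.1 / 2].
Definition falling_band : set R2 := [set p | `|p.2 + p.1 / 2| <= 4^-1].
Definition falling_line : set R2 := [set p | p.2 = - (p.1 / 2)].
(* The upper ends are joined, and the lower ends are joined. *)
Definition upper_lower_bands : set R2 := [set p | 4^-1 <= `|p.2| <= 3 / 4].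
Definition upper_lower_lines : set R2 := [set p | `|p.2| = 2^-1].
(* The left ends are joined, and the right ends are joined. *)
Definition left_right_bands : set R2 :=
  [set p | [/\ 4^-1 <= `|p.1|, `|p.2| <= 3 / 4
             & 4^-1 <= `|p.2| \/ `|p.1| <= 3 / 4]].
Definition left_right_lines : set R2 :=
  [set p | (`|p.1| = 2^-1 /\ `|p.2| <= 2^-1) \/
           (2^-1 <= `|p.1| /\ `|p.2| = 2^-1)].

(* The graph of the height function h over the part B of the square. *)
Definition over_band (c : R2) (r : R) (B : set R2) (h : R2 -> R) : set R3 :=
  [set p | [/\ in_box c r p.1, B ((p.1.1 - c.1) / r, (p.1.2 - c.2) / r)
             & p.2 = h p.1]].

Definition inside (c : R2) (r : R) (L : set R3) : set R3 :=
  [set p | L p /\ in_box c r p.1].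
Definition outside (c : R2) (r : R) (L : set R3) : set R3 :=
  [set p | L p /\ ~ in_open_box c r p.1].

(* Inside the square, L consists of the annuli pieces B, and the cores of the
   annuli are the lines K: the condition on the cores ensures that the bands run
   along the link. *)
Definition picture (c : R2) (r : R) (L : flink) (B K : set R3) : Prop :=
  exists k (F : 'I_k -> R3 -> R3),
    [/\ thick_embedding F, L = annuli F :> set R3,
        inside c r (annuli F) = B & inside c r (cores F) = K].

Definition skein_triple (L L0 L1 : flink) : Prop :=
  exists (c : R2) (r : R),
    [/\ 0 < r /\ forall j : 'I_n, ~ in_box c r (puncture j),
        outside c r L0 = outside c r L /\ outside c r L1 = outside c r L,
        exists ho hu : R2 -> R,
          [/\ continuous ho, continuous hu,
              forall p, in_box c r p -> hu p < ho p &
              picture c r L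
                (over_band c r rising_band ho `|` over_band c r falling_band hu)
                (over_band c r rising_line ho `|` over_band c r falling_line hu)],
        exists2 h : R2 -> R, continuous h &
          picture c r L0 (over_band c r upper_lower_bands h)
                         (over_band c r upper_lower_lines h) &
        exists2 h : R2 -> R, continuous h &
          picture c r L1 (over_band c r left_right_bands h)
                         (over_band c r left_right_lines h)].

(* Since [sk_stack] makes products of links equal to links, the algebra
   presented below is the quotient of the free module on framed links by isotopy
   and the Kauffman bracket relations, with the product given by stacking. *)
Inductive skein_rel : pterm (qfield R) flink -> pterm (qfield R) flink -> Prop :=
| sk_isotopy L L' : isotopic L L' -> skein_rel (PGen L) (PGen L')
| sk_empty (L : flink) : flink_set L = set0 -> skein_rel (PGen L) 1%:S
| sk_stack (X Y XY : flink) : flink_set XY = (below @` X) `|` (above @` Y) ->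
    skein_rel (PGen X * PGen Y) (PGen XY)
| sk_circle (L : flink) g : blackboard L g ->
    (forall j : 'I_n, ~ encloses g (puncture j)) ->
    skein_rel (PGen L) (- q - q^-1)%:S
| sk_crossing L L0 L1 : skein_triple L L0 L1 ->
    skein_rel (PGen L) (qhalf%:S * PGen L0 + qhalf^-1%:S * PGen L1).

Definition skein := palg skein_rel.
Definition skein_class (L : flink) : skein := pgen skein_rel L.

(* Rotation about the midpoint of the punctures i and i+1, by the angle pi up to
   the distance 3/4, decreasing to 0 at the distance 1. *)
Definition half_twist (i : nat) (p : R2) : R2 :=
  let m := i%:R + 2^-1 in
  let u := p.1 - m in
  let d := Num.sqrt (u ^+ 2 + p.2 ^+ 2) in
  let a := pi * Num.min 1 (Num.max 0 (4 - 4 * d)) in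
  (m + (cos a * u - sin a * p.2), sin a * u + cos a * p.2).

Definition half_twist3 (i : nat) (p : R3) : R3 := (half_twist i p.1, p.2).

End Skein.

Section Actions.
Variables (R : realType) (n : nat).

(* beta_i acts on framed links by [half_twist i]. *)
Definition skein_braid_action (rho : braid n -> skein R n -> skein R n) : Prop :=
  [/\ is_action rho,
      forall b, alg_morphism (rho b) &
      forall (i : 'I_n.-1) (L L' : flink R n),
        flink_set L' = half_twist3 i @` L ->
        rho (bgen i) (skein_class L) = skein_class L'].

(* beta_i acts by [braid_op i]. *)
Definition completion_braid_action
    (rho : braid n -> completion R n -> completion R n) : Prop :=
  is_action rho /\
  forall (i : 'I_n.-1) (x : completion R n) V, rho (bgen i) x V = braid_op i x V.

(* phi is the isomorphism s_A |-> - Lambda_A. *)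
Definition skein_AW_iso (phi : skein R n -> Utens R n) : Prop :=
  [/\ alg_morphism phi, injective phi,
      forall y, AW y <-> exists x, phi x = y &
      forall (A : {set 'I_n}) (L : flink R n), A != finset.set0 -> is_s A L ->
        phi (skein_class L) = - Lambda A].

End Actions.

(* Main.v *)
(* It is enough to treat one Artin generator beta_i and, since it acts by algebra
   automorphisms, to check the claim on generators.  Each Lambda_A is a product
   of 4 x 4 transfer matrices, one per tensor factor, the factor j contributing
   the matrix of Delta or of tau_L according to whether j is in A; conjugation
   by the R-matrix thus acts on the two factors i and i+1 only, and it sends
   Lambda_A to Lambda_A' with A' the image of A under the transposition,
   provided that A does not contain i+1 without i.  The half twist sends a curve
   s_A to s_A' under the same condition.  The remaining Lambda_A are obtained
   from these by an Askey-Wilson relation, except Lambda_{i+1}, a Casimir, for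
   which a small circle around the puncture i+1 is rotated. *)

(* The value of [phi] is prescribed on every link representing s_A, so no isotopy has to be built:
   for each A one explicit link suffices, chosen so that its image under the half twist again
   satisfies [is_s]. The restriction on A comes from the direction of the twist: the anti-clockwise
   rotation carries puncture i below puncture i+1, and the curve keeps passing below the excluded
   punctures; this can fail only when i+1 is enclosed and i is not. On the algebraic side the
   obstacle is that Lambda_A is defined through graphs of Delta and tau_L, and tau_L lives on a
   subalgebra for which no presentation is at hand. It is identified with the braiding of x (x) 1.
   Weight modules separate the elements of U^(x)n, which is where the PBW monomials enter; hence the
   braiding has at most one value in U^(x)n, and the graph of tau_L is that of a function. Braiding
   itself is handled as a relation S x = y S, stable under sums and products, so that it only has to
   be checked on a few elements. *)
Require Import Defs.
From HB Require Import structures.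
From mathcomp Require Import all_boot all_order all_algebra perm ring lra zify.
From mathcomp Require Import all_classical all_reals all_analysis.

Set Implicit Arguments.
Unset Strict Implicit.
Unset Printing Implicit Defensive.

Import Order.TTheory GRing.Theory Num.Theory.

Local Open Scope ring_scope.

(** * Algebras with central scalars *)

(* MathComp's [algType] requires [1 != 0], which fails for matrices of size 0
   and would have to be proved for presented algebras; so an algebra is a ring
   with a central image of the field. *)
Record central_scalars (F : fieldType) (A : pzRingType) (iota : F -> A) : Prop :=
  CentralScalars {
    csD : {morph iota : a b / a + b};
    csM : {morph iota : a b / a * b};
    cs1 : iota 1 = 1;
    csC : forall c x, iota c * x = x * iota c }.

Section CentralScalarsTheory.
Variables (F : fieldType) (A : pzRingType) (iota : F -> A).
Hypothesis cs : central_scalars iota.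

Lemma cs0 : iota 0 = 0.
Proof. by apply: (addrI (iota 0)); rewrite -(csD cs) !addr0. Qed.
Lemma csN : {morph iota : a / - a}.
Proof. by move=> a; apply: (addrI (iota a)); rewrite -(csD cs) !subrr cs0. Qed.

Lemma csCA c x y : x * (iota c * y) = iota c * (x * y).
Proof. by rewrite mulrA -(csC cs) mulrA. Qed.

End CentralScalarsTheory.

Lemma matrix_scalars (F : fieldType) n :
  central_scalars (@scalar_mx F n : F -> 'M[F]_n).
Proof.
split=> //.
- exact: raddfD.
- by move=> a b; rewrite scalar_mxM.
- by move=> c x; rewrite -!mulmxE scalar_mxC.
Qed.

Section PresentedAlgebraTheory.
Variables (F : fieldType) (X : Type).
Variable r : pterm F X -> pterm F X -> Prop.

Definition pscal (c : F) : palg r := c *: (1 : palg r).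

Lemma palgZ (c : F) (x : palg r) : c *: x = pscal c * x.
Proof. by rewrite /pscal -palg_scaleAl mul1r. Qed.

Lemma palg_scalars : central_scalars pscal.
Proof.
split.
- by move=> a b; rewrite /pscal scalerDl.
- by move=> a b; rewrite -palgZ /pscal scalerA.
- by rewrite /pscal scale1r.
- by move=> c x; rewrite /pscal -palg_scaleAl -palg_scaleAr mul1r mulr1.
Qed.

Lemma pcl_add s t : pcl r (s + t)%PT = pcl r s + pcl r t.
Proof. by rewrite -pclD. Qed.
Lemma pcl_mul s t : pcl r (s * t)%PT = pcl r s * pcl r t.
Proof. by rewrite -pclM. Qed.
Lemma pcl_scal c : pcl r (c%:S)%PT = pscal c.
Proof.
rewrite [RHS](pclZ r c (1%:S)%PT); apply/pclP.
by rewrite -{1}[c]mulr1; apply: peq_scalM.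
Qed.

End PresentedAlgebraTheory.

Section Evaluation.
Variables (F : fieldType) (X : Type) (A : pzRingType) (iota : F -> A).
Hypothesis cs : central_scalars iota.

Fixpoint peval (v : X -> A) (t : pterm F X) : A :=
  match t with
  | PGen x => v x
  | PScal c => iota c
  | PAdd s t => peval v s + peval v t
  | PMul s t => peval v s * peval v t
  end.

Lemma peval_peq (r : pterm F X -> pterm F X -> Prop) v s t :
  (forall s t, r s t -> peval v s = peval v t) ->
  peq r s t -> peval v s = peval v t.
Proof.
move=> rv; elim=> {s t} /=.
- exact: rv.
- by [].
- by [].
- by move=> s t u _ -> _ ->.
- by move=> s s' t t' _ -> _ ->.
- by move=> s s' t t' _ -> _ ->.
- by move=> s t u; rewrite addrA.
- by move=> s t; rewrite addrC.
- by move=> s; rewrite (cs0 cs) add0r.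
- by move=> s; rewrite (csN cs) (cs1 cs) mulN1r subrr (cs0 cs).
- by move=> s t u; rewrite mulrA.
- by move=> s; rewrite (cs1 cs) mul1r.
- by move=> s t u; rewrite mulrDl.
- by move=> s t u; rewrite mulrDr.
- by move=> a b; rewrite (csD cs).
- by move=> a b; rewrite (csM cs).
- by move=> a s; rewrite (csC cs).
Qed.

(** The morphism out of the presented algebra induced by [v]: the value does not depend on the
    representative once [v] respects the relations. *)
Definition pext (r : pterm F X -> pterm F X -> Prop) v (x : palg r) : A :=
  peval v (repr x).

Variables (r : pterm F X -> pterm F X -> Prop) (v : X -> A).
Hypothesis rv : forall s t, r s t -> peval v s = peval v t.

Lemma pext_pcl s : pext v (pcl r s) = peval v s.
Proof. exact: peval_peq rv (repr_pcl _ _). Qed.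

Lemma pextD (x y : palg r) : pext v (x + y) = pext v x + pext v y.
Proof.
elim/palg_ind: x => s; elim/palg_ind: y => t.
by rewrite -pcl_add !pext_pcl.
Qed.

Lemma pextM (x y : palg r) : pext v (x * y) = pext v x * pext v y.
Proof.
elim/palg_ind: x => s; elim/palg_ind: y => t.
by rewrite -pcl_mul !pext_pcl.
Qed.

Lemma pext_scal c : pext v (pscal r c) = iota c.
Proof. by rewrite -pcl_scal pext_pcl. Qed.

Lemma pext_gen x : pext v (pgen r x) = v x.
Proof. exact: pext_pcl. Qed.

End Evaluation.

(** * Normal forms in U_q(sl_2) (x) U_q(sl_2) *)

Section TwoSites.
Variables (F : fieldType) (q : F).

(* A letter is a generator of the first (false) or second (true) factor. *)
Definition letter := (bool * ugen)%type.
Definition lincomb := seq (F * seq letter).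

(** The comparisons and list operations below are plain fixpoints, so that [cbv] can run them on
    concrete words while the coefficients remain symbolic elements of the field. *)
Definition letter_code (x : letter) : nat :=
  match x with
  | (false, gF) => 0 | (false, gK) => 1 | (false, gKi) => 2 | (false, gE) => 3
  | (true, gF) => 4 | (true, gK) => 5 | (true, gKi) => 6 | (true, gE) => 7
  end%N.

Fixpoint nat_same (m n : nat) : bool :=
  match m, n with
  | 0, 0 => true
  | m.+1, n.+1 => nat_same m n
  | _, _ => false
  end.

Fixpoint word_same (u w : seq letter) : bool :=
  match u, w with
  | [::], [::] => true
  | x :: u, y :: w =>
      if nat_same (letter_code x) (letter_code y) then word_same u w else false
  | _, _ => false
  end.

(** Rewriting rules towards a word F^a K^b E^c in the first factor followed by such a word in the
    second; [None] means that the two letters are already in order. *)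
Definition swap_letters (x y : letter) : option lincomb :=
  match x, y with
  | (true, a), (false, b) => Some [:: (1, [:: (false, b); (true, a)])]
  | (false, _), (true, _) => None
  | (s, a), (_, b) =>
    match a, b with
    | gE, gF => Some [:: (1, [:: (s, gF); (s, gE)]);
                         ((q - q^-1)^-1, [:: (s, gK)]);
                         (- (q - q^-1)^-1, [:: (s, gKi)])]
    | gK, gF => Some [:: (q ^- 2, [:: (s, gF); (s, gK)])]
    | gKi, gF => Some [:: (q ^+ 2, [:: (s, gF); (s, gKi)])]
    | gE, gK => Some [:: (q ^- 2, [:: (s, gK); (s, gE)])]
    | gE, gKi => Some [:: (q ^+ 2, [:: (s, gKi); (s, gE)])]
    | gK, gKi => Some [:: (1, [::])]
    | gKi, gK => Some [:: (1, [::])]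
    | _, _ => None
    end
  end.

Fixpoint lc_cat (l l' : lincomb) : lincomb :=
  match l with [::] => l' | p :: l => p :: lc_cat l l' end.

Fixpoint lc_scale (c : F) (l : lincomb) : lincomb :=
  match l with [::] => [::] | (c', w) :: l => (c * c', w) :: lc_scale c l end.

Fixpoint lc_bind (f : seq letter -> lincomb) (l : lincomb) : lincomb :=
  match l with
  | [::] => [::]
  | (c, w) :: l => lc_cat (lc_scale c (f w)) (lc_bind f l)
  end.

(** When [fuel] runs out the word is returned unreduced, which is still a correct value: soundness
    holds for every bound, and 100 only has to be large enough for the identities at hand. *)
Fixpoint mul_letter (fuel : nat) (x : letter) (w : seq letter) : lincomb :=
  match fuel, w with
  | fuel.+1, y :: w' =>
    match swap_letters x y with
    | None => [:: (1, x :: w)]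
    | Some l => lc_bind (fun u =>
        (fix mul_word u := match u with
         | [::] => [:: (1, w')]
         | z :: u => lc_bind (mul_letter fuel z) (mul_word u)
         end) u) l
    end
  | _, _ => [:: (1, x :: w)]
  end.

Fixpoint mul_word (u w : seq letter) : lincomb :=
  match u with
  | [::] => [:: (1, w)]
  | z :: u => lc_bind (mul_letter 100 z) (mul_word u w)
  end.

Fixpoint normal_form (t : pterm F letter) : lincomb :=
  match t with
  | PGen x => [:: (1, [:: x])]
  | PScal c => [:: (c, [::])]
  | PAdd s t => lc_cat (normal_form s) (normal_form t)
  | PMul s t => let m := normal_form t in
                lc_bind (fun u => lc_bind (mul_word u) m) (normal_form s)
  end.

Fixpoint lc_insert (c : F) (w : seq letter) (l : lincomb) : lincomb :=
  match l with
  | [::] => [:: (c, w)]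
  | (c', w') :: l =>
    if word_same w w' then (c + c', w') :: l else (c', w') :: lc_insert c w l
  end.

Fixpoint lc_collect (l : lincomb) : lincomb :=
  match l with [::] => [::] | (c, w) :: l => lc_insert c w (lc_collect l) end.

Fixpoint lc_null (l : lincomb) : Prop :=
  match l with [::] => True | (c, _) :: l => c = 0 /\ lc_null l end.

Section OneSite.
Variables (A : pzRingType) (iota : F -> A).

Record one_site (v : ugen -> A) : Prop := OneSite {
  os_KKi : v gK * v gKi = 1;
  os_KiK : v gKi * v gK = 1;
  os_KE : v gK * v gE = iota (q ^+ 2) * (v gE * v gK);
  os_KF : v gK * v gF = iota (q ^- 2) * (v gF * v gK);
  os_EF : v gE * v gF - v gF * v gE = iota (q - q^-1)^-1 * (v gK - v gKi) }.

Record two_sites (v : letter -> A) : Prop := TwoSites {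
  ts_scal : central_scalars iota;
  ts_site s : one_site (fun a => v (s, a));
  ts_comm a b : v (true, a) * v (false, b) = v (false, b) * v (true, a) }.

Variable v : ugen -> A.
Hypotheses (cs : central_scalars iota) (q0 : q != 0) (os : one_site v).

Lemma os_KiE : v gE * v gKi = iota (q ^+ 2) * (v gKi * v gE).
Proof.
rewrite -[LHS]mul1r -(os_KiK os) -mulrA [v gK * _]mulrA (os_KE os).
by rewrite -!mulrA (os_KKi os) mulr1 !mulrA (csC cs).
Qed.

Lemma os_KiF : v gKi * v gF = iota (q ^+ 2) * (v gF * v gKi).
Proof.
rewrite -[LHS]mulr1 -(os_KKi os) !mulrA; congr (_ * _).
rewrite -!mulrA -[v gF * v gK]mul1r -(cs1 cs).
rewrite -(mulfV (expf_neq0 2 q0)) (csM cs) -[_ * _ * (_ * _)]mulrA -(os_KF os).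
by rewrite mulrA -(csC cs) -!mulrA; congr (_ * _); rewrite mulrA (os_KiK os) mul1r.
Qed.

Lemma os_EK : v gE * v gK = iota (q ^- 2) * (v gK * v gE).
Proof.
by rewrite (os_KE os) mulrA -(csM cs) mulVf ?expf_neq0 // (cs1 cs) mul1r.
Qed.

End OneSite.

Section Soundness.
Variables (A : pzRingType) (iota : F -> A) (v : letter -> A).
Hypotheses (q0 : q != 0) (ts : two_sites iota v).
Let cs := ts_scal ts.

Fixpoint word_val (w : seq letter) : A :=
  match w with [::] => 1 | x :: w => v x * word_val w end.

Fixpoint lc_val (l : lincomb) : A :=
  match l with [::] => 0 | (c, w) :: l => iota c * word_val w + lc_val l end.

Lemma lc_val_cat l l' : lc_val (lc_cat l l') = lc_val l + lc_val l'.
Proof. by elim: l => [|[c w] l IH] /=; rewrite ?add0r // IH addrA. Qed.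

Lemma lc_val_scale c l : lc_val (lc_scale c l) = iota c * lc_val l.
Proof.
by elim: l => [|[c' w] l IH] /=; rewrite ?mulr0 // IH (csM cs) mulrDr mulrA.
Qed.

Lemma lc_val_bind f l z :
  (forall w, lc_val (f w) = z * word_val w) -> lc_val (lc_bind f l) = z * lc_val l.
Proof.
move=> fz; elim: l => [|[c w] l IH] /=; rewrite ?mulr0 //.
by rewrite lc_val_cat lc_val_scale IH fz mulrDr !mulrA (csC cs).
Qed.

Lemma lc_val_bindl f l z :
  (forall w, lc_val (f w) = word_val w * z) -> lc_val (lc_bind f l) = lc_val l * z.
Proof.
move=> fz; elim: l => [|[c w] l IH] /=; rewrite ?mul0r //.
by rewrite lc_val_cat lc_val_scale IH fz mulrDl !mulrA.
Qed.

Lemma swap_lettersP x y l : swap_letters x y = Some l -> lc_val l = v x * v y.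
Proof.
case: x y => [s a] [s' b].
have [KKi KiK _ KF EF] := ts_site ts s.
have KiE := os_KiE cs (ts_site ts s); have KiF := os_KiF cs q0 (ts_site ts s).
have EK := os_EK cs q0 (ts_site ts s).
have same : swap_letters (s, a) (s, b) = Some l -> lc_val l = v (s, a) * v (s, b).
  case: s KKi KiK KF EF KiE KiF EK => /=;
    case: a b => [] [] // KKi KiK KF EF KiE KiF EK [<-] /=;
    rewrite ?(cs1 cs) ?mul1r ?mulr1 ?addr0 //;
    by rewrite (csN cs) mulNr -mulrBr -EF addrC -addrA addNr addr0.
case: s s' same {KKi KiK KF EF KiE KiF EK} => [] [] // _ [<-] /=.
by rewrite (cs1 cs) mul1r mulr1 addr0 (ts_comm ts).
Qed.

Lemma mul_letterP fuel x w : lc_val (mul_letter fuel x w) = v x * word_val w.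
Proof.
elim: fuel x w => [|fuel IH] x [|y w] /=;
  rewrite ?(cs1 cs) ?mul1r ?addr0 //.
case xy: (swap_letters x y) => [l|] /=; last by rewrite (cs1 cs) mul1r addr0.
rewrite mulrA -(swap_lettersP xy); apply: lc_val_bindl.
elim=> [|z u IHu] /=; first by rewrite (cs1 cs) addr0.
by rewrite (lc_val_bind _ (IH z)) IHu mulrA.
Qed.

Lemma mul_wordP u w : lc_val (mul_word u w) = word_val u * word_val w.
Proof.
elim: u => [|z u IHu]; first by rewrite /= (cs1 cs) addr0.
by rewrite /mul_word -/mul_word (lc_val_bind _ (mul_letterP 100 z)) IHu /= mulrA.
Qed.

Lemma normal_formP t : lc_val (normal_form t) = peval iota v t.
Proof.
elim: t => [x|c|s IHs t IHt|s IHs t IHt] /=.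
- by rewrite (cs1 cs) mul1r mulr1 addr0.
- by rewrite mulr1 addr0.
- by rewrite lc_val_cat IHs IHt.
- rewrite -IHs -IHt; apply: lc_val_bindl => u; apply: lc_val_bind => w.
  exact: mul_wordP.
Qed.

Lemma word_sameP u w : word_same u w -> u = w.
Proof.
elim: u w => [|x u IH] [|y w] //=; case xy: (nat_same _ _) => // /IH ->.
by congr (_ :: _); case: x y xy => [[] []] [[] []].
Qed.

Lemma lc_val_insert c w l : lc_val (lc_insert c w l) = iota c * word_val w + lc_val l.
Proof.
elim: l => [|[c' w'] l IH] //=.
case: ifP => [/word_sameP <-|_] /=; first by rewrite (csD cs) mulrDl addrA.
by rewrite IH addrCA.
Qed.

Lemma lc_val_collect l : lc_val (lc_collect l) = lc_val l.
Proof. by elim: l => [|[c w] l IH] //=; rewrite lc_val_insert IH. Qed.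

Lemma lc_val_null l : lc_null l -> lc_val l = 0.
Proof.
by elim: l => [|[c w] l IH] //= [-> /IH ->]; rewrite (cs0 cs) mul0r addr0.
Qed.

(** Soundness of the rewriting is all that is used: if each collected coefficient of the difference
    vanishes, the two sides agree in every algebra with two commuting images of U_q(sl_2). What
    remains to be proved, [lc_null], consists of equations in the field. *)
Lemma normal_form_eq s t :
  lc_null (lc_collect (normal_form (s - t)%PT)) -> peval iota v s = peval iota v t.
Proof.
move/lc_val_null; rewrite lc_val_collect normal_formP /= (csN cs) (cs1 cs) mulN1r.
by move/eqP; rewrite subr_eq0 => /eqP.
Qed.

End Soundness.
End TwoSites.

Ltac reify_alg F iota v e :=
  lazymatch e with
  | v ?x => constr:(@PGen F letter x)
  | iota ?c => constr:(@PScal F letter c)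
  | 1 => constr:(@PScal F letter 1)
  | 0 => constr:(@PScal F letter 0)
  | (?a + ?b)%R => let s := reify_alg F iota v a in
                   let t := reify_alg F iota v b in constr:(PAdd s t)
  | (?a * ?b)%R => let s := reify_alg F iota v a in
                   let t := reify_alg F iota v b in constr:(PMul s t)
  | (- ?a)%R => let s := reify_alg F iota v a in
                constr:(PMul (@PScal F letter (-1)) s)
  | (?a ^+ 2)%R => let s := reify_alg F iota v a in constr:(PMul s s)
  end.

Ltac uq_compute :=
  cbv [normal_form lc_collect lc_insert lc_null lc_bind lc_cat lc_scale
       mul_word mul_letter swap_letters word_same nat_same letter_code
       fst snd].

(* Proves an identity in the subalgebra generated by two commuting copies of
   U_q(sl_2), leaving the equations between scalars that do not follow by
   [field]. *)
Ltac uq_normalise ts q0 qq1 :=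
  match type of ts with
  | @two_sites ?F ?q ?A ?iota ?v =>
    match goal with |- ?l = ?r =>
      let s := reify_alg F iota v l in let t := reify_alg F iota v r in
      have : peval iota v s = peval iota v t;
      [ apply: (normal_form_eq q0 ts); uq_compute;
        repeat (match goal with |- _ /\ _ => split end);
        try exact: I; try by field; rewrite ?q0 ?qq1
      | rewrite /= ?expr2 ?mulN1r ?(csN (ts_scal ts)) ?(cs0 (ts_scal ts)) ?(cs1 (ts_scal ts)) ?mulN1r //]
    end
  end.

(** * Generic q: independence of characters and powers of the generators *)

Lemma q_expn_neq1 (R : realType) n : (0 < n)%N -> q ^+ n != 1 :> qfield R.
Proof.
move=> n0; rewrite /Defs.q /qroot4 -exprM -rmorphXn -(rmorph1 (@tofrac _)).
rewrite tofrac_eq; apply/eqP => /(congr1 (fun p => size (polyseq p))).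
by rewrite size_polyXn size_poly1; lia.
Qed.

Section GenericParameter.
Variables (F : fieldType) (q : F).
Hypotheses (q0 : q != 0) (qgen : forall n, (0 < n)%N -> q ^+ n != 1).

Lemma generic_expz_neq1 (z : int) : z != 0 -> q ^ z != 1.
Proof.
case: z => n; first by move=> n0; apply: qgen; rewrite lt0n.
by move=> _; rewrite -[q ^ _]/(q ^- n.+1) invr_eq1; apply: qgen.
Qed.

Lemma generic_expz_inj : injective (fun z : int => q ^ z).
Proof.
move=> y z yz; apply/eqP; rewrite -subr_eq0.
apply: contraTT isT => /generic_expz_neq1; rewrite expfzDr // yz -expfzDr //.
by rewrite subrr expr0z eqxx.
Qed.

Lemma generic_qq1 : q * q - 1 != 0.
Proof. by rewrite subr_eq0 -expr2 qgen. Qed.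

Lemma generic_subV n : (0 < n)%N -> q ^+ n - q ^- n != 0.
Proof.
move=> n0; rewrite subr_eq0; apply/eqP => e.
have := @qgen (n + n) (ltn_addl _ n0); rewrite exprD {2}e.
by rewrite mulfV ?eqxx // expf_neq0.
Qed.

End GenericParameter.

(** Dedekind's elimination: if [s] and [s0] differ at the coordinate i, the relation at d increased
    by one in that coordinate, minus [q ^ b s0 i] times the relation at d, is a shorter relation
    without [s0]. Only tuples d above D are considered because they will be highest weights of
    modules, which must be large enough. *)
Lemma characters_free (F : fieldType) (q : F) (I : eqType) m
    (b : I -> 'I_m -> int) (D : 'I_m -> nat) (T : seq I) (coef : I -> F) :
  q != 0 -> injective (fun z : int => q ^ z) ->
  uniq T -> {in T &, forall s t, b s =1 b t -> s = t} ->
  (forall d : 'I_m -> nat, (forall i, (D i <= d i)%N) ->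
     \sum_(s <- T) coef s * \prod_i q ^ (b s i * d i) = 0) ->
  {in T, forall s, coef s = 0}.
Proof.
move=> q0 qinj; elim: T coef => [|s0 T IH] coef //= /andP[s0T uT] binj sum0.
have T0 : {in T, forall s, coef s = 0}.
  move=> s sT; have [i bi] : exists i, b s i != b s0 i.
    apply/existsP; apply: contraNT s0T => /existsPn bs.
    suff -> : s0 = s by [].
    apply: binj => [||i]; rewrite ?mem_head ?inE ?sT ?orbT //.
    by apply/esym/eqP; have := bs i; rewrite negbK.
  pose coef' s := coef s * (q ^ b s i - q ^ b s0 i).
  have binjT : {in T &, forall s t, b s =1 b t -> s = t}.
    by move=> t u tT uT'; apply: binj; rewrite inE ?tT ?uT' orbT.
  have sum0T (d : 'I_m -> nat) : (forall i, (D i <= d i)%N) ->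
     \sum_(s <- T) coef' s * \prod_i q ^ (b s i * d i) = 0.
    move=> Dd; pose d' j := (d j + (j == i))%N.
    have := sum0 d' (fun j => leq_trans (Dd j) (leq_addr _ _)).
    have := sum0 d Dd; rewrite !big_cons.
    have d'E s' : \prod_j q ^ (b s' j * d' j) =
        q ^ b s' i * \prod_j q ^ (b s' j * d j).
      rewrite [LHS](bigD1 i) //= [in RHS](bigD1 i) //= mulrA; congr (_ * _).
        by rewrite -expfzDr // /d' eqxx PoszD mulrDr mulr1 addrC.
      by apply: eq_bigr => j ji; rewrite /d' (negPf ji) addn0.
    rewrite d'E; set x := \prod_j _ => e e'.
    transitivity
      ((coef s0 * (q ^ b s0 i * x) +
        \sum_(j <- T) coef j * \prod_l q ^ (b j l * d' l))
      - q ^ b s0 i * (coef s0 * x +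
          \sum_(j <- T) coef j * \prod_l q ^ (b j l * d l))); last first.
      by rewrite e e' mulr0 subrr.
    rewrite mulrDr opprD addrACA mulrCA subrr add0r mulr_sumr -sumrB.
    by apply: eq_bigr => t _; rewrite d'E /coef'; ring.
  have /eqP := IH coef' uT binjT sum0T s sT.
  rewrite mulf_eq0 subr_eq0 => /orP[/eqP //|/eqP/qinj e].
  by rewrite e eqxx in bi.
move=> s; rewrite inE => /orP[/eqP ->|/T0 //].
have := sum0 D (fun=> leqnn _); rewrite big_cons [X in _ + X]big_seq [X in _ + X]big1 => [|t tT]; rewrite ?addr0.
  move=> /eqP; rewrite mulf_eq0 => /orP[/eqP //|].
  by rewrite prodf_seq_eq0 => /hasP[i _]; rewrite (negPf (expfz_neq0 _ q0)).
by rewrite (T0 t tT) mul0r.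
Qed.

Section Powers.
Variables (F : fieldType) (q : F) (A : pzRingType) (iota : F -> A).
Variable v : ugen -> A.
Hypotheses (cs : central_scalars iota) (q0 : q != 0) (qq1 : q * q - 1 != 0).
Hypothesis os : one_site q iota v.

Definition qnum n : F := (q ^+ n - q ^- n) / (q - q^-1).

Lemma skew_exp (x y : A) (c : F) n :
  x * y = iota c * (y * x) -> x * y ^+ n = iota (c ^+ n) * (y ^+ n * x).
Proof.
move=> xy; elim: n => [|n IH]; first by rewrite !expr0 (cs1 cs) mulr1 !mul1r.
rewrite exprSr mulrA IH -!mulrA xy exprSr (csM cs) -!mulrA; congr (_ * _).
by rewrite mulrA -(csC cs) !mulrA.
Qed.

Lemma os_KFn n : v gK * v gF ^+ n = iota ((q ^- 2) ^+ n) * (v gF ^+ n * v gK).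
Proof. exact/skew_exp/(os_KF os). Qed.
Lemma os_KiFn n : v gKi * v gF ^+ n = iota ((q ^+ 2) ^+ n) * (v gF ^+ n * v gKi).
Proof. exact/skew_exp/(os_KiF cs q0 os). Qed.
Lemma os_KEn n : v gK * v gE ^+ n = iota ((q ^+ 2) ^+ n) * (v gE ^+ n * v gK).
Proof. exact/skew_exp/(os_KE os). Qed.
Lemma os_KiEn n : v gKi * v gE ^+ n = iota ((q ^- 2) ^+ n) * (v gE ^+ n * v gKi).
Proof.
apply: skew_exp; rewrite (os_KiE cs os) mulrA -(csM cs).
by rewrite mulVf ?expf_neq0 // (cs1 cs) mul1r.
Qed.

(** An induction step with undetermined scalars a and b: the noncommutative rearrangement happens
    here, and the recurrence for the coefficients is left to [field] in [os_EFn]. *)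
Lemma os_EFS n a b :
  v gE * v gF ^+ n.+1 = v gF ^+ n.+1 * v gE +
    v gF ^+ n * (iota a * v gK - iota b * v gKi) ->
  v gE * v gF ^+ n.+2 = v gF ^+ n.+2 * v gE +
    v gF ^+ n.+1 * (iota ((q - q^-1)^-1 + a * q ^- 2) * v gK -
                    iota ((q - q^-1)^-1 + b * q ^+ 2) * v gKi).
Proof.
have EF : v gE * v gF = v gF * v gE + iota (q - q^-1)^-1 * (v gK - v gKi).
  by rewrite -(os_EF os) addrC subrK.
have KF : (iota a * v gK - iota b * v gKi) * v gF =
          v gF * (iota (a * q ^- 2) * v gK - iota (b * q ^+ 2) * v gKi).
  rewrite mulrBl -!mulrA (os_KF os) (os_KiF cs q0 os) mulrBr.
  by rewrite !(csCA cs _ (v gF)) !(csM cs) !mulrA.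
move=> IH; rewrite exprSr mulrA IH mulrDl -[_ * v gE * _]mulrA EF.
rewrite -[_ * (_ - _) * v gF]mulrA KF mulrDr mulrA -exprSr -addrA.
congr (_ + _); rewrite [X in _ + X]mulrA -exprSr -mulrDr; congr (_ * _).
by rewrite mulrBr addrACA -opprD -!mulrDl -!(csD cs).
Qed.

Lemma os_FES n a b :
  v gE ^+ n.+1 * v gF = v gF * v gE ^+ n.+1 +
    v gE ^+ n * (iota a * v gK - iota b * v gKi) ->
  v gE ^+ n.+2 * v gF = v gF * v gE ^+ n.+2 +
    v gE ^+ n.+1 * (iota ((q - q^-1)^-1 * (q ^+ 2) ^+ n.+1 + a) * v gK -
                    iota ((q - q^-1)^-1 * (q ^- 2) ^+ n.+1 + b) * v gKi).
Proof.
have EF : v gE * v gF = v gF * v gE + iota (q - q^-1)^-1 * (v gK - v gKi).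
  by rewrite -(os_EF os) addrC subrK.
have KE : (v gK - v gKi) * v gE ^+ n.+1 = v gE ^+ n.+1 *
    (iota ((q ^+ 2) ^+ n.+1) * v gK - iota ((q ^- 2) ^+ n.+1) * v gKi).
  by rewrite mulrBl os_KEn os_KiEn mulrBr !(csCA cs _ (v gE ^+ _)).
move=> IH; rewrite exprS -mulrA IH mulrDr mulrA EF mulrDl.
rewrite -[v gF * v gE * _]mulrA -exprS -addrA; congr (_ + _).
rewrite -[iota _ * _ * _]mulrA KE [v gE * _]mulrA -exprS.
rewrite -(csCA cs) -mulrDr; congr (_ * _).
by rewrite mulrBr !mulrA -!(csM cs) addrACA -opprD -!mulrDl -!(csD cs).
Qed.

Lemma os_EFn n : v gE * v gF ^+ n.+1 = v gF ^+ n.+1 * v gE +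
  v gF ^+ n * (iota (qnum n.+1 * q ^- n / (q - q^-1)) * v gK -
               iota (qnum n.+1 * q ^+ n / (q - q^-1)) * v gKi).
Proof.
elim: n => [|n /os_EFS ->].
  have -> : qnum 1 = 1 by rewrite /qnum; field; rewrite ?qq1 q0.
  rewrite !expr1 !expr0 divr1 !mul1r -mulrBr -(os_EF os) addrC subrK //.
have qn : q ^+ n != 0 by rewrite expf_neq0.
congr (_ + _ * (iota _ * _ - iota _ * _)); rewrite /qnum !exprS;
  by field; rewrite ?qq1 ?q0 ?qn.
Qed.

Lemma os_FEn n : v gE ^+ n.+1 * v gF = v gF * v gE ^+ n.+1 +
  v gE ^+ n * (iota (qnum n.+1 * q ^+ n / (q - q^-1)) * v gK -
               iota (qnum n.+1 * q ^- n / (q - q^-1)) * v gKi).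
Proof.
elim: n => [|n /os_FES ->].
  have -> : qnum 1 = 1 by rewrite /qnum; field; rewrite ?qq1 q0.
  rewrite !expr1 !expr0 divr1 !mul1r -mulrBr -(os_EF os) addrC subrK //.
have qn : q ^+ n != 0 by rewrite expf_neq0.
rewrite exprVn -exprM mulnC exprM expr2.
congr (_ + _ * (iota _ * _ - iota _ * _)); rewrite /qnum !exprS;
  by field; rewrite ?qq1 ?q0 ?qn.
Qed.

End Powers.

(** * PBW spanning set and faithfulness on weight modules *)

Section UtensTheory.
Variables (R : realType) (m : nat).
Local Notation k := (qfield R).
Local Notation U := (Utens R m).
Local Notation us := (pscal (@urel R m)).

Lemma ug_site i : one_site q us (fun a => ug a i : U).
Proof.
have cs := palg_scalars (@urel R m).
have rel s t : urel s t -> pcl (@urel R m) s = pcl (@urel R m) t.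
  by move=> st; apply/pclP/peq_rel.
split.
- by have := rel _ _ (urel_KKi R i); rewrite pcl_mul pcl_scal (cs1 cs).
- by have := rel _ _ (urel_KiK R i); rewrite pcl_mul pcl_scal (cs1 cs).
- by have := rel _ _ (urel_KE R i); rewrite !pcl_mul pcl_scal.
- by have := rel _ _ (urel_KF R i); rewrite !pcl_mul pcl_scal.
- have := rel _ _ (urel_EF R i).
  by rewrite !(pcl_add, pcl_mul, pcl_scal) (csN cs) (cs1 cs) !mulN1r.
Qed.

Lemma ug_comm i j a b : i != j -> ug a i * ug b j = ug b j * ug a i :> U.
Proof.
move=> ij; have /pclP : peq (@urel R m) _ _ := peq_rel (urel_comm R a b ij).
by rewrite !pcl_mul.
Qed.

Lemma ug_two_sites i j : i != j ->
  two_sites q us (fun x : letter => ug x.2 (if x.1 then j else i)).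
Proof.
move=> ij; split=> [|[]|a b]; [exact: palg_scalars|exact: ug_site|exact: ug_site|].
by apply: ug_comm; rewrite eq_sym.
Qed.

End UtensTheory.

Section Products.
Variables (I : eqType) (A : pzRingType) (B : I -> A).

(** The factor at j enters an ordered product as P x Q with P and Q independent of x, which gives
    linearity in that factor. *)
Lemma prod_update j r : uniq r -> j \in r ->
  exists P Q, forall x, \prod_(i <- r) (if i == j then x else B i) = P * x * Q.
Proof.
elim: r => [|i r IH] //= /andP[ir ur]; rewrite inE => /orP[/eqP ji|jr].
  exists 1, (\prod_(i <- r) B i) => x; rewrite big_cons -ji eqxx mul1r.
  congr (_ * _); apply: eq_big_seq => l lr; case: eqP => // lj.
  by rewrite -ji -lj lr in ir.
have [P [Q PQ]] := IH ur jr.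
exists (B i * P), Q => x; rewrite big_cons PQ; case: eqP => [ij|_].
  by rewrite ij jr in ir.
by rewrite !mulrA.
Qed.

Lemma prod_commute g j r : uniq r -> j \in r ->
  (forall i, i != j -> g * B i = B i * g) ->
  g * \prod_(i <- r) B i = \prod_(i <- r) (if i == j then g * B i else B i).
Proof.
move=> ur jr gB; elim: r ur jr => [|i r IH] //= /andP[ir ur].
rewrite inE !big_cons mulrA => /orP[/eqP ji|jr].
  rewrite -ji eqxx; congr (_ * _).
  apply: eq_big_seq => l lr; case: eqP => // lj.
  by rewrite -ji -lj lr in ir.
have [ij|ij] := eqVneq i j; first by rewrite ij jr in ir.
by rewrite gB // -mulrA IH.
Qed.

End Products.

Section Spanning.
Variables (R : realType) (m : nat).
Local Notation k := (qfield R).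
Local Notation U := (Utens R m).
Local Notation us := (pscal (@urel R m)).
Local Notation cs := (palg_scalars (@urel R m)).

Definition ugz (i : 'I_m) (b : int) : U :=
  match b with Posz n => ug gK i ^+ n | Negz n => ug gKi i ^+ n.+1 end.

Definition pbw_block (i : 'I_m) (t : nat * int * nat) : U :=
  ug gF i ^+ t.1.1 * ugz i t.1.2 * ug gE i ^+ t.2.

Definition pbw (s : {ffun 'I_m -> nat * int * nat}) : U :=
  \prod_(i < m) pbw_block i (s i).

Definition pbw_sum (l : seq (k * {ffun 'I_m -> nat * int * nat})) : U :=
  \sum_(p <- l) us p.1 * pbw p.2.

Lemma ugz_K i b : ug gK i * ugz i b = ugz i (b + 1).
Proof.
case: b => [n|[|n]].
- have -> : (Posz n + 1 = Posz n.+1)%R by lia.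
  by rewrite /= -exprS.
- by rewrite /= expr1 (os_KKi (ug_site _ i)).
- have -> : (Negz n.+1 + 1 = Negz n)%R by lia.
  by rewrite /= exprS mulrA (os_KKi (ug_site _ i)) mul1r.
Qed.

Lemma ugz_Ki i b : ug gKi i * ugz i b = ugz i (b - 1).
Proof.
case: b => [[|n]|n].
- by rewrite /= mulr1.
- have -> : (Posz n.+1 - 1 = Posz n)%R by lia.
  by rewrite /= exprS mulrA (os_KiK (ug_site _ i)) mul1r.
- have -> : (Negz n - 1 = Negz n.+1)%R by lia.
  by rewrite /= -exprS.
Qed.

Lemma ugz_E i b : exists c, ug gE i * ugz i b = us c * (ugz i b * ug gE i).
Proof.
have q0 := q_neq0 R; case: b => n.
  exists ((q ^- 2) ^+ n); exact: skew_exp cs _ _ _ _ (os_EK cs q0 (ug_site _ i)).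
exists ((q ^+ 2) ^+ n.+1); exact: skew_exp cs _ _ _ _ (os_KiE cs (ug_site _ i)).
Qed.

Lemma pbw_block_gen g i t : exists l : seq (k * (nat * int * nat)),
  ug g i * pbw_block i t = \sum_(p <- l) us p.1 * pbw_block i p.2.
Proof.
have q0 := q_neq0 R; have os := ug_site R i.
case: t => [[a b] c]; rewrite /pbw_block /=; case: g.
(* Moving E past a positive power of F costs the two Cartan terms of [os_EFn], which are absent for
   a = 0. *)
- have [z Ez] := ugz_E i b; case: a => [|a].
    exists [:: (z, (0%N, b, c.+1))]; rewrite big_cons big_nil addr0 /=.
    by rewrite !expr0 !mul1r mulrA Ez exprS !mulrA.
  exists [:: (z, (a.+1, b, c.+1));
    (qnum q a.+1 * q ^- a / (q - q^-1), (a, b + 1, c));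
    (- (qnum q a.+1 * q ^+ a / (q - q^-1)), (a, b - 1, c))].
  rewrite !big_cons big_nil addr0 /= !mulrA (os_EFn cs q0 (generic_qq1 (@q_expn_neq1 R)) os).
  rewrite !mulrDl; congr (_ + _).
    by rewrite -!mulrA [ug gE i * (_ * _)]mulrA Ez -mulrA (csCA cs) -[ugz i b * _ * _]mulrA -exprS.
  rewrite mulrBr !mulrDl !(csN cs) !mulNr -!mulrA -ugz_K -ugz_Ki !(csCA cs _ (ug gF i ^+ a)).
  by rewrite !mulrA.
- exists [:: (1, (a.+1, b, c))].
  by rewrite big_cons big_nil addr0 /= (cs1 cs) mul1r exprS !mulrA.
- exists [:: ((q ^- 2) ^+ a, (a, b + 1, c))].
  rewrite big_cons big_nil addr0 /= !mulrA (os_KFn cs os) -ugz_K.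
  by rewrite !mulrA.
- exists [:: ((q ^+ 2) ^+ a, (a, b - 1, c))].
  rewrite big_cons big_nil addr0 /= !mulrA (os_KiFn cs q0 os) -ugz_Ki.
  by rewrite !mulrA.
Qed.

Lemma pbw_block_comm a (i j : 'I_m) t : i != j ->
  ug a j * pbw_block i t = pbw_block i t * ug a j.
Proof.
move=> ij; have ji : j != i by rewrite eq_sym.
have cX b n : GRing.comm (ug a j) (ug b i ^+ n : U).
  by apply: commrX; apply: ug_comm.
by apply: commrM; first apply: commrM => //; case: t.1.2 => n; apply: cX.
Qed.

Lemma pbw_gen g j s : exists l, ug g j * pbw s = pbw_sum l.
Proof.
have [l El] := pbw_block_gen g j (s j).
have [P [Q PQ]] := prod_update (fun i => pbw_block i (s i)) (index_enum_uniq 'I_m) (mem_index_enum j).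
pose upd t : {ffun 'I_m -> nat * int * nat} := [ffun i => if i == j then t else s i].
exists [seq (p.1, upd p.2) | p <- l]; rewrite /pbw_sum big_map /=.
have updE t : pbw (upd t) = P * pbw_block j t * Q.
  rewrite -PQ; apply: eq_bigr => i _; rewrite ffunE.
  by case: eqP => // ->.
rewrite /pbw (prod_commute (j := j)) ?index_enum_uniq ?mem_index_enum //; last first.
  by move=> i ij; apply: pbw_block_comm.
transitivity (P * (ug g j * pbw_block j (s j)) * Q).
  by rewrite -PQ; apply: eq_bigr => i _; case: eqP => // ->.
rewrite El mulr_sumr mulr_suml; apply: eq_bigr => p _.
by rewrite -/(pbw _) updE (csCA cs) !mulrA.
Qed.

(** The span of the ordered monomials contains 1 and is stable under left multiplication by
    generators, hence by every term. *)
Lemma pbw_span (x : U) : exists l, x = pbw_sum l.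
Proof.
have spanD l l' : pbw_sum l + pbw_sum l' = pbw_sum (l ++ l').
  by rewrite /pbw_sum big_cat.
have spanZ c l : us c * pbw_sum l = pbw_sum [seq (c * p.1, p.2) | p <- l].
  rewrite /pbw_sum big_map mulr_sumr; apply: eq_bigr => p _ /=.
  by rewrite (csM cs) mulrA.
suff mulP t l : exists l', pcl (@urel R m) t * pbw_sum l = pbw_sum l'.
  elim/palg_ind: x => t; have [l' El] := mulP t [:: (1, [ffun=> (0%N, 0 : int, 0%N)])].
  exists l'; rewrite -El /pbw_sum big_cons big_nil addr0 (cs1 cs) mul1r /pbw big1 ?mulr1 // => i _.
  by rewrite ffunE /pbw_block /= !expr0 !mulr1.
elim: t l => [[i g]|c|s IHs t IHt|s IHs t IHt] l.
- elim: l => [|[c s] l [l' IH]].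
    by exists [::]; rewrite /pbw_sum !big_nil mulr0.
  have [l'' E] := pbw_gen g i s.
  exists ([seq (c * p.1, p.2) | p <- l''] ++ l').
  rewrite -spanD -IH -spanZ -E /pbw_sum big_cons mulrDr /=; congr (_ + _).
  by rewrite (csCA cs).
- by rewrite pcl_scal spanZ; eexists.
- have [l1 E1] := IHs l; have [l2 E2] := IHt l.
  by rewrite pcl_add mulrDl E1 E2 spanD; eexists.
- have [l2 E2] := IHt l; have [l1 E1] := IHs l2.
  by rewrite pcl_mul -mulrA E2 E1; eexists.
Qed.

End Spanning.

(** * The irreducible modules of dimension d + 1 *)

Section IrreducibleModule.
Variables (F : fieldType) (q : F).
Hypotheses (q0 : q != 0) (qgen : forall n, (0 < n)%N -> q ^+ n != 1).
Let qq1 := generic_qq1 qgen.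
Variable d : nat.

(** The basis is e_j = F^j e_0, of weight d - 2j, with E e_j = [j][d - j + 1] e_(j-1). *)
Definition irrE : 'M[F]_d.+1 :=
  \matrix_(r, c) ((qnum q c * qnum q (d - c).+1) *+ (r.+1 == c)).
Definition irrF : 'M[F]_d.+1 := \matrix_(r, c) (r == c.+1 :> nat)%:R.
Definition irr_wt (j : 'I_d.+1) : int := d%:Z - (j + j)%N%:Z.
Definition irrK : 'M[F]_d.+1 := diag_mx (\row_j q ^ irr_wt j).
Definition irrKi : 'M[F]_d.+1 := diag_mx (\row_j q ^ (- irr_wt j)).

Lemma qnum_neq0 n : (0 < n)%N -> qnum q n != 0.
Proof.
move=> n0; rewrite /qnum mulf_neq0 ?generic_subV ?invr_eq0 //.
by have := generic_subV q0 qgen (n := 1) isT; rewrite expr1.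
Qed.

Lemma irrKE : irrK *m irrE = q ^+ 2 *: (irrE *m irrK).
Proof.
apply/matrixP => r c; rewrite mul_diag_mx mul_mx_diag !mxE.
case: eqP => [rc|_]; last by rewrite !mulr0n mul0r !mulr0.
have -> : irr_wt r = 2%:Z + irr_wt c by rewrite /irr_wt; lia.
by rewrite expfzDr // -exprnP; ring.
Qed.

Lemma irrKF : irrK *m irrF = q ^- 2 *: (irrF *m irrK).
Proof.
apply/matrixP => r c; rewrite mul_diag_mx mul_mx_diag !mxE.
case: eqP => [rc|_]; last by rewrite !mul0r !mulr0.
have -> : irr_wt c = 2%:Z + irr_wt r by rewrite /irr_wt; lia.
rewrite expfzDr // -exprnP mulr1 mul1r mulrA mulVf ?mul1r //.
by rewrite expf_neq0.
Qed.

Lemma qnum_comm m n :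
  qnum q m.+1 * qnum q n - qnum q m * qnum q n.+1 =
  (q - q^-1)^-1 * (q ^ (n%:Z - m%:Z) - q ^ (- (n%:Z - m%:Z))).
Proof.
rewrite opprB !expfzDr // -!exprnP -!exprnN /qnum !exprS.
have qm : q ^+ m != 0 by rewrite expf_neq0.
have qn : q ^+ n != 0 by rewrite expf_neq0.
by field; rewrite qm qn q0 qq1.
Qed.

Lemma irrEF : irrE *m irrF - irrF *m irrE = (q - q^-1)^-1 *: (irrK - irrKi).
Proof.
apply/matrixP => r c; rewrite !mxE.
have -> : \sum_j irrE r j * irrF j c =
    (qnum q c.+1 * qnum q (d - c)) *+ (r == c).
  have [cd|cd] := ltnP c d.
    have cd' : (c.+1 < d.+1)%N by [].
    rewrite (bigD1 (Ordinal cd')) //= big1 => [|j jc].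
      by rewrite !mxE /= eqxx mulr1 addr0 eqSS -subSn // subSS.
    rewrite !mxE (_ : (j == c.+1 :> nat) = false) ?mulr0 //.
    by apply/negbTE; apply: contraNneq jc => jc; apply/eqP/val_inj.
  (* At the lowest vector, c = d, every term of the sum vanishes and the expected coefficient
     contains [0] = 0; the case c = 0 below is the same at the other end. *)
  have -> : (d - c)%N = 0%N by lia.
  rewrite /qnum expr0 invr1 subrr mul0r mulr0 mul0rn big1 // => j _.
  rewrite !mxE (_ : (j == c.+1 :> nat) = false) ?mulr0 //.
  by apply/negbTE; have := ltn_ord j; lia.
have -> : \sum_j irrF r j * irrE j c =
    (qnum q c * qnum q (d - c).+1) *+ (r == c).
  case: (posnP c) => [c0|c0].
    rewrite c0 /qnum expr0 invr1 subrr !mul0r mul0rn big1 // => j _.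
    by rewrite !mxE c0 mulr0.
  have cd : (c.-1 < d.+1)%N by have := ltn_ord c; lia.
  rewrite (bigD1 (Ordinal cd)) //= big1 => [|j jc].
    rewrite !mxE /= prednK // eqxx mulr1n addr0 -val_eqE /=.
    by rewrite mulr_natl.
  rewrite !mxE (_ : (j.+1 == c :> nat) = false) ?mulr0n ?mulr0 //.
  apply/negbTE; apply: contraNneq jc => jc.
  by apply/eqP/val_inj => /=; rewrite -jc.
have [->|rc] := eqVneq r c; last by rewrite !mulr0n subrr mulr0.
rewrite !mulr1n qnum_comm; congr (_ * (q ^ _ - q ^ _)).
- by rewrite /irr_wt; have := ltn_ord c; lia.
- by rewrite /irr_wt; have := ltn_ord c; lia.
Qed.

Local Notation e j := (delta_mx j 0 : 'cV[F]_d.+1).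

Lemma mul_delta (X : 'M[F]_d.+1) j : X *m e j = col j X.
Proof. by rewrite colE. Qed.

Lemma irrE_delta (j j' : 'I_d.+1) : j = j'.+1 :> nat ->
  irrE *m e j = (qnum q j * qnum q (d - j).+1) *: e j'.
Proof.
move=> jj'; rewrite mul_delta; apply/matrixP => r c; rewrite !mxE (ord1 c) eqxx andbT.
by rewrite mulr_natr; congr (_ *+ _); rewrite jj' eqSS.
Qed.

Lemma irrE_delta0 : irrE *m e 0 = 0.
Proof. by rewrite mul_delta; apply/matrixP => r c; rewrite !mxE mulr0n. Qed.

Lemma irrE_exp_gt (c : nat) (j : 'I_d.+1) : (j < c)%N -> irrE ^+ c *m e j = 0.
Proof.
elim: c j => [|c IH] j // jc; rewrite exprSr -mulmxE -mulmxA.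
case: (posnP j) => [j0|j0].
  have -> : j = 0 by apply: val_inj.
  by rewrite irrE_delta0 mulmx0.
have jd : (j.-1 < d.+1)%N by have := ltn_ord j; lia.
rewrite (@irrE_delta j (Ordinal jd)) /= ?prednK // -scalemxAr IH ?scaler0 //=.
by lia.
Qed.

Lemma irrE_exp (c : nat) (j : 'I_d.+1) : c = j ->
  exists2 l : F, l != 0 & irrE ^+ c *m e j = l *: e 0.
Proof.
elim: c j => [|c IH] j cj.
  have -> : j = 0 by apply: val_inj.
  by exists 1; rewrite ?oner_eq0 // expr0 mul1mx scale1r.
have jd : (c < d.+1)%N by have := ltn_ord j; lia.
have [l l0 El] := IH (Ordinal jd) erefl.
exists (qnum q j * qnum q (d - j).+1 * l).
  have j0 : (0 < j)%N by rewrite -cj.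
  by rewrite mulf_neq0 // mulf_neq0 // qnum_neq0.
rewrite exprSr -mulmxE -mulmxA (@irrE_delta j (Ordinal jd)) /= -?cj //.
by rewrite -scalemxAr El scalerA.
Qed.

Lemma irrF_exp (a : nat) (j : 'I_d.+1) : (a <= d)%N -> a = j ->
  irrF ^+ a *m e 0 = e j.
Proof.
elim: a j => [|a IH] j ad aj.
  have -> : j = 0 by apply: val_inj.
  by rewrite expr0 mul1mx.
have jd : (a < d.+1)%N by lia.
rewrite exprS -mulmxE -mulmxA (IH (Ordinal jd)) ?(ltnW ad) //.
rewrite mul_delta; apply/matrixP => r c; rewrite !mxE (ord1 c) eqxx andbT /=.
by rewrite -val_eqE /= aj.
Qed.

Lemma irrF_exp_gt (a : nat) : (d < a)%N -> irrF ^+ a *m e 0 = 0.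
Proof.
elim: a => // a IH; rewrite ltnS leq_eqVlt exprS -mulmxE -mulmxA.
case/orP => [/eqP da|/IH ->]; last by rewrite mulmx0.
rewrite (@irrF_exp a ord_max) ?da // mul_delta.
apply/matrixP => r c; rewrite !mxE /= (_ : (r == d.+1 :> nat) = false) //.
by apply/negbTE; have := ltn_ord r; lia.
Qed.

Definition irrZ (b : int) : 'M[F]_d.+1 :=
  match b with Posz n => irrK ^+ n | Negz n => irrKi ^+ n.+1 end.

Lemma irrZ_delta0 b : irrZ b *m e 0 = q ^ (b * d) *: e 0.
Proof.
have diag_exp (v : 'rV[F]_d.+1) n : diag_mx v ^+ n *m e 0 = v 0 0 ^+ n *: e 0.
  elim: n => [|n IH]; first by rewrite !expr0 mul1mx scale1r.
  rewrite exprSr -mulmxE -mulmxA mul_delta.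
  have -> : col 0 (diag_mx v) = v 0 0 *: e 0.
    apply/matrixP => r c; rewrite !mxE (ord1 c) eqxx andbT.
    by case: (eqVneq r 0) => [->|]; rewrite ?mulr1n ?mulr0n ?mulr1 ?mulr0.
  by rewrite -scalemxAr IH scalerA exprS.
case: b => n; rewrite /irrZ diag_exp mxE /irr_wt /= addn0 subr0; congr (_ *: _).
  by rewrite -exprnP -exprM -[RHS]/(q ^+ _) mulnC.
by rewrite exprnP exprz_exp; congr (q ^ _); lia.
Qed.

Definition irr_block (t : nat * int * nat) :=
  irrF ^+ t.1.1 *m irrZ t.1.2 *m irrE ^+ t.2.

Lemma irr_block_gt t (a c : 'I_d.+1) : (c < t.2)%N -> irr_block t a c = 0.
Proof.
move=> ct; transitivity ((irr_block t *m e c) a 0); first by rewrite mul_delta [RHS]mxE.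
by rewrite /irr_block -mulmxA irrE_exp_gt // mulmx0 mxE.
Qed.

(** E^c sends e_c to a nonzero multiple of e_0, K^b scales e_0 by q^(b d), and the power of F moves
    it down. So the entry detects the exponent of F and sees the exponent of K as a character of d,
    while [l] is the same for all t. *)
Lemma irr_block_eq (a c : 'I_d.+1) : exists2 l : F, l != 0 &
  forall t : nat * int * nat, t.2 = c -> irr_block t a c = l * q ^ (t.1.2 * d) * (t.1.1 == a)%:R.
Proof.
have [l l0 El] := irrE_exp (erefl (c : nat)); exists l => // t tc.
transitivity ((irr_block t *m e c) a 0); first by rewrite mul_delta [RHS]mxE.
rewrite /irr_block -mulmxA tc El -!mulmxA -scalemxAr irrZ_delta0 -!scalemxAr.
rewrite scalerA mxE; congr (_ * _).
have [ad|ad] := leqP t.1.1 d.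
  have ad' : (t.1.1 < d.+1)%N by [].
  rewrite (@irrF_exp _ (Ordinal ad')) // mxE eqxx andbT -val_eqE /=.
  by rewrite eq_sym.
rewrite irrF_exp_gt // mxE (_ : (t.1.1 == a) = false) //.
by apply/negbTE; have := ltn_ord a; lia.
Qed.

End IrreducibleModule.

(** * Faithfulness of the weight modules *)

Section CompletionMorphism.
Variables (R : realType) (m : nat).
Local Notation k := (qfield R).
Local Notation us := (pscal (@urel R m)).
Implicit Types (x y : Utens R m) (V : 'I_m -> wmod R).

Lemma to_completionD x y V :
  to_completion (x + y) V = to_completion x V + to_completion y V.
Proof.
elim/palg_ind: x => s; elim/palg_ind: y => t.
by rewrite -pcl_add !to_completion_pcl.
Qed.

Lemma to_completionM x y V :
  to_completion (x * y) V = to_completion x V *m to_completion y V.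
Proof.
elim/palg_ind: x => s; elim/palg_ind: y => t.
by rewrite -pcl_mul !to_completion_pcl.
Qed.

Lemma to_completion_scal c V : to_completion (us c) V = c%:M.
Proof. by rewrite -pcl_scal to_completion_pcl. Qed.

Lemma to_completion_ug a i V :
  to_completion (ug a i) V = slot (d := tdim V) i (fun j => wop (V j) a).
Proof. by rewrite to_completion_pcl. Qed.

Lemma to_completion1 V : to_completion (1 : Utens R m) V = 1%:M.
Proof. by rewrite -(cs1 (palg_scalars _)) to_completion_scal. Qed.

Lemma to_completion0 V : to_completion (0 : Utens R m) V = 0.
Proof. by rewrite -(cs0 (palg_scalars _)) to_completion_scal raddf0. Qed.

Lemma to_completionB x y V :
  to_completion (x - y) V = to_completion x V - to_completion y V.
Proof.
by apply/eqP; rewrite eq_sym subr_eq -to_completionD subrK.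
Qed.

Lemma to_completionX x n V : to_completion (x ^+ n) V = to_completion x V ^+ n.
Proof.
elim: n => [|n IH]; first by rewrite !expr0 to_completion1.
by rewrite !exprS to_completionM IH.
Qed.

End CompletionMorphism.

Section Slots.
Variables (F : fieldType) (m : nat).
Implicit Types d : 'I_m -> nat.

Lemma slot_exp d i (x : forall j, 'M[F]_(d j)) n :
  slot i x ^+ n = slot i (fun j => x j ^+ n).
Proof.
elim: n => [|n IH]; first by rewrite expr0 slot1.
by rewrite exprS IH -mulmxE slot_mul; apply: eq_slot => j; rewrite exprS.
Qed.

Lemma prod_slot d (x : 'I_m -> forall j, 'M[F]_(d j)) (r : seq 'I_m) : uniq r ->
  \prod_(i <- r) slot i (x i) = tens (fun j => if j \in r then x j j else 1%:M).
Proof.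
elim: r => [_|i r IH /= /andP[ir ur]]; first by rewrite big_nil [RHS]tens1.
rewrite big_cons IH // -mulmxE tens_mul; apply: eq_tens => j.
rewrite inE; have [->|ji] := eqVneq j i; first by rewrite (negPf ir) mulmx1.
by rewrite mul1mx.
Qed.

End Slots.

Section Injectivity.
Variables (R : realType) (m : nat).
Local Notation k := (qfield R).
Local Notation us := (pscal (@urel R m)).
Local Notation mono := {ffun 'I_m -> nat * int * nat}.

Definition irr (d : nat) : wmod R :=
  Wmod (irrKE (q_neq0 R) (@q_expn_neq1 R) d)
    (irrKF (q_neq0 R) (@q_expn_neq1 R) d)
    (irrEF (q_neq0 R) (@q_expn_neq1 R) d).

Definition irrs (d : 'I_m -> nat) : 'I_m -> wmod R := fun i => irr (d i).

Lemma to_completion_pbw (s : mono) (d : 'I_m -> nat) :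
  to_completion (pbw R s) (irrs d) =
  tens (d := tdim (irrs d)) (e := tdim (irrs d)) (fun j => irr_block (q : k) (d j) (s j)).
Proof.
have block i : to_completion (pbw_block R i (s i)) (irrs d) =
    slot (d := tdim (irrs d)) i (fun j => irr_block (q : k) (d j) (s i)).
  rewrite /pbw_block !to_completionM !to_completionX !to_completion_ug.
  have -> : to_completion (ugz R i (s i).1.2) (irrs d) =
      slot (d := tdim (irrs d)) i (fun j => irrZ q (d j) (s i).1.2).
    by case: (s i).1.2 => n; rewrite /ugz to_completionX to_completion_ug slot_exp.
  by rewrite !slot_exp !slot_mul.
transitivity (\prod_(i < m) slot (d := tdim (irrs d)) i (fun j => irr_block (q : k) (d j) (s i))).
  rewrite /pbw; elim: (index_enum _) => [|i r IH]; first by rewrite !big_nil to_completion1.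
  by rewrite !big_cons to_completionM block IH.
rewrite (prod_slot (d := tdim (irrs d)) (fun i j => irr_block (q : k) (d j) (s i))) ?index_enum_uniq //.
by apply: eq_tens => j; rewrite mem_index_enum.
Qed.

(** Strong induction on the total exponent of E. For a given [s0], the matrix entry with row the
    exponents of F and column the exponents of E of [s0] receives, apart from monomials already
    known to have coefficient 0, only those that differ from [s0] by their exponents of K; letting d
    vary, these are separated as characters. *)
Lemma pbw_free (S : seq mono) (coef : mono -> k) : uniq S ->
  (forall d, to_completion (\sum_(s <- S) us (coef s) * pbw R s) (irrs d) = 0) ->
  {in S, forall s, coef s = 0}.
Proof.
move=> uS sum0.
have entry (d a c : 'I_m -> nat) :
    (forall i, (a i <= d i)%N) -> (forall i, (c i <= d i)%N) ->
    \sum_(s <- S) coef s *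
      \prod_i irr_block (q : k) (d i) (s i) (inord (a i)) (inord (c i)) = 0.
  move=> ad cd.
  pose ix (f : 'I_m -> nat) : tidx (tdim (irrs d)) := [ffun i => inord (f i)].
  have /matrixP/(_ (enum_rank (ix a)) (enum_rank (ix c))) := sum0 d.
  rewrite [RHS]mxE => e; rewrite -[RHS]e {e}.
  transitivity ((\sum_(s <- S) coef s *: tens (d := tdim (irrs d)) (e := tdim (irrs d))
     (fun j => irr_block (q : k) (d j) (s j))) (enum_rank (ix a)) (enum_rank (ix c))).
    rewrite summxE; apply: eq_bigr => s _; rewrite mxE [in RHS]mxE !enum_rankK.
    by congr (_ * _); apply: eq_bigr => i _; rewrite !ffunE.
  congr (fun_of_matrix _ _ _); elim: S {uS sum0} => [|s S' IH].
    by rewrite !big_nil to_completion0.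
  rewrite !big_cons to_completionD to_completionM IH to_completion_scal.
  by rewrite to_completion_pbw mul_scalar_mx.
have q0 := q_neq0 R; have qgen := @q_expn_neq1 R.
pose size (s : mono) := (\sum_i (s i).2)%N.
suff main N : {in S, forall s, size s = N -> coef s = 0} by move=> s sS; apply: main.
elim/ltn_ind: N => N IH s0 s0S s0N.
pose like (s : mono) := [forall i, ((s i).1.1 == (s0 i).1.1) && ((s i).2 == (s0 i).2)].
(* From this bound on, both the row index and the column index read off from [s0] exist in the
   module of highest weight d i. *)
pose D i := maxn (s0 i).1.1 (s0 i).2.
suff : {in [seq s <- S | like s], forall s, coef s = 0}.
  by apply; rewrite mem_filter s0S andbT; apply/forallP => i; rewrite !eqxx.
apply: (@characters_free _ _ mono m (fun s i => (s i).1.2) D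
  [seq s <- S | like s] coef q0 (generic_expz_inj q0 qgen)).
- exact: filter_uniq.
- move=> s t; rewrite !mem_filter => /andP[/forallP sl _] /andP[/forallP tl _] st.
  apply/ffunP => i; have := sl i; have := tl i; have := st i.
  case: (s i) => [[a b] c]; case: (t i) => [[a' b'] c'] /= ->.
  by move=> /andP[/eqP -> /eqP ->] /andP[/eqP -> /eqP ->].
move=> d Dd.
have ad i : ((s0 i).1.1 <= d i)%N by apply: leq_trans (Dd i); rewrite leq_maxl.
have cd i : ((s0 i).2 <= d i)%N by apply: leq_trans (Dd i); rewrite leq_maxr.
have [l l0 El] : exists2 l : 'I_m -> k, (forall i, l i != 0) &
    forall i (t : nat * int * nat), t.2 = (s0 i).2 ->
      irr_block (q : k) (d i) t (inord (s0 i).1.1) (inord (s0 i).2) =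
      l i * q ^ (t.1.2 * d i) * (t.1.1 == (s0 i).1.1)%:R.
  have ex i : exists l : k, l != 0 /\ forall t : nat * int * nat, t.2 = (s0 i).2 ->
      irr_block (q : k) (d i) t (inord (s0 i).1.1) (inord (s0 i).2) =
      l * q ^ (t.1.2 * d i) * (t.1.1 == (s0 i).1.1)%:R.
    have [l l0 El] := irr_block_eq q0 qgen (inord (s0 i).1.1 : 'I_(d i).+1) (inord (s0 i).2).
    exists l; split=> // t; have := El t; rewrite !inordK ?ltnS //.
  have [l El] := choice ex; exists l => i; first by case: (El i).
  by case: (El i).
have sumS := entry d (fun i => (s0 i).1.1) (fun i => (s0 i).2) ad cd.
rewrite big_filter big_mkcond /=.
have lp : \prod_i l i != 0 by apply/prodf_neq0 => i _; exact: l0.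
apply: (mulfI lp).
rewrite mulr0; apply: etrans _ sumS; rewrite mulr_sumr; apply: eq_big_seq => s sS.
have [sl|sl] := boolP (like s).
  rewrite mulrCA -big_split /=; congr (_ * _); apply: eq_bigr => i _.
  have /andP[/eqP ai /eqP ci] := forallP sl i.
  by rewrite El // ai eqxx mulr1.
rewrite mulr0; apply/esym/eqP; rewrite mulf_eq0.
have [lt|ge] := ltnP (size s) N; first by rewrite (IH _ lt s sS erefl) eqxx.
apply/orP; right; apply/eqP.
(* A larger exponent of E kills the column. Otherwise the exponents of E are at most those of [s0]
   and their sum is no smaller, so they are equal, and then some exponent of F differs. *)
have [/existsP[i ci]|/existsPn cle] := boolP [exists i, (s0 i).2 < (s i).2]%N.
  apply/eqP/prodf_eq0; exists i => //; apply/eqP.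
  by apply: (irr_block_gt q0 qgen); rewrite inordK ?ltnS.
have ceq i : (s i).2 = (s0 i).2.
  apply/eqP; rewrite eqn_leq leqNgt cle /=.
  have sizeE t : size t = ((t i).2 + \sum_(j | j != i) (t j).2)%N.
    by rewrite /size (bigD1 i).
  move: ge; rewrite -s0N !sizeE => ge.
  rewrite -(leq_add2r (\sum_(j | j != i) (s0 j).2)); apply: leq_trans ge _.
  by rewrite leq_add2l; apply: leq_sum => j _; rewrite leqNgt cle.
have [i ai] : exists i, (s i).1.1 != (s0 i).1.1.
  apply/existsP; apply: contraNT sl => /existsPn h; apply/forallP => i.
  by rewrite ceq eqxx andbT; have := h i; rewrite negbK.
apply/eqP/prodf_eq0; exists i => //; apply/eqP.
by rewrite El // (negPf ai) mulr0.
Qed.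

(** Irreducible modules already separate elements: after terms with the same monomial have been
    collected in [coef], the difference is a combination of distinct PBW monomials, to which
    [pbw_free] applies. *)
Lemma to_completion_inj (x y : Utens R m) :
  (forall V, to_completion x V = to_completion y V) -> x = y.
Proof.
move=> xy; apply/eqP; rewrite -subr_eq0; apply/eqP.
have {xy} : forall d, to_completion (x - y) (irrs d) = 0.
  by move=> d; rewrite to_completionB xy subrr.
move: (x - y) => {x y} x x0; have [l xl] := pbw_span x.
pose S := undup (unzip2 l); pose coef s := \sum_(p <- l | p.2 == s) p.1.
have cs := palg_scalars (@urel R m).
have xS : x = \sum_(s <- S) us (coef s) * pbw R s.
  rewrite xl /pbw_sum.
  transitivity (\sum_(s <- S) \sum_(p <- l | p.2 == s) us p.1 * pbw R p.2).
    rewrite (exchange_big_dep predT) //= big_seq [RHS]big_seq; apply: eq_bigr => p pl.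
    rewrite (big_rem p.2) /=; last by rewrite mem_undup map_f.
    rewrite eqxx big1_seq ?addr0 // => s /andP[/eqP <-].
    by rewrite mem_rem_uniq ?undup_uniq // inE eqxx.
  apply: eq_bigr => s _; rewrite /coef.
  have -> : us (\sum_(p <- l | p.2 == s) p.1) = \sum_(p <- l | p.2 == s) us p.1.
    by apply: (big_morph us (csD cs) (cs0 cs)).
  by rewrite mulr_suml; apply: eq_bigr => p /eqP ->.
have coef0 : {in S, forall s, coef s = 0}.
  by apply: pbw_free (undup_uniq _) _ => d; rewrite -xS x0.
by rewrite xS big_seq big1 // => s /coef0 ->; rewrite (cs0 cs) mul0r.
Qed.

End Injectivity.

(** For identities satisfied by Theta degree by degree: f has no term in degree 0, and none in
    degree N by nilpotence of E, so the shift of index leaves no boundary term. *)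
Lemma sum_telescope (A : pzRingType) (f g : nat -> A) N :
  f 0%N = 0 -> f N = 0 -> (forall m, f m.+1 = g m) ->
  \sum_(m < N) f m = \sum_(m < N) g m.
Proof.
move=> f0 fN fg; transitivity (\sum_(m < N.+1) f m).
  by rewrite big_ord_recr /= fN addr0.
by rewrite big_ord_recl f0 add0r; apply: eq_bigr => m _; exact: fg.
Qed.

(** * The quasi-R-matrix and the braiding *)

Section QuasiRMatrix.
Variables (F : fieldType) (q : F) (A : pzRingType) (iota : F -> A).
Variable v : letter -> A.
Hypotheses (q0 : q != 0) (qgen : forall n, (0 < n)%N -> q ^+ n != 1).
Hypothesis ts : two_sites q iota v.
Let cs := ts_scal ts.
Let qq1 := generic_qq1 qgen.

Local Notation E0 := (v (false, gE)). Local Notation F0 := (v (false, gF)).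
Local Notation K0 := (v (false, gK)). Local Notation J0 := (v (false, gKi)).
Local Notation E1 := (v (true, gE)). Local Notation F1 := (v (true, gF)).
Local Notation K1 := (v (true, gK)). Local Notation J1 := (v (true, gKi)).

Lemma ts_com a b : v (false, a) * v (true, b) = v (true, b) * v (false, a).
Proof. by rewrite (ts_comm ts). Qed.

Lemma ts_comX a b m n :
  v (true, b) ^+ n * v (false, a) ^+ m = v (false, a) ^+ m * v (true, b) ^+ n.
Proof. by apply: commrX; apply/commr_sym/commrX/(ts_com a b). Qed.

Lemma ts_comX1 a b m : v (true, b) * v (false, a) ^+ m = v (false, a) ^+ m * v (true, b).
Proof. by have := ts_comX a b m 1; rewrite expr1. Qed.
Lemma ts_comX2 a b n : v (true, b) ^+ n * v (false, a) = v (false, a) * v (true, b) ^+ n.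
Proof. by have := ts_comX a b 1 n; rewrite expr1. Qed.

Lemma iota_comb a b c x y z :
  iota a * (x * (iota b * y - iota c * z)) = iota (a * b) * (x * y) - iota (a * c) * (x * z).
Proof. by rewrite mulrBr !(csCA cs _ x) mulrBr !mulrA -!(csM cs). Qed.
Lemma iota_combl a b c x y z :
  iota a * ((iota b * y - iota c * z) * x) = iota (a * b) * (y * x) - iota (a * c) * (z * x).
Proof. by rewrite mulrBl mulrBr !mulrA -!(csM cs). Qed.

Let K0En m : K0 * E0 ^+ m = iota ((q ^+ 2) ^+ m) * (E0 ^+ m * K0).
Proof. exact: os_KEn cs (ts_site ts false) m. Qed.
Let J1Fn m : J1 * F1 ^+ m = iota ((q ^+ 2) ^+ m) * (F1 ^+ m * J1).
Proof. exact: os_KiFn cs q0 (ts_site ts true) m. Qed.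
Let E1Fn m : E1 * F1 ^+ m.+1 = F1 ^+ m.+1 * E1 +
  F1 ^+ m * (iota (qnum q m.+1 * q ^- m / (q - q^-1)) * K1 -
             iota (qnum q m.+1 * q ^+ m / (q - q^-1)) * J1).
Proof. exact: os_EFn cs q0 qq1 (ts_site ts true) m. Qed.
Let F0En m : E0 ^+ m.+1 * F0 = F0 * E0 ^+ m.+1 +
  E0 ^+ m * (iota (qnum q m.+1 * q ^+ m / (q - q^-1)) * K0 -
             iota (qnum q m.+1 * q ^- m / (q - q^-1)) * J0).
Proof. exact: os_FEn cs q0 qq1 (ts_site ts false) m. Qed.

Variables (N : nat) (c : nat -> F).
Hypotheses (EN : E0 ^+ N = 0) (c0 : c 0%N = 1).
Hypothesis cS : forall m, c m.+1 * qnum q m.+1 = c m * q ^+ m * (q - q^-1).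

Local Notation t m := (E0 ^+ m * F1 ^+ m).
Local Notation d := (q - q^-1).

(** Theta enters only through the recurrence [cS] for its coefficients, the normalisation [c0], and
    the nilpotence [EN] that makes the sum finite. *)
Definition qtheta : A := \sum_(m < N) iota (c m) * t m.

Lemma tE0 m : t m * E0 = E0 * t m.
Proof.
by rewrite -mulrA -[X in F1 ^+ _ * X]expr1 ts_comX expr1 !mulrA -exprS -exprSr.
Qed.

Lemma tF1 m : t m * F1 = F1 * t m.
Proof.
by rewrite [RHS]mulrA -[X in X * E0 ^+ _]expr1 ts_comX expr1 -!mulrA -exprS -exprSr.
Qed.

Lemma tEF m : E0 * F1 * t m = t m.+1.
Proof. by rewrite -mulrA -tF1 !mulrA -exprS -mulrA -exprSr. Qed.

Lemma t_skew x e : (forall m, t m * x = iota (e m) * (x * t m)) ->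
  qtheta * x = x * \sum_(m < N) iota (c m * e m) * t m.
Proof.
move=> tx; rewrite /qtheta mulr_suml mulr_sumr; apply: eq_bigr => m _.
by rewrite [RHS](csCA cs) -mulrA tx (csM cs) !mulrA.
Qed.

Lemma qtheta_comm x : (forall m, t m * x = x * t m) -> qtheta * x = x * qtheta.
Proof.
move=> tx; rewrite (@t_skew x (fun=> 1)) => [|m]; last by rewrite (cs1 cs) mul1r tx.
by congr (_ * _); apply: eq_bigr => m _; rewrite mulr1.
Qed.

Lemma qtheta_E0 : qtheta * E0 = E0 * qtheta.
Proof. exact/qtheta_comm/tE0. Qed.

Lemma qtheta_F1 : qtheta * F1 = F1 * qtheta.
Proof. exact/qtheta_comm/tF1. Qed.

Let d0 : d != 0.
Proof. by have := generic_subV q0 qgen (n := 1) isT; rewrite expr1. Qed.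

Lemma cSV m : c m.+1 - c m.+1 * (q ^- 2) ^+ m.+1 = q^-1 * d ^+ 2 * c m.
Proof.
have qm : q ^+ m != 0 by rewrite expf_neq0.
transitivity (c m.+1 * qnum q m.+1 * (q^-1 * q ^- m * d)).
  rewrite exprVn -exprM mulnC exprM expr2 /qnum exprS; field.
  by rewrite q0 qm qq1.
by rewrite cS; field; rewrite q0 qm.
Qed.

(** By the recurrence, c_m (1 - q^(-2m)) is a fixed multiple of c_(m-1), so rescaling degree m by
    q^(-2m) amounts to a factor with a single correction term. This is why conjugating K by Theta
    produces just one extra summand. *)
Lemma qtheta_shift : \sum_(m < N) iota (c m * (q ^- 2) ^+ m) * t m =
  (1 - iota (q^-1 * d ^+ 2) * (E0 * F1)) * qtheta.
Proof.
rewrite mulrBl mul1r /qtheta [X in _ = _ - X]mulr_sumr.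
rewrite -(@sum_telescope _ (fun m => iota (c m - c m * (q ^- 2) ^+ m) * t m)
  (fun m => iota (q^-1 * d ^+ 2) * (E0 * F1) * (iota (c m) * t m))).
- rewrite -sumrB; apply: eq_bigr => m _.
  by rewrite -mulrBl -(csN cs) -(csD cs) opprB addrC subrK.
- by rewrite expr0 mulr1 subrr (cs0 cs) mul0r.
- by rewrite EN mul0r mulr0.
- by move=> m; rewrite cSV -tEF (csM cs) -[RHS]mulrA (csCA cs _ (E0 * F1)) !mulrA.
Qed.

Lemma qtheta_K0 : qtheta * K0 =
  (K0 - iota (q^-1 * d ^+ 2) * (K0 * E0 * F1)) * qtheta.
Proof.
rewrite (@t_skew _ (fun m => (q ^- 2) ^+ m)) => [|m].
  by rewrite qtheta_shift [LHS]mulrA mulrBr mulr1 (csCA cs) !mulrA.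
have EK : E0 ^+ m * K0 = iota ((q ^- 2) ^+ m) * (K0 * E0 ^+ m).
  rewrite K0En mulrA -(csM cs) -exprMn mulVf ?expf_neq0 //.
  by rewrite expr1n (cs1 cs) mul1r.
by rewrite -mulrA -{1}[K0]expr1 ts_comX expr1 mulrA EK -!mulrA.
Qed.

Lemma qtheta_J1 : qtheta * J1 =
  (J1 - iota (q^-1 * d ^+ 2) * (J1 * E0 * F1)) * qtheta.
Proof.
rewrite (@t_skew _ (fun m => (q ^- 2) ^+ m)) => [|m].
  by rewrite qtheta_shift [LHS]mulrA mulrBr mulr1 (csCA cs) !mulrA.
have FJ : F1 ^+ m * J1 = iota ((q ^- 2) ^+ m) * (J1 * F1 ^+ m).
  rewrite J1Fn mulrA -(csM cs) -exprMn mulVf ?expf_neq0 //.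
  by rewrite expr1n (cs1 cs) mul1r.
rewrite -mulrA FJ (csCA cs); congr (_ * _).
by rewrite [RHS]mulrA -[X in _ = X * E0 ^+ _ * _]expr1 ts_comX expr1 mulrA.
Qed.

(** Compared by degree in E (x) 1, both sides reduce to c_(m+1) [E, F^(m+1)] in the second factor
    being equal to c_m (F^m K - K^-1 F^m), which is the commutation formula [os_EFn] combined with
    [cS]. *)
Lemma qtheta_coprodE : qtheta * (E0 * K1 + E1) = (E0 * J1 + E1) * qtheta.
Proof.
apply/eqP; rewrite -subr_eq0 mulr_suml mulr_sumr -sumrB; apply/eqP.
pose g m := iota (c m) * (E0 ^+ m.+1 * (F1 ^+ m * K1 - J1 * F1 ^+ m)).
pose f m := iota (c m) * (E0 ^+ m * (E1 * F1 ^+ m - F1 ^+ m * E1)).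
transitivity (\sum_(m < N) (g m - f m)).
  apply: eq_bigr => m _; rewrite /g /f -mulrA (csCA cs) -!mulrBr; congr (_ * _).
  have -> : t m * (E0 * K1 + E1) = E0 ^+ m.+1 * (F1 ^+ m * K1) + E0 ^+ m * (F1 ^+ m * E1).
    by rewrite mulrDr [t m * (E0 * _)]mulrA tE0 exprS !mulrA.
  have -> : (E0 * J1 + E1) * t m = E0 ^+ m.+1 * (J1 * F1 ^+ m) + E0 ^+ m * (E1 * F1 ^+ m).
    rewrite mulrDl; congr (_ + _); last by rewrite mulrA ts_comX1 -mulrA.
    by rewrite -mulrA [J1 * _]mulrA ts_comX1 exprS !mulrA.
  by rewrite opprD addrACA !mulrBr opprB.
rewrite sumrB -(@sum_telescope _ f g) ?subrr //.
- by rewrite /f !expr0 !mulr1 !mul1r subrr ?mul0r mulr0.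
- by rewrite /f EN mul0r mulr0.
move=> m; rewrite /f /g E1Fn addrAC subrr add0r J1Fn mulrBr !(csCA cs _ (F1 ^+ m)).
rewrite iota_comb; have {2}-> : F1 ^+ m * K1 = iota 1 * (F1 ^+ m * K1).
  by rewrite (cs1 cs) mul1r.
rewrite iota_comb mulr1.
have qm : q ^+ m != 0 by rewrite expf_neq0.
congr (iota _ * _ - iota _ * _).
- rewrite -[_ / q ^+ m / d]mulrA [c _ * (qnum _ _ * _)]mulrA cS.
  by field; rewrite q0 qm qq1.
- rewrite -[_ * q ^+ m / d]mulrA [c _ * (qnum _ _ * _)]mulrA cS exprAC expr2.
  by field; rewrite q0 qq1.
Qed.

Lemma qtheta_coprodF : qtheta * (F0 + J0 * F1) = (F0 + K0 * F1) * qtheta.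
Proof.
apply/eqP; rewrite -subr_eq0 mulr_suml mulr_sumr -sumrB; apply/eqP.
pose g m := iota (c m) * ((K0 * E0 ^+ m - E0 ^+ m * J0) * F1 ^+ m.+1).
pose f m := iota (c m) * ((E0 ^+ m * F0 - F0 * E0 ^+ m) * F1 ^+ m).
transitivity (\sum_(m < N) (f m - g m)).
  apply: eq_bigr => m _; rewrite /g /f -mulrA (csCA cs) -!mulrBr; congr (_ * _).
  have -> : t m * (F0 + J0 * F1) = E0 ^+ m * F0 * F1 ^+ m + E0 ^+ m * J0 * F1 ^+ m.+1.
    rewrite mulrDr -mulrA ts_comX2 [E0 ^+ m * (F0 * _)]mulrA; congr (_ + _).
    by rewrite -mulrA [F1 ^+ m * _]mulrA ts_comX2 -mulrA -exprSr mulrA.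
  have -> : (F0 + K0 * F1) * t m = F0 * E0 ^+ m * F1 ^+ m + K0 * E0 ^+ m * F1 ^+ m.+1.
    by rewrite mulrDl -[K0 * F1 * _]mulrA -tF1 exprSr !mulrA.
  by rewrite opprD addrACA !mulrBl opprB.
rewrite sumrB (@sum_telescope _ f g) ?subrr //.
- by rewrite /f !expr0 !mulr1 !mul1r subrr ?mul0r mulr0.
- by rewrite /f EN mul0r mulr0 subrr mul0r mulr0.
move=> m; rewrite /f /g F0En addrAC subrr add0r K0En mulrBr !(csCA cs _ (E0 ^+ m)).
rewrite iota_combl; have {2}-> : E0 ^+ m * J0 = iota 1 * (E0 ^+ m * J0).
  by rewrite (cs1 cs) mul1r.
rewrite iota_combl mulr1.
have qm : q ^+ m != 0 by rewrite expf_neq0.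
congr (iota _ * _ - iota _ * _).
- rewrite -[_ * q ^+ m / d]mulrA [c _ * (qnum _ _ * _)]mulrA cS exprAC expr2.
  by field; rewrite q0 qq1.
- rewrite -[_ / q ^+ m / d]mulrA [c _ * (qnum _ _ * _)]mulrA cS.
  by field; rewrite q0 qm qq1.
Qed.

(** Theta - 1 is divisible by E (x) 1, with a quotient y commuting with it; hence it is nilpotent
    and the geometric series gives an inverse. *)
Lemma qtheta_inv : exists x, qtheta * x = 1.
Proof.
pose y := \sum_(m < N) iota (c m.+1) * (E0 ^+ m * F1 ^+ m.+1).
have yE : y * E0 = E0 * y.
  rewrite /y mulr_suml mulr_sumr; apply: eq_bigr => m _.
  rewrite -mulrA (csCA cs); congr (_ * _).
  by rewrite -mulrA ts_comX2 !mulrA -exprS -exprSr.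
have -> : qtheta = 1 - (- (E0 * y)).
  have : qtheta = \sum_(m < N.+1) iota (c m) * t m.
    by rewrite big_ord_recr /= EN mul0r mulr0 addr0.
  rewrite big_ord_recl c0 (cs1 cs) !expr0 !mulr1 opprK => ->; congr (_ + _).
  rewrite /y mulr_sumr; apply: eq_bigr => m _.
  by rewrite (csCA cs) [E0 * _]mulrA -exprS.
exists (\sum_(j < N) (- (E0 * y)) ^+ j).
have := subrX1 (- (E0 * y)) N.
rewrite -mulNr exprMn_comm; last by rewrite /GRing.comm mulNr mulrN yE.
rewrite exprNn EN mulr0 mul0r sub0r => /(congr1 -%R); rewrite opprK -mulNr opprB.
by rewrite mulNr => <-.
Qed.

End QuasiRMatrix.

Section Intertwining.
Variables (F : fieldType) (A : pzRingType) (iota : F -> A).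
Hypothesis cs : central_scalars iota.

Definition intertwines (s x y : A) := s * x = y * s.

Lemma intertwinesD s x y x' y' : intertwines s x y -> intertwines s x' y' ->
  intertwines s (x + x') (y + y').
Proof. by rewrite /intertwines mulrDr mulrDl => -> ->. Qed.

Lemma intertwinesB s x y x' y' : intertwines s x y -> intertwines s x' y' ->
  intertwines s (x - x') (y - y').
Proof. by rewrite /intertwines mulrBr mulrBl => -> ->. Qed.

Lemma intertwinesM s x y x' y' : intertwines s x y -> intertwines s x' y' ->
  intertwines s (x * x') (y * y').
Proof. by rewrite /intertwines => xy xy'; rewrite mulrA xy -mulrA xy' mulrA. Qed.

Lemma intertwines_scal s a : intertwines s (iota a) (iota a).
Proof. by rewrite /intertwines (csC cs). Qed.

Lemma intertwines_comp s s' x y z : intertwines s' x y -> intertwines s y z ->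
  intertwines (s * s') x z.
Proof. by rewrite /intertwines => xy yz; rewrite -mulrA xy mulrA yz mulrA. Qed.

End Intertwining.

Section Braiding.
Variables (F : fieldType) (q : F) (A : pzRingType) (iota : F -> A).
Variable v : letter -> A.
Hypotheses (q0 : q != 0) (qgen : forall n, (0 < n)%N -> q ^+ n != 1).
Hypothesis ts : two_sites q iota v.
Let cs := ts_scal ts.
Let qq1 := generic_qq1 qgen.

Local Notation E0 := (v (false, gE)). Local Notation F0 := (v (false, gF)).
Local Notation K0 := (v (false, gK)). Local Notation J0 := (v (false, gKi)).
Local Notation E1 := (v (true, gE)). Local Notation F1 := (v (true, gF)).
Local Notation K1 := (v (true, gK)). Local Notation J1 := (v (true, gKi)).
Local Notation d := (q - q^-1).

Variables (N : nat) (c : nat -> F).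
Hypotheses (EN : E0 ^+ N = 0) (c0 : c 0%N = 1).
Hypothesis cS : forall m, c m.+1 * qnum q m.+1 = c m * q ^+ m * (q - q^-1).
Variable D : A.
Hypotheses (DE0 : intertwines D E0 (E0 * K1)) (DE1 : intertwines D E1 (K0 * E1)).
Hypotheses (DF0 : intertwines D F0 (F0 * J1)) (DF1 : intertwines D F1 (J0 * F1)).
Hypotheses (DK0 : intertwines D K0 K0) (DK1 : intertwines D K1 K1).
Hypotheses (DJ0 : intertwines D J0 J0) (DJ1 : intertwines D J1 J1).

Local Notation S := (D * qtheta iota v N c).

Definition site_cas (s : bool) : A :=
  iota (d ^+ 2) * (v (s, gF) * v (s, gE)) + iota q * v (s, gK) + iota q^-1 * v (s, gKi).

(** D is the Cartan part q^(H (x) H / 2) of the R-matrix, known here only by its commutation rules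
    with the generators. The images under beta are the flips of the right-hand sides; the flip of
    this one is tau_L(E). *)
Lemma braid_E0 : intertwines S E0 (E0 * K1).
Proof. exact: intertwines_comp (qtheta_E0 ts N c) DE0. Qed.

Lemma braid_F1 : intertwines S F1 (J0 * F1).
Proof. exact: intertwines_comp (qtheta_F1 ts N c) DF1. Qed.

Lemma braid_coprodE : intertwines S (E0 * K1 + E1) (K0 * E1 + E0).
Proof.
apply: intertwines_comp (qtheta_coprodE q0 qgen ts EN cS) _.
have -> : K0 * E1 + E0 = E0 * K1 * J1 + K0 * E1 by uq_normalise ts q0 qq1.
by apply: intertwinesD => //; apply: intertwinesM.
Qed.

Lemma braid_coprodF : intertwines S (F0 + J0 * F1) (F1 + J1 * F0).
Proof.
apply: intertwines_comp (qtheta_coprodF q0 qgen ts EN cS) _.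
have -> : F1 + J1 * F0 = F0 * J1 + K0 * (J0 * F1) by uq_normalise ts q0 qq1.
by apply: intertwinesD => //; apply: intertwinesM.
Qed.

(** The flip of the right-hand side is tau_L(K). *)
Lemma braid_K0 : intertwines S K0 (K0 - iota (q^-1 * d ^+ 2) * (F1 * K1 * E0)).
Proof.
apply: intertwines_comp (qtheta_K0 q0 qgen ts EN cS) _.
have -> : F1 * K1 * E0 = K0 * (E0 * K1) * (J0 * F1) by uq_normalise ts q0 qq1.
apply: intertwinesB => //; apply: intertwinesM; first exact: intertwines_scal cs _ _.
by apply: intertwinesM => //; apply: intertwinesM.
Qed.

Lemma braid_J1 : intertwines S J1 (J1 - iota (q * d ^+ 2) * (F1 * J0 * E0)).
Proof.
apply: intertwines_comp (qtheta_J1 q0 qgen ts EN cS) _.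
have -> : iota (q * d ^+ 2) * (F1 * J0 * E0) =
    iota (q^-1 * d ^+ 2) * (J1 * (E0 * K1) * (J0 * F1)) by uq_normalise ts q0 qq1.
apply: intertwinesB => //; apply: intertwinesM; first exact: intertwines_scal cs _ _.
by apply: intertwinesM => //; apply: intertwinesM.
Qed.

(** Theta is a polynomial in E (x) F, the two letters lying in commuting factors. *)
Lemma qtheta_weight0 x : x * (E0 * F1) = E0 * F1 * x ->
  qtheta iota v N c * x = x * qtheta iota v N c.
Proof.
move=> xEF; apply: (qtheta_comm ts) => m; rewrite -exprMn_comm.
  by apply/commr_sym/commrX.
by rewrite /GRing.comm (ts_comm ts).
Qed.

Lemma braid_KK : intertwines S (K0 * K1) (K1 * K0).
Proof.
apply: (@intertwines_comp _ _ _ _ (K0 * K1)).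
  by apply: qtheta_weight0; uq_normalise ts q0 qq1.
by rewrite (ts_comm ts); apply: intertwinesM.
Qed.

Lemma braid_JJ : intertwines S (J0 * J1) (J1 * J0).
Proof.
apply: (@intertwines_comp _ _ _ _ (J0 * J1)).
  by apply: qtheta_weight0; uq_normalise ts q0 qq1.
by rewrite (ts_comm ts); apply: intertwinesM.
Qed.

(** A Casimir is central in its own factor and commutes with the other one, hence with Theta; the
    twists that D puts on F and E cancel in the product FE. *)
Lemma braid_cas s : intertwines S (site_cas s) (site_cas s).
Proof.
apply: (@intertwines_comp _ _ _ _ (site_cas s)).
  apply: (qtheta_comm ts) => m.
  have cE : GRing.comm (site_cas s) E0.
    by case: s; rewrite /GRing.comm /site_cas; uq_normalise ts q0 qq1.
  have cF : GRing.comm (site_cas s) F1.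
    by case: s {cE}; rewrite /GRing.comm /site_cas; uq_normalise ts q0 qq1.
  by apply/commr_sym/commrM; apply: commrX.
have sI := @intertwines_scal _ _ _ cs D.
have DK : intertwines D (v (s, gK)) (v (s, gK)) by case: s.
have DJ : intertwines D (v (s, gKi)) (v (s, gKi)) by case: s {DK}.
rewrite /site_cas; apply: intertwinesD (intertwinesM (sI _) DJ).
apply: intertwinesD (intertwinesM (sI _) DK); apply: intertwinesM (sI _) _.
case: s {DK DJ}.
  have {2}-> : F1 * E1 = J0 * F1 * (K0 * E1) by uq_normalise ts q0 qq1.
  exact: intertwinesM.
have {2}-> : F0 * E0 = F0 * J1 * (E0 * K1) by uq_normalise ts q0 qq1.
exact: intertwinesM.
Qed.
End Braiding.

(** * The R-matrix on weight modules *)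

Section WeightModules.
Variable R : realType.
Local Notation k := (qfield R).
Implicit Type W : wmod R.

Lemma diag_skew (F : fieldType) (h : F) m (w : 'I_m -> int) (X : 'M[F]_m) (z : F) (e : int) r c :
  z = h ^ e -> h != 0 -> injective (fun z : int => h ^ z) ->
  diag_mx (\row_j h ^ w j) *m X = z *: (X *m diag_mx (\row_j h ^ w j)) ->
  X r c != 0 -> w r = w c + e.
Proof.
move=> -> h0 hinj /matrixP/(_ r c); rewrite mul_diag_mx mul_mx_diag !mxE => XE X0.
apply: hinj; apply: (mulIf X0); rewrite XE mulrC expfzDr //; ring.
Qed.

Lemma wE_weight W r c : wE W r c != 0 -> wt r = wt c + 2.
Proof.
apply: diag_skew (q_neq0 R) _ (wKE W); first by [].
exact: generic_expz_inj (q_neq0 R) (@q_expn_neq1 R).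
Qed.

Lemma wF_weight W r c : wF W r c != 0 -> wt r = wt c - 2.
Proof.
apply: diag_skew (q_neq0 R) _ (wKF W); first by [].
exact: generic_expz_inj (q_neq0 R) (@q_expn_neq1 R).
Qed.

(** A nonzero entry of E^m in row r yields m strictly decreasing weights below that of r, and fewer
    than [wdim W] basis vectors lie below r. *)
Lemma wE_nilpotent W : wE W ^+ wdim W = 0.
Proof.
pose lower (r : 'I_(wdim W)) := #|[set j : 'I_(wdim W) | wt j < wt r]|.
have low m r c : (wE W ^+ m) r c != 0 -> (m <= lower r)%N.
  elim: m r c => [|m IH] r c //; rewrite exprS mxE => sum0.
  have [s Es] : exists s, wE W r s * (wE W ^+ m) s c != 0.
    apply/existsP; apply: contraNT sum0 => /existsPn s0; apply/eqP/big1 => s _.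
    by apply/eqP; have := s0 s; rewrite negbK.
  move: Es; rewrite mulf_eq0 negb_or => /andP[/wE_weight rs /IH lows].
  apply: leq_ltn_trans lows _; apply: proper_card; apply/properP; split.
    by apply/fintype.subsetP => j; rewrite !inE rs; lia.
  by exists s; rewrite !inE ?rs; lia.
apply/matrixP => r c; rewrite [RHS]mxE; apply/eqP; apply: contraTT isT => /low.
rewrite leqNgt => /negP[]; rewrite -[X in (_ < X)%N]card_ord -cardsT.
apply: proper_card; apply/properP; split; first exact: finset.subsetT.
by exists r; rewrite !inE // ltxx.
Qed.

End WeightModules.

Section SlotEntries.
Variables (F : fieldType) (n : nat) (d : 'I_n -> nat).
Local Notation T := (tidx d).

Lemma slot_neq0 i (x : forall j, 'M[F]_(d j)) a b : slot i x a b != 0 ->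
  x i ((enum_val a : T) i) ((enum_val b : T) i) != 0 /\
  forall j, j != i -> (enum_val a : T) j = (enum_val b : T) j.
Proof.
rewrite slotE mulf_eq0 negb_or => /andP[x0 /prodf_neq0 p0]; split=> // j ji.
by have := p0 j ji; have [//|_] := eqVneq ((enum_val a : T) j) ((enum_val b : T) j); rewrite eqxx.
Qed.

Lemma slot_diag i (v : forall j, 'rV[F]_(d j)) :
  slot i (fun j => diag_mx (v j)) = diag_mx (\row_a v i 0 ((enum_val a : T) i)).
Proof.
apply/matrixP => a b; rewrite slotE !mxE; have [->|ab] := eqVneq a b.
  by rewrite eqxx mulr1n big1 ?mulr1 // => j _; rewrite eqxx.
rewrite mulr0n; apply/eqP; apply: contraNT ab; rewrite mulf_eq0 negb_or.
case/andP => v0 /prodf_neq0 p0; apply/eqP/enum_val_inj/ffunP => j.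
have [->|ji] := eqVneq j i; last first.
  by have := p0 j ji; have [//|_] := eqVneq ((enum_val a : T) j) ((enum_val b : T) j); rewrite eqxx.
by apply/eqP; apply: contraNT v0 => /negPf ->.
Qed.

End SlotEntries.

Section ThetaWeights.
Variables (R : realType) (n : nat) (i : 'I_n.-1).
Local Notation k := (qfield R).
Local Notation i0 := (strand i).
Local Notation i1 := (strandS i).
Implicit Types V W : 'I_n -> wmod R.
Local Notation TW W := #|tidx (tdim W)|.

Lemma strand_neq : i0 != i1.
Proof. by rewrite -val_eqE /= neq_ltn ltnSn. Qed.

Definition site_letter (x : letter) : 'I_n * ugen := (if x.1 then i1 else i0, x.2).

Definition vW W (x : letter) : 'M[k]_(TW W) :=
  to_completion (ug (site_letter x).2 (site_letter x).1) W.

Lemma vW_two_sites W : two_sites (q : k) (@scalar_mx k (TW W)) (vW W).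
Proof.
have ts := ug_two_sites R strand_neq.
pose f x := to_completion x W : 'M[k]_(TW W).
have fM x y : f x * f y = f (x * y) by rewrite /f to_completionM.
have fB x y : f x - f y = f (x - y) by rewrite /f to_completionB.
have fS c : scalar_mx c = f (pscal _ c) by rewrite /f to_completion_scal.
split; first exact: matrix_scalars.
  move=> s; have [KKi KiK KE KF EF] := ts_site ts s.
  split; rewrite -1?[vW W]/(fun x => f (ug (site_letter x).2 (site_letter x).1)); cbv beta.
  - by rewrite fM KKi /f to_completion1.
  - by rewrite fM KiK /f to_completion1.
  - by rewrite fS !fM KE.
  - by rewrite fS !fM KF.
  - by rewrite fS !fM !fB !fM EF.
move=> a b; rewrite -[vW W]/(fun x => f (ug (site_letter x).2 (site_letter x).1)); cbv beta.
by rewrite !fM (ts_comm ts).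
Qed.

Definition theta_coef (m : nat) : k :=
  q ^+ (m * m.-1)./2 * (q - q^-1) ^+ m / qfact m.

(** Stated with an arbitrary f in place of the q-factorial, so that [field] sees opaque data; the
    power of q^m comes from the increment of the triangular numbers. *)
Lemma theta_coefE (F : fieldType) (q : F) (f : nat -> F) m :
  q - q^-1 != 0 -> f m != 0 -> qnum q m.+1 != 0 -> f m.+1 = f m * qnum q m.+1 ->
  q ^+ (m.+1 * m)./2 * (q - q^-1) ^+ m.+1 / f m.+1 * qnum q m.+1 =
  q ^+ (m * m.-1)./2 * (q - q^-1) ^+ m / f m * q ^+ m * (q - q^-1).
Proof.
move=> d0 fm qm ->.
have -> : (m.+1 * m)./2 = ((m * m.-1)./2 + m)%N.
  case: m {fm qm} => [//|m].
  have -> : (m.+2 * m.+1 = m.+1 * m + m.+1.*2)%N by lia.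
  by rewrite halfD doubleK odd_double andbF.
rewrite exprD exprSr; move: (qnum q m.+1) qm (q - q^-1) d0 => z z0 d d0.
by field; rewrite fm z0.
Qed.

Lemma qfact_neq0 m : qfact m != 0 :> k.
Proof.
rewrite /qfact prodf_seq_neq0; apply/allP => j; rewrite mem_index_iota => /andP[j0 _].
apply/implyP => _; exact: (qnum_neq0 (q_neq0 R) (@q_expn_neq1 R) j0).
Qed.

Lemma theta_coefS m :
  theta_coef m.+1 * qnum q m.+1 = theta_coef m * q ^+ m * (q - q^-1).
Proof.
apply: (@theta_coefE k q (fun m => qfact m)).
- by have := generic_subV (q_neq0 R) (@q_expn_neq1 R) (n := 1) isT; rewrite expr1.
- exact: qfact_neq0.
- by have := qnum_neq0 (q_neq0 R) (@q_expn_neq1 R) (ltn0Sn m).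
- by rewrite /qfact big_nat_recr.
Qed.

Lemma theta_coef0 : theta_coef 0 = 1.
Proof. by rewrite /theta_coef /qfact big_geq // !expr0 mulr1 invr1 mulr1. Qed.

Lemma ThetaE W : Theta i W =
  qtheta (@scalar_mx k (TW W)) (vW W) (wdim (W i0)) theta_coef.
Proof.
rewrite /Theta /qtheta; apply: eq_bigr => m _.
rewrite /vW !to_completion_ug !slot_exp -!mulmxE mul_scalar_mx -scalemxAl.
by rewrite -/(theta_coef m).
Qed.

Lemma vE_nilpotent W : vW W (false, gE) ^+ wdim (W i0) = 0.
Proof.
rewrite /vW to_completion_ug slot_exp; apply/matrixP => a b.
by rewrite slotE /= wE_nilpotent mxE mul0r mxE.
Qed.

Definition weight W (j : 'I_n) (a : 'I_(TW W)) : int :=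
  wt ((enum_val a : tidx (tdim W)) j).

(** The operator q^(H (x) H / 2) on the factors i and i+1. *)
Definition Dmx W : 'M[k]_(TW W) :=
  diag_mx (\row_a qhalf ^ (weight i0 a * weight i1 a)).

Definition Dinv W : 'M[k]_(TW W) :=
  diag_mx (\row_a qhalf ^ (- (weight i0 a * weight i1 a))).

Lemma qhalf_neq0 : qhalf != 0 :> k.
Proof. by rewrite /qhalf expf_neq0 // /qroot4 tofrac_eq0 polyX_eq0. Qed.

Lemma qhalf2 : qhalf ^ 2 = q :> k.
Proof. by rewrite /qhalf /q -[_ ^ 2]/(_ ^+ 2) -exprM. Qed.

Lemma DmxK W : Dmx W *m Dinv W = 1%:M.
Proof.
rewrite mulmx_diag -diag_const_mx; congr diag_mx.
by apply/rowP => a; rewrite !mxE -expfzDr ?qhalf_neq0 // subrr expr0z.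
Qed.

(** The exponent in [PsiInv] is the difference of the products of the two weights at a and at b, so
    Psi^-1 is conjugation by D. *)
Lemma PsiInvE W z : PsiInv i z = Dmx W *m z *m Dinv W.
Proof.
apply/matrixP => a b; rewrite mul_diag_mx mul_mx_diag !mxE mulrAC.
rewrite -expfzDr ?qhalf_neq0 //; congr (_ ^ _ * _).
rewrite -!/(weight _ _) /=; move: (weight _ a) (weight _ b) => u v.
ring.
Qed.

Lemma Dmx_intertwines W (X Y : 'M[k]_(TW W)) :
  (forall a b, qhalf ^ (weight i0 a * weight i1 a) * X a b =
               Y a b * qhalf ^ (weight i0 b * weight i1 b)) ->
  intertwines (Dmx W) X Y.
Proof.
by move=> XY; apply/matrixP => a b; rewrite -!mulmxE mul_diag_mx mul_mx_diag !mxE.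
Qed.

Lemma slotK_diag W j : slot (d := tdim W) j (fun l => wop (W l) gK) =
  diag_mx (\row_a q ^ weight j a).
Proof. by rewrite slot_diag; congr diag_mx; apply/rowP => a; rewrite !mxE. Qed.

Lemma slotKi_diag W j : slot (d := tdim W) j (fun l => wop (W l) gKi) =
  diag_mx (\row_a q ^ (- weight j a)).
Proof. by rewrite slot_diag; congr diag_mx; apply/rowP => a; rewrite !mxE. Qed.

Lemma Dmx_diag W (v : 'rV[k]_(TW W)) : intertwines (Dmx W) (diag_mx v) (diag_mx v).
Proof. by rewrite /intertwines -!mulmxE !mulmx_diag; congr diag_mx; apply/rowP => a; rewrite !mxE mulrC. Qed.

Lemma Dmx_K W s : intertwines (Dmx W) (vW W (s, gK)) (vW W (s, gK)).
Proof. by rewrite /vW to_completion_ug slotK_diag; exact: Dmx_diag. Qed.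

Lemma Dmx_Ki W s : intertwines (Dmx W) (vW W (s, gKi)) (vW W (s, gKi)).
Proof. by rewrite /vW to_completion_ug slotKi_diag; exact: Dmx_diag. Qed.

Lemma slot_weight W j (x : forall l, 'M[k]_(tdim W l)) a b :
  slot (d := tdim W) j x a b != 0 -> forall l, l != j -> weight l a = weight l b.
Proof. by move=> /slot_neq0[_ ab] l lj; rewrite /weight ab. Qed.

(** E and F shift the weight of one factor by 2; with h the square root of q, the other weight w
    then contributes (h^2)^w, an eigenvalue of K in that other factor, or its inverse. *)
Lemma half_weight_shift (F : fieldType) (h x : F) (u w : int) : h != 0 ->
  [/\ h ^ ((u + 2) * w) * x = x * (h ^ 2) ^ w * h ^ (u * w),
      h ^ (u * w) * x = x * (h ^ 2) ^ (- w) * h ^ ((u + 2) * w),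
      h ^ (w * (u + 2)) * x = (h ^ 2) ^ w * x * h ^ (w * u) &
      h ^ (w * u) * x = (h ^ 2) ^ (- w) * x * h ^ (w * (u + 2))].
Proof.
move=> h0; rewrite !(mulrC w) ![_ * x]mulrC -!mulrA !exprz_exp -!expfzDr //.
by split; congr (_ * _ ^ _); ring.
Qed.

Lemma mul_diagE (F : fieldType) m (X : 'M[F]_m) f a b :
  (diag_mx (\row_c f c) *m X) a b = f a * X a b.
Proof. by rewrite mul_diag_mx [LHS]mxE [X in X * _]mxE. Qed.

Lemma mulE_diag (F : fieldType) m (X : 'M[F]_m) f a b :
  (X *m diag_mx (\row_c f c)) a b = X a b * f b.
Proof. by rewrite mul_mx_diag [LHS]mxE [X in _ * X]mxE. Qed.

Lemma strand_neq' : i1 != i0. Proof. by rewrite eq_sym strand_neq. Qed.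

Lemma Dmx_E0 W : intertwines (Dmx W) (vW W (false, gE))
  (vW W (false, gE) * vW W (true, gK)).
Proof.
apply: Dmx_intertwines => a b.
rewrite /vW !to_completion_ug slotK_diag -mulmxE mulE_diag.
set x := slot _ _ a b; have [->|x0] := eqVneq x 0; first by rewrite mulr0 !mul0r.
rewrite (slot_weight x0 strand_neq').
have /slot_neq0[/wE_weight wab _] := x0.
rewrite [weight i0 a](_ : _ = weight i0 b + 2) // -qhalf2.
by case: (half_weight_shift x (weight i0 b) (weight i1 b) qhalf_neq0).
Qed.

Lemma Dmx_E1 W : intertwines (Dmx W) (vW W (true, gE))
  (vW W (false, gK) * vW W (true, gE)).
Proof.
apply: Dmx_intertwines => a b.
rewrite /vW !to_completion_ug slotK_diag -mulmxE mul_diagE.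
set x := slot _ _ a b; have [->|x0] := eqVneq x 0; first by rewrite !mulr0 mul0r.
rewrite (slot_weight x0 strand_neq).
have /slot_neq0[/wE_weight wab _] := x0.
rewrite [weight i1 a](_ : _ = weight i1 b + 2) // -qhalf2.
by case: (half_weight_shift x (weight i1 b) (weight i0 b) qhalf_neq0).
Qed.

Lemma Dmx_F0 W : intertwines (Dmx W) (vW W (false, gF))
  (vW W (false, gF) * vW W (true, gKi)).
Proof.
apply: Dmx_intertwines => a b.
rewrite /vW !to_completion_ug slotKi_diag -mulmxE mulE_diag.
set x := slot _ _ a b; have [->|x0] := eqVneq x 0; first by rewrite mulr0 !mul0r.
rewrite (slot_weight x0 strand_neq').
have /slot_neq0[/wF_weight wab _] := x0.
have wba : weight i0 b = weight i0 a + 2 by rewrite [weight i0 a]wab subrK.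
rewrite [in RHS]wba -qhalf2.
by case: (half_weight_shift x (weight i0 a) (weight i1 b) qhalf_neq0).
Qed.

Lemma Dmx_F1 W : intertwines (Dmx W) (vW W (true, gF))
  (vW W (false, gKi) * vW W (true, gF)).
Proof.
apply: Dmx_intertwines => a b.
rewrite /vW !to_completion_ug slotKi_diag -mulmxE mul_diagE.
set x := slot _ _ a b; have [->|x0] := eqVneq x 0; first by rewrite !mulr0 mul0r.
rewrite (slot_weight x0 strand_neq).
have /slot_neq0[/wF_weight wab _] := x0.
have wba : weight i1 b = weight i1 a + 2 by rewrite [weight i1 a]wab subrK.
rewrite [in RHS]wba -qhalf2.
by case: (half_weight_shift x (weight i1 a) (weight i0 b) qhalf_neq0).
Qed.

Lemma Dmx_far W j a : j != i0 -> j != i1 ->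
  intertwines (Dmx W) (to_completion (ug a j) W) (to_completion (ug a j) W).
Proof.
move=> j0 j1; apply: Dmx_intertwines => b c; rewrite to_completion_ug.
set x := slot _ _ b c; have [->|x0] := eqVneq x 0; first by rewrite mulr0 mul0r.
by rewrite !(slot_weight x0) 1?eq_sym // mulrC.
Qed.

Definition Smx W : 'M[k]_(TW W) := Dmx W * Theta i W.

Section Strands.
Variable W : 'I_n -> wmod R.
Let ts := vW_two_sites W.
Let q0 := q_neq0 R.
Let qgen := @q_expn_neq1 R.
Let EN := vE_nilpotent W.

Lemma Smx_E0 : intertwines (Smx W) (vW W (false, gE)) (vW W (false, gE) * vW W (true, gK)).
Proof. by rewrite /Smx ThetaE; apply: (braid_E0 ts); exact: Dmx_E0. Qed.

Lemma Smx_F1 : intertwines (Smx W) (vW W (true, gF)) (vW W (false, gKi) * vW W (true, gF)).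
Proof. by rewrite /Smx ThetaE; apply: (braid_F1 ts); exact: Dmx_F1. Qed.

Lemma Smx_coprodE : intertwines (Smx W)
  (vW W (false, gE) * vW W (true, gK) + vW W (true, gE))
  (vW W (false, gK) * vW W (true, gE) + vW W (false, gE)).
Proof.
by rewrite /Smx ThetaE; apply: (braid_coprodE q0 qgen ts EN theta_coefS (Dmx_E0 W) (Dmx_E1 W) (Dmx_Ki W true)).
Qed.

Lemma Smx_coprodF : intertwines (Smx W)
  (vW W (false, gF) + vW W (false, gKi) * vW W (true, gF))
  (vW W (true, gF) + vW W (true, gKi) * vW W (false, gF)).
Proof.
by rewrite /Smx ThetaE; apply: (braid_coprodF q0 qgen ts EN theta_coefS (Dmx_F0 W) (Dmx_F1 W) (Dmx_K W false)).
Qed.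

Lemma Smx_K0 : intertwines (Smx W) (vW W (false, gK))
  (vW W (false, gK) - (q^-1 * (q - q^-1) ^+ 2)%:M *
     (vW W (true, gF) * vW W (true, gK) * vW W (false, gE))).
Proof.
by rewrite /Smx ThetaE; apply: (braid_K0 q0 qgen ts EN theta_coefS (Dmx_E0 W) (Dmx_F1 W) (Dmx_K W false)).
Qed.

Lemma Smx_J1 : intertwines (Smx W) (vW W (true, gKi))
  (vW W (true, gKi) - (q * (q - q^-1) ^+ 2)%:M *
     (vW W (true, gF) * vW W (false, gKi) * vW W (false, gE))).
Proof.
by rewrite /Smx ThetaE; apply: (braid_J1 q0 qgen ts EN theta_coefS (Dmx_E0 W) (Dmx_F1 W) (Dmx_Ki W true)).
Qed.

Lemma Smx_KK : intertwines (Smx W) (vW W (false, gK) * vW W (true, gK))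
  (vW W (true, gK) * vW W (false, gK)).
Proof.
by rewrite /Smx ThetaE; apply: (braid_KK q0 ts _ _ (Dmx_K W false) (Dmx_K W true)).
Qed.

Lemma Smx_JJ : intertwines (Smx W) (vW W (false, gKi) * vW W (true, gKi))
  (vW W (true, gKi) * vW W (false, gKi)).
Proof.
by rewrite /Smx ThetaE; apply: (braid_JJ q0 ts _ _ (Dmx_Ki W false) (Dmx_Ki W true)).
Qed.

Lemma Smx_cas s : intertwines (Smx W) (site_cas q (@scalar_mx k (TW W)) (vW W) s)
  (site_cas q (@scalar_mx k (TW W)) (vW W) s).
Proof.
rewrite /Smx ThetaE; apply: (braid_cas q0 qgen ts _ _ (Dmx_E0 W) (Dmx_E1 W)
  (Dmx_F0 W) (Dmx_F1 W) (Dmx_K W false) (Dmx_K W true) (Dmx_Ki W false) (Dmx_Ki W true)).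
Qed.

Lemma Smx_far j a : j != i0 -> j != i1 ->
  intertwines (Smx W) (to_completion (ug a j) W) (to_completion (ug a j) W).
Proof.
move=> j0 j1; apply: intertwines_comp (Dmx_far W a j0 j1).
rewrite ThetaE; apply: (qtheta_weight0 ts); rewrite /vW -!mulmxE -!to_completionM.
rewrite -mulrA [X in _ = to_completion (_ * X) _](ug_comm R _ _ (i := i1)) 1?eq_sym //.
by rewrite mulrA (ug_comm R _ _ (i := j) (j := i0)) // mulrA.
Qed.

Lemma Theta_unit : Theta i W \in unitmx.
Proof.
have [x xE] := qtheta_inv ts EN theta_coef0; rewrite ThetaE.
have [uT _] := @mulmx1_unit k (TW W) (qtheta _ _ _ _) x xE; exact: uT.
Qed.

End Strands.

End ThetaWeights.

(** * The flip, and braiding as a relation *)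

Section Flip.
Variables (R : realType) (n : nat) (i : 'I_n.-1).
Local Notation k := (qfield R).
Local Notation i0 := (strand i).
Local Notation i1 := (strandS i).
Local Notation s := (tperm i0 i1).
Implicit Types V W : 'I_n -> wmod R.
Local Notation T W := (tidx (tdim W)).
Local Notation TW W := #|tidx (tdim W)|.

Definition flip_idx V (a : T V) : T (swapV i V) := [ffun j => a (s j)].

Lemma flip_idx_inj V : injective (@flip_idx V).
Proof.
move=> a b /ffunP ab; apply/ffunP => j.
have : a (s (s j)) = b (s (s j)) :> 'I_(tdim V (s (s j))).
  by have := ab (s j); rewrite !ffunE.
by rewrite tpermK.
Qed.

Lemma flip_idx_bij V : bijective (@flip_idx V).
Proof.
apply: inj_card_bij (@flip_idx_inj V) _.
(* Swapping twice gives V back, so the same injection in the other direction compares the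
   cardinalities. *)
have swapK : swapV i (swapV i V) = V by apply: funext => j; rewrite /swapV tpermK.
by have := leq_card _ (@flip_idx_inj (swapV i V)); rewrite swapK.
Qed.

Lemma flipE V a b :
  flip i V a b = (flip_idx (enum_val a) == enum_val b)%:R.
Proof.
rewrite mxE; congr (_ %:R); congr nat_of_bool; apply/forallP/eqP => [ab|<- j].
  by apply/ffunP => j; rewrite ffunE; apply/eqP; exact: ab.
by rewrite ffunE.
Qed.

Lemma flip_mulE V m (X : 'M[k]_(TW (swapV i V), m)) a b :
  (flip i V *m X) a b = X (enum_rank (flip_idx (enum_val a))) b.
Proof.
rewrite mxE (bigD1 (enum_rank (flip_idx (enum_val a)))) //= big1 => [|c ca].
  by rewrite addr0 flipE enum_rankK eqxx mul1r.
rewrite flipE (_ : (_ == _) = false) ?mul0r //.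
by apply: contraNF ca => /eqP ->; rewrite enum_valK.
Qed.

Lemma mul_flipE V m (X : 'M[k]_(m, TW V)) a (c : T V) :
  (X *m flip i V) a (enum_rank (flip_idx c)) = X a (enum_rank c).
Proof.
rewrite mxE (bigD1 (enum_rank c)) //= big1 => [|b bc].
  by rewrite addr0 flipE !enum_rankK eqxx mulr1.
rewrite flipE enum_rankK (_ : (_ == _) = false) ?mulr0 //.
by apply: contraNF bc => /eqP/flip_idx_inj <-; rewrite enum_valK.
Qed.

Lemma flip_tens V (M : forall j, 'M[k]_(tdim V j)) :
  flip i V *m tens (d := tdim (swapV i V)) (e := tdim (swapV i V)) (fun j => M (s j)) =
  tens (d := tdim V) (e := tdim V) M *m flip i V.
Proof.
have [g _ gf] := flip_idx_bij V.
apply/matrixP => a b; rewrite -(enum_valK b) -(gf (enum_val b)).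
rewrite flip_mulE mul_flipE !mxE !enum_rankK.
rewrite [RHS](reindex_inj (@perm_inj _ s)) /=; apply: eq_bigr => j _.
by rewrite !ffunE.
Qed.

Lemma flip_orthogonal V : flip i V *m (flip i V)^T = 1%:M.
Proof.
apply/matrixP => a b; rewrite flip_mulE mxE flipE enum_rankK mxE.
congr (_ %:R); congr nat_of_bool.
by rewrite eq_sym; apply/eqP/eqP => [/flip_idx_inj /enum_val_inj|->].
Qed.

Definition flips (x y : Utens R n) : Prop := forall V,
  flip i V *m to_completion x (swapV i V) = to_completion y V *m flip i V.

Lemma flips_ug a j : flips (ug a j) (ug a (s j)).
Proof.
move=> V; rewrite !to_completion_ug /slot -flip_tens; congr (_ *m _).
by apply: eq_tens => l; rewrite (inj_eq (@perm_inj _ s)).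
Qed.

Lemma flipsD x y x' y' : flips x y -> flips x' y' -> flips (x + x') (y + y').
Proof. by move=> xy xy' V; rewrite !to_completionD mulmxDr mulmxDl xy xy'. Qed.

Lemma flipsM x y x' y' : flips x y -> flips x' y' -> flips (x * x') (y * y').
Proof. by move=> xy xy' V; rewrite !to_completionM mulmxA xy -mulmxA xy' mulmxA. Qed.

Lemma flips_scal c : flips (pscal _ c) (pscal _ c).
Proof. by move=> V; rewrite !to_completion_scal scalar_mxC. Qed.

(* beta_i x = y, without inverting the R-matrix. *)
Definition braids (x y : Utens R n) : Prop := forall V,
  flip i V *m (Smx i (swapV i V) *m to_completion x (swapV i V)) =
  to_completion y V *m (flip i V *m Smx i (swapV i V)).

Lemma braids_comp x y z :
  (forall W, intertwines (Smx i W) (to_completion x W) (to_completion y W)) ->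
  flips y z -> braids x z.
Proof.
move=> xy yz V; have xyV : Smx i (swapV i V) *m to_completion x (swapV i V) =
  to_completion y (swapV i V) *m Smx i (swapV i V) := xy (swapV i V).
by rewrite xyV mulmxA yz mulmxA.
Qed.

Lemma braidsD x y x' y' : braids x y -> braids x' y' -> braids (x + x') (y + y').
Proof. by move=> xy xy' V; rewrite !to_completionD !mulmxDr mulmxDl xy xy'. Qed.

Lemma braidsM x y x' y' : braids x y -> braids x' y' -> braids (x * x') (y * y').
Proof.
move=> xy xy' V; rewrite !to_completionM -[RHS]mulmxA -xy' !mulmxA; congr (_ *m _).
by have := xy V; rewrite !mulmxA.
Qed.

Lemma braids_scal c : braids (pscal _ c) (pscal _ c).
Proof. by move=> V; rewrite !to_completion_scal mulmxA scalar_mxC. Qed.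

Lemma braidsB x y x' y' : braids x y -> braids x' y' -> braids (x - x') (y - y').
Proof. by move=> xy xy' V; rewrite !to_completionB !mulmxBr mulmxBl xy xy'. Qed.

(** [PsiInv] is conjugation by D, so [braid_op] is conjugation by the flip composed with D Theta;
    Theta, D and the flip then cancel one after the other. *)
Lemma braid_op_eq x y V : braids x y ->
  braid_op i (to_completion x) V = to_completion y V.
Proof.
move=> xy; have := xy V; rewrite /braid_op PsiInvE /Smx -!mulmxE !mulmxA => ->.
rewrite -!mulmxA; set th := Theta i _.
have thK : th *m (invmx th *m (Dinv i (swapV i V) *m (flip i V)^T)) =
  Dinv i (swapV i V) *m (flip i V)^T by rewrite mulKVmx // Theta_unit.
rewrite thK.
have DK : Dmx i (swapV i V) *m (Dinv i (swapV i V) *m (flip i V)^T) = (flip i V)^T.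
  by rewrite mulmxA DmxK mul1mx.
by rewrite DK flip_orthogonal mulmx1.
Qed.

(** Both candidates act on every weight module as beta_i x, and weight modules are faithful. *)
Lemma braids_inj x y y' : braids x y -> braids x y' -> y = y'.
Proof.
by move=> xy xy'; apply: to_completion_inj => V; rewrite -(braid_op_eq _ xy) -(braid_op_eq _ xy').
Qed.

Lemma braids_far a j : j != i0 -> j != i1 -> braids (ug a j) (ug a j).
Proof.
move=> j0 j1; apply: braids_comp (fun W => Smx_far W a j0 j1) _.
by have := flips_ug a j; rewrite tpermD // eq_sym.
Qed.

Lemma flips0 a : flips (ug a i0) (ug a i1).
Proof. by have := flips_ug a i0; rewrite tpermL. Qed.

Lemma flips1 a : flips (ug a i1) (ug a i0).
Proof. by have := flips_ug a i1; rewrite tpermR. Qed.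

Local Notation us := (pscal (@urel R n)).

Lemma braids_E0 : braids (ug gE i0) (ug gK i0 * ug gE i1).
Proof.
rewrite (ug_comm R gK gE (strand_neq i)).
apply: (@braids_comp _ (ug gE i0 * ug gK i1)); last exact: flipsM (flips0 _) (flips1 _).
move=> W; rewrite to_completionM; exact: Smx_E0.
Qed.

Lemma braids_F1 : braids (ug gF i1) (ug gF i0 * ug gKi i1).
Proof.
rewrite (ug_comm R gF gKi (strand_neq i)).
apply: (@braids_comp _ (ug gKi i0 * ug gF i1)); last exact: flipsM (flips0 _) (flips1 _).
move=> W; rewrite to_completionM; exact: Smx_F1.
Qed.

Lemma braids_coprodE :
  braids (ug gE i0 * ug gK i1 + ug gE i1) (ug gE i0 * ug gK i1 + ug gE i1).
Proof.
rewrite {2}(ug_comm R gE gK (strand_neq i)).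
apply: (@braids_comp _ (ug gK i0 * ug gE i1 + ug gE i0)); last first.
  by apply: flipsD (flips0 _); exact: flipsM (flips0 _) (flips1 _).
move=> W; rewrite !to_completionD !to_completionM; exact: Smx_coprodE.
Qed.

Lemma braids_coprodF :
  braids (ug gF i0 + ug gKi i0 * ug gF i1) (ug gF i0 + ug gKi i0 * ug gF i1).
Proof.
apply: (@braids_comp _ (ug gF i1 + ug gKi i1 * ug gF i0)); last first.
  by apply: flipsD (flips1 _) _; exact: flipsM (flips1 _) (flips0 _).
move=> W; rewrite !to_completionD !to_completionM; exact: Smx_coprodF.
Qed.

Lemma braids_KK : braids (ug gK i0 * ug gK i1) (ug gK i0 * ug gK i1).
Proof.
apply: (@braids_comp _ (ug gK i1 * ug gK i0)); last exact: flipsM (flips1 _) (flips0 _).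
move=> W; rewrite !to_completionM; exact: Smx_KK.
Qed.

Lemma braids_JJ : braids (ug gKi i0 * ug gKi i1) (ug gKi i0 * ug gKi i1).
Proof.
apply: (@braids_comp _ (ug gKi i1 * ug gKi i0)); last exact: flipsM (flips1 _) (flips0 _).
move=> W; rewrite !to_completionM; exact: Smx_JJ.
Qed.

Lemma flipsB x y x' y' : flips x y -> flips x' y' -> flips (x - x') (y - y').
Proof. by move=> xy xy' V; rewrite !to_completionB mulmxBr mulmxBl xy xy'. Qed.

Lemma braids_K0 : braids (ug gK i0)
  (ug gK i1 - us (q^-1 * (q - q^-1) ^+ 2) * (ug gF i0 * ug gK i0 * ug gE i1)).
Proof.
apply: (@braids_comp _
  (ug gK i0 - us (q^-1 * (q - q^-1) ^+ 2) * (ug gF i1 * ug gK i1 * ug gE i0))); last first.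
  apply: flipsB (flips0 _) _; apply: flipsM; first exact: flips_scal.
  by apply: flipsM (flips0 _); exact: flipsM (flips1 _) (flips1 _).
move=> W; rewrite !to_completionB !to_completionM to_completion_scal; exact: Smx_K0.
Qed.

Lemma braids_J1 : braids (ug gKi i1)
  (ug gKi i0 - us (q * (q - q^-1) ^+ 2) * (ug gF i0 * ug gKi i1 * ug gE i1)).
Proof.
apply: (@braids_comp _
  (ug gKi i1 - us (q * (q - q^-1) ^+ 2) * (ug gF i1 * ug gKi i0 * ug gE i0))); last first.
  apply: flipsB (flips1 _) _; apply: flipsM; first exact: flips_scal.
  by apply: flipsM (flips0 _); exact: flipsM (flips1 _) (flips0 _).
move=> W; rewrite !to_completionB !to_completionM to_completion_scal; exact: Smx_J1.
Qed.

Lemma braids_casimir_site (s : bool) :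
  braids (casimir (if s then i1 else i0)) (casimir (if s then i0 else i1)).
Proof.
have fl a : flips (ug a (if s then i1 else i0)) (ug a (if s then i0 else i1)).
  by case: s; [exact: flips1 | exact: flips0].
rewrite /casimir !palgZ; set j := if s then i1 else i0.
apply: (@braids_comp _
  (us ((q - q^-1) ^+ 2) * (ug gF j * ug gE j) + us q * ug gK j + us q^-1 * ug gKi j)).
  move=> W; rewrite !to_completionD !to_completionM !to_completion_scal.
  by rewrite /j; case: (s); [exact: (Smx_cas _ _ true) | exact: (Smx_cas _ _ false)].
apply: flipsD (flipsM (flips_scal _) (fl _)); apply: flipsD (flipsM (flips_scal _) (fl _)).
exact: flipsM (flips_scal _) (flipsM (fl _) (fl _)).
Qed.

End Flip.

(** * Transfer matrices *)

Section TransferMatrices.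
Variables (F : fieldType) (q : F) (A : pzRingType) (iota : F -> A).

Local Notation d := (q - q^-1).

(* The generators of I_L are ordered as E, FK, Casimir - (q + q^-1) K, K: with
   this third generator, the counit vanishes on the first three. *)
Definition coideal_cas (g : ugen -> A) : A :=
  iota (d ^+ 2) * (g gF * g gE) + iota q^-1 * g gKi - iota q^-1 * g gK.

Definition seq_mx (rows : seq (seq A)) : 'M[A]_4 :=
  \matrix_(a, b) nth 0 (nth [::] rows a) b.

(* If w is the column of generators of I_L, then Delta(w) = M (x) w where M is
   [coprod_mx], and tau_L(w) = M (x) w where M is [coact_mx]. *)
Definition coprod_mx (g : ugen -> A) : 'M[A]_4 := seq_mx
  [:: [:: 1; 0; 0; g gE];
      [:: 0; 1; 0; g gF * g gK];
      [:: iota (d ^+ 2) * g gF; iota (d ^+ 2) * (g gKi * g gE); g gKi; coideal_cas g];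
      [:: 0; 0; 0; g gK]].

Definition coact_mx (g : ugen -> A) : 'M[A]_4 := seq_mx
  [:: [:: g gK; 0; 0; 0];
      [:: - (iota (q^-1 * d ^+ 2) * (g gF * g gF * g gK)); g gKi; - (iota q * g gF); 0];
      [:: iota ((1 + q ^- 2) * d ^+ 2) * (g gF * g gK); 0; 1; 0];
      [:: - (iota (q^-1 * d ^+ 2) * (g gF * g gK)); 0; 0; 1]].

Definition transfer_mx (b : bool) (g : ugen -> A) : 'M[A]_4 :=
  if b then coprod_mx g else coact_mx g.

(** The coordinates of the Casimir in the ordered generators of I_L; [counit_col] holds the counits
    of these generators. *)
Definition start_row : 'rV[A]_4 :=
  \row_b nth 0 [:: 0; 0; 1; iota (q + q^-1)] b.
Definition counit_col : 'cV[A]_4 := \col_a nth 0 [:: 0; 0; 0; 1] a.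

Local Notation o j := (@Ordinal 4 j isT).

Lemma mulmx4E m p (X : 'M[A]_(m, 4)) (Y : 'M[A]_(4, p)) a b :
  (X *m Y) a b = X a (o 0) * Y (o 0) b + X a (o 1) * Y (o 1) b +
                 X a (o 2) * Y (o 2) b + X a (o 3) * Y (o 3) b.
Proof.
rewrite mxE !big_ord_recl big_ord0 addr0 !addrA.
by congr (X a _ * Y _ b + X a _ * Y _ b + X a _ * Y _ b + X a _ * Y _ b); apply: val_inj.
Qed.

Lemma forall4 (P : 'I_4 -> Prop) :
  P (o 0) -> P (o 1) -> P (o 2) -> P (o 3) -> forall a, P a.
Proof.
by move=> P0 P1 P2 P3 [[|[|[|[|m]]]] ltm] //; rewrite (bool_irrelevance ltm isT).
Qed.

Variable v : letter -> A.
Hypotheses (q0 : q != 0) (qgen : forall n, (0 < n)%N -> q ^+ n != 1).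
Hypothesis ts : two_sites q iota v.
Let cs := ts_scal ts.
Let qq1 := generic_qq1 qgen.

Local Notation E0 := (v (false, gE)). Local Notation F0 := (v (false, gF)).
Local Notation K0 := (v (false, gK)). Local Notation J0 := (v (false, gKi)).
Local Notation E1 := (v (true, gE)). Local Notation F1 := (v (true, gF)).
Local Notation K1 := (v (true, gK)). Local Notation J1 := (v (true, gKi)).
Local Notation cas s :=
  (iota (d ^+ 2) * (v (s, gF) * v (s, gE)) + iota q * v (s, gK) + iota q^-1 * v (s, gKi)).
Local Notation DE := (E0 * K1 + E1).
Local Notation DF := (F0 + J0 * F1).
Local Notation KK := (K0 * K1).
Local Notation JJ := (J0 * J1).
Definition cas01 : A :=
  iota (d ^+ 2) * (DF * DE) + iota q * KK + iota q^-1 * JJ.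

Inductive coprod_gen : A -> Prop :=
| coprod_gE : coprod_gen DE
| coprod_gF : coprod_gen DF
| coprod_gK : coprod_gen KK
| coprod_gKi : coprod_gen JJ.

(* z, y, u, w stand for corresponding entries of the transfer matrices of two
   adjacent factors j, j+1 with j, j+1, both or none of them in A: the braiding
   maps z to y and fixes u and w, and the four satisfy [aw_relation].  Both
   properties are stable under the closure operations below. *)
Inductive resolution : A -> A -> A -> A -> Prop :=
| res_K : resolution K0 (K1 - iota (q^-1 * d ^+ 2) * (F0 * K0 * E1)) KK 1
| res_Ki : resolution J1 (J0 - iota (q * d ^+ 2) * (F0 * J1 * E1)) 1 JJ
| res_cas : resolution (cas false) (cas true) cas01 (iota (q + q^-1))
| res_scal c z y u w : resolution z y u w ->
    resolution (iota c * z) (iota c * y) (iota c * u) (iota c * w)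
| res_add z y u w z' y' u' w' : resolution z y u w -> resolution z' y' u' w' ->
    resolution (z + z') (y + y') (u + u') (w + w')
| res_mull x z y u w : coprod_gen x -> resolution z y u w ->
    resolution (x * z) (x * y) (x * u) (x * w)
| res_mulr x z y u w : coprod_gen x -> resolution z y u w ->
    resolution (z * x) (y * x) (u * x) (w * x).

Lemma cas01_comm x : coprod_gen x -> cas01 * x = x * cas01.
Proof. by case; rewrite /cas01; uq_normalise ts q0 qq1. Qed.

Lemma cas_comm s x : coprod_gen x -> cas s * x = x * cas s.
Proof. by case: s; case; uq_normalise ts q0 qq1. Qed.

Definition commutes_cas x :=
  [/\ cas01 * x = x * cas01, cas false * x = x * cas false & cas true * x = x * cas true].

(** The relation is linear in (z, y, u, w), its other ingredients being the Casimirs of the pair and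
    of the two factors: so it survives sums, and products with anything in [commutes_cas]. *)
Definition aw_relation z y u w := iota q * (cas01 * z) - iota q^-1 * (z * cas01) =
  iota (q ^- 2 - q ^+ 2) * y + iota d * (cas false * u + cas true * w).

Lemma aw_relationD z y u w z' y' u' w' : aw_relation z y u w ->
  aw_relation z' y' u' w' -> aw_relation (z + z') (y + y') (u + u') (w + w').
Proof.
rewrite /aw_relation => IH IH'.
rewrite (mulrDl z z') (mulrDr cas01) (mulrDr (iota q)) (mulrDr (iota q^-1)) opprD.
rewrite addrACA IH IH' addrACA -!mulrDr; congr (_ + _ * _).
by rewrite addrACA -!mulrDr.
Qed.

Lemma aw_relation_mull x z y u w : commutes_cas x -> aw_relation z y u w ->
  aw_relation (x * z) (x * y) (x * u) (x * w).
Proof.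
move=> [x01 x0 x1]; rewrite /aw_relation => IH.
rewrite (mulrA cas01) x01 -(mulrA x cas01) -(mulrA x z).
rewrite (mulrA (cas false)) (mulrA (cas true)) x0 x1 -!(mulrA x).
by rewrite -(mulrDr x) -!(csCA cs _ x) -(mulrBr x) IH (mulrDr x).
Qed.

Lemma aw_relation_mulr x z y u w : commutes_cas x -> aw_relation z y u w ->
  aw_relation (z * x) (y * x) (u * x) (w * x).
Proof.
move=> [x01 x0 x1]; rewrite /aw_relation => IH.
rewrite -(mulrA z) -x01 (mulrA cas01) (mulrA z) (mulrA (iota q)).
rewrite (mulrA (iota q^-1)) -mulrBl IH mulrDl -!(mulrA (iota _)) mulrDl.
by rewrite -(mulrA (cas false)) -(mulrA (cas true)).
Qed.

Lemma resolution_relation z y u w : resolution z y u w -> aw_relation z y u w.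
Proof.
have comm x : coprod_gen x -> commutes_cas x.
  by move=> cx; split; [exact: cas01_comm | exact: cas_comm | exact: cas_comm].
elim=> {z y u w}.
- by rewrite /aw_relation /cas01; uq_normalise ts q0 qq1.
- by rewrite /aw_relation /cas01; uq_normalise ts q0 qq1.
- by rewrite /aw_relation /cas01; uq_normalise ts q0 qq1.
- move=> c z y u w _; apply: aw_relation_mull; split; exact/esym/(csC cs).
- by move=> z y u w z' y' u' w' _ IH _; exact: aw_relationD.
- by move=> x z y u w /comm cx _; exact: aw_relation_mull.
- by move=> x z y u w /comm cx _; exact: aw_relation_mulr.
Qed.

Lemma resolution0 : resolution 0 0 0 0.
Proof.
by have := res_scal 0 res_K; rewrite !(cs0 cs) !mul0r.
Qed.

Lemma res_sub z y u w z' y' u' w' : resolution z y u w -> resolution z' y' u' w' ->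
  resolution (z - z') (y - y') (u - u') (w - w').
Proof.
move=> r /(res_scal (-1)); rewrite !(csN cs) !(cs1 cs) !mulN1r; exact: res_add.
Qed.

Lemma resolvesP z y u w z' y' u' w' : resolution z' y' u' w' ->
  z = z' -> y = y' -> u = u' -> w = w' -> resolution z y u w.
Proof. by move=> r -> -> -> ->. Qed.

Local Notation g0 := (fun a => v (false, a)).
Local Notation g1 := (fun a => v (true, a)).

(** All sixteen entries come from the three basic quadruples: commutators with coproducts extract E,
    F and the remaining Cartan entry, and the matrix entries are combinations of these. *)
Lemma transfer_resolution a b :
  resolution ((coprod_mx g0 *m coact_mx g1) a b) ((coact_mx g0 *m coprod_mx g1) a b)
             ((coprod_mx g0 *m coprod_mx g1) a b) ((coact_mx g0 *m coact_mx g1) a b).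
Proof.
have qq1' : 1 - q * q != 0 by rewrite -opprB oppr_eq0.
(* The commutator of Delta(E) with K (x) 1 is (1 - q^2) EK (x) K; multiplying by Delta(K^-1)
   isolates E (x) 1. The same is done for F with 1 (x) K^-1. *)
have rE : resolution E0 (K0 * E1) DE 0.
  apply: (resolvesP (res_scal (1 - q ^+ 2)^-1 (res_mulr coprod_gKi
    (res_sub (res_mull coprod_gE res_K) (res_mulr coprod_gE res_K)))));
  uq_normalise ts q0 qq1; by field; rewrite ?q0 ?qq1 ?qq1'.
have rF : resolution F1 (F0 * J1) 0 DF.
  apply: (resolvesP (res_scal (1 - q ^+ 2)^-1 (res_mulr coprod_gK
    (res_sub (res_mull coprod_gF res_Ki) (res_mulr coprod_gF res_Ki)))));
  uq_normalise ts q0 qq1; by field; rewrite ?q0 ?qq1 ?qq1'.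
(* Adding (q - q^-1) [Delta(E), 1 (x) F] to 1 (x) K^-1 replaces K^-1 by K, up to the term in E (x)
   FK. *)
have rB : resolution (K1 - iota (q^-1 * d ^+ 2) * (E0 * F1 * K1)) K0 1 KK.
  apply: (resolvesP (res_add res_Ki (res_scal d (res_sub (res_mull coprod_gE rF)
    (res_mulr coprod_gE rF))))); uq_normalise ts q0 qq1.
elim/forall4: a; elim/forall4: b; rewrite !mulmx4E !mxE /= /coideal_cas;
  [ apply: (resolvesP rB)
  | apply: (resolvesP resolution0)
  | apply: (resolvesP resolution0)
  | apply: (resolvesP rE)
  | apply: (resolvesP (res_scal (- (q^-1 * d ^+ 2))
      (res_mull coprod_gF (res_mulr coprod_gK rF))))
  | apply: (resolvesP res_Ki)
  | apply: (resolvesP (res_scal (- q) rF))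
  | apply: (resolvesP (res_sub (res_mull coprod_gF res_K) rF))
  | apply: (resolvesP (res_scal (d ^+ 2) (res_add (res_mulr coprod_gF rB)
      (res_scal (1 - q ^- 2)^-1 (res_sub (res_mull coprod_gF rB) (res_mulr coprod_gF rB))))))
  | apply: (resolvesP (res_scal (d ^+ 2 * q ^- 2) (res_mulr coprod_gKi rE)))
  | apply: (resolvesP (res_mulr coprod_gKi rB))
  | apply: (resolvesP (res_sub res_cas (res_scal (q + q^-1) res_K)))
  | apply: (resolvesP (res_scal (- (q^-1 * d ^+ 2)) (res_mulr coprod_gK rF)))
  | apply: (resolvesP resolution0)
  | apply: (resolvesP resolution0)
  | apply: (resolvesP res_K) ];
  rewrite /cas01; uq_normalise ts q0 qq1; by field; rewrite ?q0 ?qq1 ?qq1'.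
Qed.

End TransferMatrices.

Section TransferRelation.
Variables (F : fieldType) (q : F) (A B : pzRingType).
Variables (iota : F -> A) (iota' : F -> B) (G : A -> B -> Prop).
Hypotheses (cs : central_scalars iota) (cs' : central_scalars iota').
Hypotheses (GD : forall x y x' y', G x y -> G x' y' -> G (x + x') (y + y')).
Hypotheses (GM : forall x y x' y', G x y -> G x' y' -> G (x * x') (y * y')).
Hypothesis GS : forall c, G (iota c) (iota' c).

Lemma rel0 : G 0 0.
Proof. by have := GS 0; rewrite (cs0 cs) (cs0 cs'). Qed.
Lemma rel1 : G 1 1.
Proof. by have := GS 1; rewrite (cs1 cs) (cs1 cs'). Qed.
Lemma relN x y : G x y -> G (- x) (- y).
Proof.
by move=> /(GM (GS (-1))); rewrite (csN cs) (csN cs') (cs1 cs) (cs1 cs') !mulN1r.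
Qed.

(** A general relation G closed under the algebra operations serves at once for the graphs of Delta,
    tau_L and padding, for [braids], and for commutation with the Casimirs. *)
Lemma rel_transfer b g g' : (forall a, G (g a) (g' a)) ->
  forall a c, G (transfer_mx q iota b g a c) (transfer_mx q iota' b g' a c).
Proof.
move=> Gg a c; have := rel0; have := rel1.
case: b; elim/forall4: a; elim/forall4: c; rewrite !mxE /= => G1 G0 //;
  rewrite /coideal_cas; repeat first [exact: GS | exact: Gg | apply: GD | apply: relN | apply: GM].
Qed.

Lemma rel_mulmx m p (X : 'M[A]_(m, 4)) (Y : 'M[A]_(4, p))
    (X' : 'M[B]_(m, 4)) (Y' : 'M[B]_(4, p)) :
  (forall a b, G (X a b) (X' a b)) -> (forall a b, G (Y a b) (Y' a b)) ->
  forall a b, G ((X *m Y) a b) ((X' *m Y') a b).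
Proof. by move=> GX GY a b; rewrite !mulmx4E; repeat first [exact: GX | exact: GY | apply: GD | apply: GM]. Qed.

Lemma rel_start a b : G (start_row q iota a b) (start_row q iota' a b).
Proof.
have G0 := rel0; have G1 := rel1.
by elim/forall4: b; rewrite !mxE /=; try exact: GS.
Qed.

Lemma rel_counit a b : G (counit_col A a b) (counit_col B a b).
Proof.
by have G0 := rel0; have G1 := rel1; elim/forall4: a; rewrite !mxE.
Qed.

End TransferRelation.

Section TransferEnds.
Variables (F : fieldType) (q : F) (A : pzRingType) (iota : F -> A).
Hypotheses (cs : central_scalars iota) (q0 : q != 0).

(** The matrix form of tau_L(Casimir) = 1 (x) Casimir: factors before the first element of A leave
    no trace. *)
Lemma start_coact g : start_row q iota *m coact_mx q iota g = start_row q iota.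
Proof.
apply/matrixP => a b; rewrite mulmx4E; elim/forall4: b; rewrite !mxE /=;
  rewrite ?mul0r ?mul1r ?mulr0 ?mulr1 ?add0r ?addr0 //.
rewrite mulrN [X in _ - X]mulrA -(csM cs); apply/eqP; rewrite subr_eq0; apply/eqP.
by congr (iota _ * _); field; rewrite q0.
Qed.

(** Factors after the largest element of A leave no trace either, so the product may run over all n
    factors although the construction stops there and pads by 1. *)
Lemma coact_counit g : coact_mx q iota g *m counit_col A = counit_col A.
Proof.
apply/matrixP => a b; rewrite mulmx4E; elim/forall4: a; rewrite !mxE /=;
  by rewrite ?mulr0 ?mulr1 ?add0r ?addr0.
Qed.

Lemma start_counit : (start_row q iota *m counit_col A) 0 0 = iota (q + q^-1).
Proof. by rewrite mulmx4E !mxE /= !mulr0 mulr1 !add0r. Qed.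

Lemma start_coprod_counit g :
  (start_row q iota *m (coprod_mx q iota g *m counit_col A)) 0 0 =
  iota ((q - q^-1) ^+ 2) * (g gF * g gE) + iota q * g gK + iota q^-1 * g gKi.
Proof.
rewrite !mulmx4E !mxE /= ?mul0r ?mul1r ?mulr0 ?mulr1 ?add0r ?addr0.
by rewrite /coideal_cas (csD cs) mulrDl [iota q * g gK + _]addrC addrA subrK addrAC.
Qed.

End TransferEnds.

(** * Lambda_A as a product of transfer matrices *)

Section Lambda.
Variables (R : realType) (m : nat).
Local Notation U := (Utens R m).
Local Notation us := (pscal (@urel R m)).
Local Notation cs := (palg_scalars (@urel R m)).

(** Indexing by natural numbers, with the junk value 0 beyond m, allows rows over U^(x)m and over
    U^(x)(m+1) to be compared at the same index. *)
Definition gen_at (a : ugen) (j : nat) : U :=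
  if insub j is Some i then ug a i else 0.

Lemma gen_atE a (i : 'I_m) : gen_at a i = ug a i.
Proof. by rewrite /gen_at valK. Qed.

Definition site_mx (A : pred nat) (j : nat) : 'M[U]_4 :=
  transfer_mx q us (A j) (gen_at^~ j).

Fixpoint left_row (A : pred nat) (j : nat) : 'rV[U]_4 :=
  if j is j'.+1 then left_row A j' *m site_mx A j' else start_row q us.

Definition transfer_Lambda (A : pred nat) : U := (left_row A m *m counit_col U) 0 0.

Lemma eq_left_row (A A' : pred nat) j : (forall l, (l < j)%N -> A l = A' l) ->
  left_row A j = left_row A' j.
Proof.
elim: j => //= j IH AA'; rewrite IH => [|l lj]; last by apply: AA'; exact: ltnW.
by rewrite /site_mx AA'.
Qed.

End Lambda.

Section CoproductAndCoaction.
Variables (F : fieldType) (q : F) (A : pzRingType) (iota : F -> A).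
Variable v : letter -> A.
Hypotheses (q0 : q != 0) (qgen : forall n, (0 < n)%N -> q ^+ n != 1).
Hypothesis ts : two_sites q iota v.
Let cs := ts_scal ts.
Let qq1 := generic_qq1 qgen.

Local Notation d := (q - q^-1).
Local Notation E0 := (v (false, gE)). Local Notation F0 := (v (false, gF)).
Local Notation K0 := (v (false, gK)). Local Notation J0 := (v (false, gKi)).
Local Notation E1 := (v (true, gE)). Local Notation F1 := (v (true, gF)).
Local Notation K1 := (v (true, gK)). Local Notation J1 := (v (true, gKi)).
Local Notation cas1 :=
  (iota (d ^+ 2) * (F1 * E1) + iota q * K1 + iota q^-1 * J1).
Local Notation g0 := (fun a => v (false, a)).
Local Notation g1 := (fun a => v (true, a)).

Definition coprod (a : ugen) : A :=
  match a with
  | gE => E0 * K1 + E1 | gF => F0 + J0 * F1 | gK => K0 * K1 | gKi => J0 * J1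
  end.

Lemma coprod_one_site : one_site q iota coprod.
Proof. by split; rewrite /coprod; uq_normalise ts q0 qq1. Qed.

Definition coactFK : A :=
  J0 * (F1 * K1) - iota q * (F0 * cas1) + iota (q * (q + q^-1)) * (F0 * K1)
  - iota (q^-1 * d ^+ 2) * (F0 ^+ 2 * K0 * E1).

Definition coactK : A := K1 - iota (q^-1 * d ^+ 2) * (F0 * K0 * E1).

(** This writes FK (x) 1 through Delta(F), K (x) 1 and 1 (x) F, whose braidings are known;
    [coactFK_coprod] is the same formula after braiding. *)
Lemma FK_coprod : F0 * K0 = (F0 + J0 * F1) * K0 - F1.
Proof. by uq_normalise ts q0 qq1. Qed.

Lemma coactFK_coprod : coactFK = (F0 + J0 * F1) * coactK - F0 * J1.
Proof. by rewrite /coactFK /coactK; uq_normalise ts q0 qq1. Qed.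

(** The column w of generators of I_L, written as (id (x) counit) Delta(w): in this form the largest
    element of A contributes a transfer matrix like any other. *)
Definition gens_col (g : ugen -> A) : 'cV[A]_4 := coprod_mx q iota g *m counit_col A.

Lemma gens_colE g a : gens_col g a 0 =
  nth 0 [:: g gE; g gF * g gK; coideal_cas q iota g; g gK] a.
Proof.
rewrite /gens_col mulmx4E; elim/forall4: a; rewrite !mxE /=;
  by rewrite ?mulr0 ?mulr1 ?add0r ?addr0.
Qed.

Lemma coprod_gens a : (coprod_mx q iota g0 *m gens_col g1) a 0 =
  nth 0 [:: coprod gE; coprod gF * coprod gK; coideal_cas q iota coprod; coprod gK] a.
Proof.
rewrite mulmx4E !gens_colE; elim/forall4: a; rewrite !mxE /= /coideal_cas /coprod;
  by uq_normalise ts q0 qq1.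
Qed.

Lemma start_coprod_gens :
  (start_row q iota *m (coprod_mx q iota g0 *m gens_col g1)) 0 0 = cas01 q iota v.
Proof.
rewrite mulmx4E !coprod_gens !mxE /= /coideal_cas /coprod /cas01.
by uq_normalise ts q0 qq1.
Qed.

Lemma coact_gens a : (coact_mx q iota g0 *m gens_col g1) a 0 =
  nth 0 [:: K0 * E1; coactFK; cas1 - iota (q + q^-1) * coactK; coactK] a.
Proof.
rewrite mulmx4E !gens_colE; elim/forall4: a; rewrite !mxE /= /coideal_cas /coactFK /coactK;
  by uq_normalise ts q0 qq1; field; rewrite q0.
Qed.

End CoproductAndCoaction.

Section UtensMorphisms.
Variables (R : realType) (m : nat) (A : pzRingType) (iota : qfield R -> A).
Hypothesis cs : central_scalars iota.
Variable v : 'I_m * ugen -> A.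
Hypothesis vs : forall i, one_site (q : qfield R) iota (fun a => v (i, a)).
Hypothesis vc : forall i j a b, i != j -> v (i, a) * v (j, b) = v (j, b) * v (i, a).

Lemma urel_peval s t : @urel R m s t -> peval iota v s = peval iota v t.
Proof.
case=> {s t} [i|i|i|i|i|i j a b ij] /=; last exact: vc.
- by rewrite (os_KKi (vs i)) (cs1 cs).
- by rewrite (os_KiK (vs i)) (cs1 cs).
- exact: os_KE (vs i).
- exact: os_KF (vs i).
- by rewrite !(csN cs) !(cs1 cs) !mulN1r; exact: os_EF (vs i).
Qed.

End UtensMorphisms.

Section Steps.
Variables (R : realType) (m : nat).
Local Notation U := (Utens R m).
Local Notation U' := (Utens R m.+1).
Local Notation us := (pscal (@urel R m)).
Local Notation us' := (pscal (@urel R m.+1)).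
Local Notation cs := (palg_scalars (@urel R m)).
Local Notation cs' := (palg_scalars (@urel R m.+1)).
Let q0 := q_neq0 R.
Let qq1 := generic_qq1 (@q_expn_neq1 R).

Lemma wd_neq_max (i : 'I_m) : wd i != ord_max.
Proof. by rewrite -val_eqE /= neq_ltn ltn_ord. Qed.

Lemma wd_inj : injective (@wd m).
Proof. by move=> i j /(congr1 val) /= ij; apply: val_inj. Qed.

Lemma last_two_sites (i : 'I_m) : two_sites (q : qfield R) us'
  (fun x : letter => ug x.2 (if x.1 then ord_max else wd i)).
Proof. exact/ug_two_sites/wd_neq_max. Qed.

Definition pad_images (x : 'I_m * ugen) : U' := ug x.2 (wd x.1).

Lemma pad_rel s t : urel s t -> peval us' pad_images s = peval us' pad_images t.
Proof.
apply: urel_peval => [|i|i j a b ij]; first exact: cs'.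
  by have := ug_site R (wd i).
by apply: ug_comm; rewrite (inj_eq wd_inj).
Qed.

Definition last_letter (i : 'I_m) (x : letter) : U' :=
  ug x.2 (if x.1 then ord_max else wd i).

Definition coprod_images (x : 'I_m * ugen) : U' :=
  if (x.1.+1 < m)%N then ug x.2 (wd x.1) else coprod (last_letter x.1) x.2.

Lemma coprod_site i : one_site (q : qfield R) us' (fun a => coprod_images (i, a)).
Proof.
rewrite /coprod_images /=; case: (i.+1 < m)%N; first by have := ug_site R (wd i).
exact: (coprod_one_site q0 (@q_expn_neq1 R) (last_two_sites i)).
Qed.

Lemma coprod_rel s t :
  urel s t -> peval us' coprod_images s = peval us' coprod_images t.
Proof.
apply: urel_peval => [|i|i j a b ij]; [exact: cs' | exact: coprod_site |].
have far c e : GRing.comm (ug c (wd i) : U') (ug e (wd j)).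
  by apply: ug_comm; rewrite (inj_eq wd_inj).
have top c e (l : 'I_m) : GRing.comm (ug c (wd l) : U') (ug e ord_max).
  exact/ug_comm/wd_neq_max.
rewrite /coprod_images /=; case: ifP => im; case: ifP => jm.
- exact: far.
- by case: b; rewrite /coprod /last_letter /=; repeat first [exact: far | exact: top | apply: commrD | apply: commrM].
- apply: commr_sym; case: a; rewrite /coprod /last_letter /=;
  by repeat first [apply: (commr_sym (far _ _)) | exact: top | apply: commrD | apply: commrM].
- case/eqP: ij; apply: val_inj => /=; have := ltn_ord i; have := ltn_ord j.
  by move: im jm; lia.
Qed.

(** Delta and padding are defined on the whole presented algebra, so their graphs are functional as
    soon as the images of the generators respect the relations. *)
Lemma graph_pext (G : U -> U' -> Prop) v :
  (forall s t, @urel R m s t -> peval us' v s = peval us' v t) ->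
  (forall x y, G x y -> y = pext us' v x) ->
  forall x y, alg_graph G x y -> y = pext us' v x.
Proof.
move=> rv Gv x y; elim=> {x y} [//|c|x y x' y' _ -> _ ->|x y x' y' _ -> _ ->].
- exact/esym/(pext_scal cs' rv).
- by rewrite (pextD cs' rv).
- by rewrite (pextM cs' rv).
Qed.

Lemma delta_fun x y y' : alg_graph (@delta_gen R m) x y ->
  alg_graph (@delta_gen R m) x y' -> y = y'.
Proof.
have Gv x' y'' : delta_gen x' y'' -> y'' = pext us' coprod_images x'.
  by case=> [i a im|i im|i im|i im|i im]; rewrite (pext_gen cs' coprod_rel)
    /coprod_images /= ?im // ltnn.
by move=> /(graph_pext coprod_rel Gv) -> /(graph_pext coprod_rel Gv) ->.
Qed.

Lemma pad_fun x y y' : alg_graph (@pad_gen R m) x y ->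
  alg_graph (@pad_gen R m) x y' -> y = y'.
Proof.
have Gv x' y'' : pad_gen x' y'' -> y'' = pext us' pad_images x'.
  by case=> i a; rewrite (pext_gen cs' pad_rel).
by move=> /(graph_pext pad_rel Gv) -> /(graph_pext pad_rel Gv) ->.
Qed.

(** tau_L(x) is the braiding of x (x) 1. This replaces a presentation of I_L: with [braids_inj] it
    shows that the graph of tau_L is functional. *)
Lemma tau_braids (i : 'I_m) x y : i.+1 = m -> alg_graph (@tau_gen R m) x y ->
  braids (n := m.+1) i (pext us' pad_images x) y.
Proof.
move=> im; have i0 : strand (n := m.+1) i = wd i by apply: val_inj.
have i1 : strandS (n := m.+1) i = ord_max by apply: val_inj => /=.
have lasti (j : 'I_m) : j.+1 = m -> j = i by move=> jm; apply: val_inj => /=; lia.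
have bK := @braids_K0 R m.+1 i; have bF := @braids_coprodF R m.+1 i.
have bF1 := @braids_F1 R m.+1 i; have bC := @braids_casimir_site R m.+1 i false.
rewrite i0 i1 in bK bF bF1 bC.
have ts := last_two_sites i.
elim=> {x y} [x y|c|x y x' y' _ IH _ IH'|x y x' y' _ IH _ IH'].
- case=> [j a jm|j jm|j jm|j jm|j jm]; rewrite ?(lasti j jm) ?(pextM cs' pad_rel)
    ?(pext_gen cs' pad_rel) /pad_images /=.
  + by apply: braids_far; rewrite ?i0 ?i1 ?wd_neq_max // (inj_eq wd_inj) -val_eqE /=; lia.
  + by have := @braids_E0 R m.+1 i; rewrite i0 i1.
  (* The braiding fixes Delta(F), sends K (x) 1 to tau_L(K), and sends 1 (x) F to F (x) K^-1. *)
  + have fk := FK_coprod q0 ts; rewrite /= in fk; rewrite fk.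
    have tk := coactFK_coprod q0 ts.
    rewrite /coactFK /coactK /= in tk; rewrite /casimir !palgZ tk.
    by apply: braidsB bF1; apply: braidsM.
  + by rewrite palgZ.
  + rewrite {1}/casimir !palgZ !(pextD cs' pad_rel) !(pextM cs' pad_rel).
    rewrite !(pext_gen cs' pad_rel) !(pext_scal cs' pad_rel) /pad_images /=.
    by rewrite /casimir !palgZ in bC *.
- by rewrite (pext_scal cs' pad_rel); exact: braids_scal.
- by rewrite (pextD cs' pad_rel); exact: braidsD.
- by rewrite (pextM cs' pad_rel); exact: braidsM.
Qed.

Lemma tau_fun (i : 'I_m) x y y' : i.+1 = m -> alg_graph (@tau_gen R m) x y ->
  alg_graph (@tau_gen R m) x y' -> y = y'.
Proof. by move=> im /(tau_braids im) xy /(tau_braids im); exact: braids_inj xy. Qed.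

End Steps.

Section StepGraphs.
Variables (R : realType) (m : nat).
Local Notation us := (pscal (@urel R m)).
Local Notation us' := (pscal (@urel R m.+1)).
Local Notation cs := (palg_scalars (@urel R m)).
Local Notation cs' := (palg_scalars (@urel R m.+1)).

Section OneGraph.
Variable G : Utens R m -> Utens R m.+1 -> Prop.
Hypothesis keep : forall (i : 'I_m) a, (i.+1 < m)%N -> G (ug a i) (ug a (wd i)).
Local Notation GG := (alg_graph G).

Lemma gen_at_wd a (i : 'I_m) : @gen_at R m.+1 a i = ug a (wd i).
Proof. by rewrite -[nat_of_ord i]/(nat_of_ord (wd i)) gen_atE. Qed.

Lemma gen_at_graph a j : (j.+1 < m)%N -> GG (@gen_at R m a j) (@gen_at R m.+1 a j).
Proof.
move=> jm; have jm' := ltnW jm.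
rewrite -[j]/(nat_of_ord (Ordinal jm')) gen_atE gen_at_wd.
by apply: graph_gen; apply: keep.
Qed.

Lemma row_graph A j b : (j < m)%N ->
  GG (@left_row R m A j 0 b) (@left_row R m.+1 A j 0 b).
Proof.
have GD := @graph_add _ _ _ _ _ G; have GM := @graph_mul _ _ _ _ _ G.
have GS c : GG (us c) (us' c) := @graph_scal _ _ _ _ _ G c.
elim: j b => [|j IH] b jm; first exact: (rel_start q cs cs' GS).
apply: (rel_mulmx GD GM) => [a' b'|]; first by rewrite (ord1 a'); apply: IH; exact: ltnW.
apply: (rel_transfer q cs cs' GD GM GS) => a; exact: gen_at_graph.
Qed.

Variable i : 'I_m.
Hypothesis im : i.+1 = m.

Lemma step_graph A (M : 'M[Utens R m.+1]_4) :
  (forall a, GG (gens_col (q : qfield R) us (fun g => ug g i) a 0)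
     ((M *m gens_col (q : qfield R) us' (fun g => ug g ord_max)) a 0)) ->
  GG ((@left_row R m A i *m gens_col (q : qfield R) us (fun g => @gen_at R m g i)) 0 0)
     ((@left_row R m.+1 A i *m M *m gens_col (q : qfield R) us' (fun g => @gen_at R m.+1 g m)) 0 0).
Proof.
move=> GW; have GD := @graph_add _ _ _ _ _ G; have GM := @graph_mul _ _ _ _ _ G.
rewrite -mulmxA; apply: (rel_mulmx GD GM) => a b.
  by rewrite (ord1 a); apply: row_graph; rewrite -{2}im.
rewrite (ord1 b).
have -> : (fun g => @gen_at R m g i) = (fun g => ug g i) by apply: funext => g; exact: gen_atE.
have -> // : (fun g => @gen_at R m.+1 g m) = (fun g => ug g ord_max).
by apply: funext => g; exact: (gen_atE _ _ (ord_max : 'I_m.+1)).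
Qed.

End OneGraph.

Variable i : 'I_m.
Hypothesis im : i.+1 = m.

Lemma delta_gens a : alg_graph (@delta_gen R m)
  (gens_col (q : qfield R) us (fun g => ug g i) a 0)
  ((coprod_mx (q : qfield R) us' (fun g => ug g (wd i)) *m
    gens_col (q : qfield R) us' (fun g => ug g ord_max)) a 0).
Proof.
have GD := @graph_add _ _ _ _ _ (@delta_gen R m).
have GM := @graph_mul _ _ _ _ _ (@delta_gen R m).
have GS c : alg_graph (@delta_gen R m) (us c) (us' c) := graph_scal _ c.
have GN x y := @relN _ _ _ _ _ _ cs cs' GM GS x y.
rewrite [X in alg_graph _ _ X](coprod_gens (q_neq0 R) (last_two_sites R i) a) gens_colE.
have Gg g : alg_graph (@delta_gen R m) (ug g i) (coprod (fun x : letter => ug x.2 (if x.1 then ord_max else wd i)) g).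
  apply: graph_gen; case: g; [exact: delta_E | exact: delta_F | exact: delta_K | exact: delta_Ki].
move: (coprod _) Gg => c Gg; elim/forall4: a => /=; rewrite /coideal_cas;
  repeat first [exact: Gg | exact: GS | apply: graph_add | apply: GN | apply: graph_mul].
Qed.

Lemma tau_gens a : alg_graph (@tau_gen R m)
  (gens_col (q : qfield R) us (fun g => ug g i) a 0)
  ((coact_mx (q : qfield R) us' (fun g => ug g (wd i)) *m
    gens_col (q : qfield R) us' (fun g => ug g ord_max)) a 0).
Proof.
have GD := @graph_add _ _ _ _ _ (@tau_gen R m).
have GM := @graph_mul _ _ _ _ _ (@tau_gen R m).
have GS c : alg_graph (@tau_gen R m) (us c) (us' c) := graph_scal _ c.
have GN x y := @relN _ _ _ _ _ _ cs cs' GM GS x y.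
rewrite [X in alg_graph _ _ X](coact_gens (q_neq0 R) (last_two_sites R i) a) gens_colE.
have GK : alg_graph (@tau_gen R m) (ug gK i) (coactK (q : qfield R) us' (fun x : letter => ug x.2 (if x.1 then ord_max else wd i))).
  by apply: graph_gen; have := @tau_K R m i im; rewrite palgZ.
elim/forall4: a => /=.
- exact/graph_gen/tau_E.
- by apply: graph_gen; have := @tau_FK R m i im; rewrite !palgZ /casimir !palgZ.
- have -> : coideal_cas (q : qfield R) us (fun g => ug g i) = casimir i - us (q + q^-1) * ug gK i.
    rewrite /coideal_cas /casimir !palgZ (csD cs) mulrDl opprD addrA.
    by rewrite [in RHS](addrAC _ (us q * _)) addrK.
  apply: graph_add; last by apply: GN; apply: graph_mul.
  by apply: graph_gen; have := @tau_Casimir R m i im; rewrite /casimir !palgZ.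
- exact: GK.
Qed.

End StepGraphs.

Section LambdaTransfer.
Variable R : realType.
Implicit Type A : pred nat.

(** The element reached in U^(x)m: as long as A has elements from m on, the last factor still
    carries the column of generators, to which the next Delta or tau_L applies; afterwards the
    product is complete. *)
Definition partial_Lambda m A : Utens R m :=
  if `[< exists2 j, A j & (m <= j)%N >]
  then (@left_row R m A m.-1 *m
        gens_col (q : qfield R) (pscal (@urel R m)) (fun g => @gen_at R m g m.-1)) 0 0
  else transfer_Lambda R m A.

Lemma partial_LambdaS m A : (exists2 j, A j & (m <= j)%N) ->
  partial_Lambda m.+1 A = (@left_row R m.+1 A m *m
    gens_col (q : qfield R) (pscal (@urel R m.+1)) (fun g => @gen_at R m.+1 g m)) 0 0.
Proof.
move=> [j Aj mj]; rewrite /partial_Lambda; case: asboolP => // noA.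
(* Here m is the largest element of A: its site matrix is that of Delta, and applied to the counit
   column it gives the column of generators, so both descriptions agree. *)
have jm : j = m.
  apply/eqP; rewrite eqn_leq mj andbT leqNgt; apply/negP => mj'; apply: noA.
  by exists j.
by rewrite /transfer_Lambda /= /site_mx -jm Aj /= -mulmxA.
Qed.

Lemma delta_step m A : A m -> (exists2 j, A j & (m.+1 <= j)%N) ->
  alg_graph (@delta_gen R m.+1) (partial_Lambda m.+1 A) (partial_Lambda m.+2 A).
Proof.
move=> Am exA; have exA' : exists2 j, A j & (m <= j)%N.
  by have [j Aj mj] := exA; exists j => //; exact: ltnW.
rewrite (partial_LambdaS exA') (partial_LambdaS exA).
have keep (i : 'I_m.+1) a : (i.+1 < m.+1)%N -> delta_gen (ug a i : Utens R m.+1) (ug a (wd i)).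
  exact: delta_keep.
have := step_graph keep (i := ord_max) erefl A (delta_gens R (i := ord_max) erefl).
rewrite /= /site_mx Am /=.
have -> : (fun g => @gen_at R m.+2 g m) = (fun g => ug g (wd ord_max)).
  by apply: funext => g; exact: (gen_atE R g (wd ord_max : 'I_m.+2)).
exact: id.
Qed.

Lemma tau_step m A : ~~ A m -> (exists2 j, A j & (m.+1 <= j)%N) ->
  alg_graph (@tau_gen R m.+1) (partial_Lambda m.+1 A) (partial_Lambda m.+2 A).
Proof.
move=> Am exA; have exA' : exists2 j, A j & (m <= j)%N.
  by have [j Aj mj] := exA; exists j => //; exact: ltnW.
rewrite (partial_LambdaS exA') (partial_LambdaS exA).
have keep (i : 'I_m.+1) a : (i.+1 < m.+1)%N -> tau_gen (ug a i : Utens R m.+1) (ug a (wd i)).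
  exact: tau_keep.
have := step_graph keep (i := ord_max) erefl A (tau_gens R (i := ord_max) erefl).
rewrite /= /site_mx (negPf Am) /=.
have -> : (fun g => @gen_at R m.+2 g m) = (fun g => ug g (wd ord_max)).
  by apply: funext => g; exact: (gen_atE R g (wd ord_max : 'I_m.+2)).
exact: id.
Qed.

Lemma pad_step m A : ~ (exists2 j, A j & (m <= j)%N) ->
  alg_graph (@pad_gen R m) (partial_Lambda m A) (partial_Lambda m.+1 A).
Proof.
move=> noA; rewrite /partial_Lambda !asboolF //; last first.
  by move=> [j Aj mj]; apply: noA; exists j => //; exact: ltnW.
have Am : A m = false by apply/negP => Am; apply: noA; exists m.
rewrite /transfer_Lambda /= /site_mx Am /= -mulmxA coact_counit.
have GD := @graph_add _ _ _ _ _ (@pad_gen R m).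
have GM := @graph_mul _ _ _ _ _ (@pad_gen R m).
have GS c : alg_graph (@pad_gen R m) (pscal _ c) (pscal _ c) := graph_scal _ c.
have cs := palg_scalars (@urel R m); have cs' := palg_scalars (@urel R m.+1).
apply: (rel_mulmx GD GM) => a b; last exact: (rel_counit cs cs' GS).
rewrite (ord1 a) {a}; suff row j b' : (j <= m)%N ->
    alg_graph (@pad_gen R m) (@left_row R m A j 0 b') (@left_row R m.+1 A j 0 b').
  exact: row.
elim: j b' {b} => [|j IH] b jm; first exact: (rel_start q cs cs' GS).
apply: (rel_mulmx GD GM) => [a' b'|]; first by rewrite (ord1 a'); apply: IH; exact: ltnW.
apply: (rel_transfer q cs cs' GD GM GS) => a.
rewrite -[j]/(nat_of_ord (Ordinal jm)) gen_atE gen_at_wd.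
by apply: graph_gen; apply: pad_intro.
Qed.

Lemma partial_Lambda1 A j : A j -> partial_Lambda 1 A = casimir ord0.
Proof.
move=> Aj; have -> : partial_Lambda 1 A = (start_row (q : qfield R) (pscal (@urel R 1)) *m
    gens_col (q : qfield R) (pscal (@urel R 1)) (fun g => @gen_at R 1 g 0)) 0 0.
  by apply: (@partial_LambdaS 0); exists j.
rewrite (start_coprod_counit _ (palg_scalars _)) /casimir !palgZ.
by rewrite !(gen_atE R _ (ord0 : 'I_1)).
Qed.

Lemma is_LambdaP A j m y : A j -> (0 < m)%N -> is_Lambda A y <-> y = partial_Lambda m A :> Utens R m.
Proof.
move=> Aj m0; split=> [|->].
  move=> Ly; elim: Ly m0 => {m y} [|m x y Lx IH Am ex xy|m x y Lx IH Am ex xy|m x y Lx IH noA xy] _.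
  - by rewrite (partial_Lambda1 Aj).
  - case: m x y Lx IH Am ex xy => [|m] x y Lx IH Am ex xy; first by inversion Lx.
    by rewrite IH // in xy; exact: delta_fun xy (delta_step Am ex).
  - case: m x y Lx IH Am ex xy => [|m] x y Lx IH Am ex xy; first by inversion Lx.
    by rewrite IH // in xy; exact: (@tau_fun _ _ ord_max) xy (tau_step Am ex).
  - case: m x y Lx IH noA xy => [|m] x y Lx IH noA xy; first by inversion Lx.
    by rewrite IH // in xy; exact: pad_fun xy (pad_step noA).
case: m m0 {y} => // m _; elim: m => [|m IH].
  by rewrite (partial_Lambda1 Aj); exact: Lambda_start.
have [ex|noA] := pselect (exists2 j, A j & (m.+1 <= j)%N); last first.
  exact: Lambda_pad IH noA (pad_step noA).
have [Am|Am] := boolP (A m).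
  exact: Lambda_delta IH Am ex (delta_step Am ex).
exact: Lambda_tau IH Am ex (tau_step Am ex).
Qed.

(** The choice made by [xget] is determined because [is_Lambda] holds for exactly one element: each
    step exists for the partial products, and each step graph is functional. *)
Theorem LambdaE n (A : {set 'I_n}) : A != finset.set0 ->
  Lambda A = transfer_Lambda R n [pred j | [exists k in A, val k == j]].
Proof.
set P := [pred j | _] => /finset.set0Pn[k kA].
have Pk : P k by apply/existsP; exists k; rewrite kA eqxx.
have n0 : (0 < n)%N by exact: leq_ltn_trans (ltn_ord k).
have noP : ~ (exists2 j, P j & (n <= j)%N).
  by move=> [j /existsP[l /andP[_ /eqP <-]]]; rewrite leqNgt ltn_ord.
have partialE : partial_Lambda n P = transfer_Lambda R n P.
  by rewrite /partial_Lambda asboolF.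
have LP y := is_LambdaP y Pk n0; rewrite partialE in LP.
rewrite /Lambda; apply/(LP _)/(@xgetPex _ 0 [set y | is_Lambda P y]%classic).
by exists (transfer_Lambda R n P); apply/LP.
Qed.

End LambdaTransfer.

(** * Braiding and Askey-Wilson relation for the Lambda_A *)

Section TwoAdjacentSites.
Variables (R : realType) (n : nat) (i : 'I_n.-1).
Local Notation U := (Utens R n).
Local Notation us := (pscal (@urel R n)).
Local Notation cs := (palg_scalars (@urel R n)).
Local Notation i0 := (strand i).
Local Notation i1 := (strandS i).
Let q0 := q_neq0 R.
Let qgen := @q_expn_neq1 R.
Implicit Type A : pred nat.

Definition pair_letter (x : letter) : U := ug x.2 (if x.1 then i1 else i0).

Lemma pair_two_sites : two_sites (q : qfield R) us pair_letter.
Proof. exact: (ug_two_sites R (strand_neq i)). Qed.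

Lemma braids_coprod_gen x : coprod_gen pair_letter x -> braids i x x.
Proof.
by case; [exact: braids_coprodE | exact: braids_coprodF | exact: braids_KK | exact: braids_JJ].
Qed.

Lemma braids_resolution z y u w :
  resolution (q : qfield R) us pair_letter z y u w ->
  [/\ braids i z y, braids i u u & braids i w w].
Proof.
have b1 : braids i (1 : U) 1 by rewrite -(cs1 cs); exact: braids_scal.
have bg g := @braids_coprod_gen g.
have bcas01 : braids i (cas01 (q : qfield R) us pair_letter) (cas01 (q : qfield R) us pair_letter).
  rewrite /cas01; apply: braidsD; last exact: braidsM (braids_scal _ _) (bg _ (coprod_gKi _)).
  apply: braidsD; last exact: braidsM (braids_scal _ _) (bg _ (coprod_gK _)).
  apply: braidsM (braids_scal _ _) _.
  exact: braidsM (bg _ (coprod_gF _)) (bg _ (coprod_gE _)).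
elim=> {z y u w}.
- split; [exact: braids_K0 | exact: braids_KK | exact: b1].
- split; [exact: braids_J1 | exact: b1 | exact: braids_JJ].
- split; [|exact: bcas01|exact: braids_scal].
  have := @braids_casimir_site R n i false; rewrite /casimir !palgZ; exact: id.
- move=> c z y u w _ [zy uu ww]; have bc := braids_scal i (c : qfield R).
  split; [exact: braidsM bc zy | exact: braidsM bc uu | exact: braidsM bc ww].
- move=> z y u w z' y' u' w' _ [zy uu ww] _ [zy' uu' ww'].
  split; [exact: braidsD zy zy' | exact: braidsD uu uu' | exact: braidsD ww ww'].
- move=> x z y u w /bg bx _ [zy uu ww].
  split; [exact: braidsM bx zy | exact: braidsM bx uu | exact: braidsM bx ww].
- move=> x z y u w /bg bx _ [zy uu ww].
  split; [exact: braidsM zy bx | exact: braidsM uu bx | exact: braidsM ww bx].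
Qed.

Definition pair_mx (b b' : bool) : 'M[U]_4 :=
  transfer_mx q us b (fun a => pair_letter (false, a)) *m
  transfer_mx q us b' (fun a => pair_letter (true, a)).

Lemma pair_resolution a b : resolution (q : qfield R) us pair_letter
  (pair_mx true false a b) (pair_mx false true a b)
  (pair_mx true true a b) (pair_mx false false a b).
Proof. exact: (transfer_resolution q0 qgen pair_two_sites a b). Qed.

(** Prescribing only the membership of i and i+1 lets the four sets of an Askey-Wilson relation
    share one A. *)
Definition set_pair A (b b' : bool) : pred nat :=
  fun j => if j == i then b else if j == i.+1 then b' else A j.

Lemma left_row_pair A b b' :
  left_row R n (set_pair A b b') i.+2 = left_row R n A i *m pair_mx b b'.
Proof.
rewrite /= -mulmxA (eq_left_row _ _ (A' := A)) => [|l li]; last first.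
  by rewrite /set_pair; case: eqP => [e|_]; [|case: eqP => [e|//]]; lia.
congr (_ *m _); rewrite /site_mx /pair_mx /set_pair eqxx.
have -> : (i.+1 == i :> nat) = false by lia.
rewrite eqxx.
have -> : (fun a => @gen_at R n a i) = (fun a => pair_letter (false, a)).
  by apply: funext => a; exact: (gen_atE R a i0).
have -> : (fun a => @gen_at R n a i.+1) = (fun a => pair_letter (true, a)).
  by apply: funext => a; exact: (gen_atE R a i1).
by [].
Qed.

Lemma far_gen j (lt_jn : (j < n)%N) : j != i -> j != i.+1 ->
  Ordinal lt_jn != i0 /\ Ordinal lt_jn != i1.
Proof. by move=> ji ji1; split; rewrite -val_eqE. Qed.

Lemma far_site_braids A j a b : (j < n)%N -> j != i -> j != i.+1 ->
  braids i (site_mx R n A j a b) (site_mx R n A j a b).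
Proof.
move=> jn ji ji1; apply: (rel_transfer q cs cs (@braidsD _ _ i) (@braidsM _ _ i) (@braids_scal _ _ i)).
move=> g; rewrite -[j]/(nat_of_ord (Ordinal jn)) gen_atE.
by have [? ?] := far_gen jn ji ji1; exact: braids_far.
Qed.

Lemma left_row_braids A b : braids i (left_row R n A i 0 b) (left_row R n A i 0 b).
Proof.
suff row j b' : (j <= i)%N -> braids i (left_row R n A j 0 b') (left_row R n A j 0 b').
  exact: row.
have lt_i : (i < n)%N := strand_lt i.
elim: j b' => [|j IH] b' ji; first exact: (rel_start q cs cs (@braids_scal _ _ i)).
apply: (rel_mulmx (@braidsD _ _ i) (@braidsM _ _ i)) => [a c|a c].
  by rewrite (ord1 a); apply: IH; exact: ltnW.
by apply: far_site_braids; lia.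
Qed.

(** The site matrices other than those of i and i+1 have entries in factors fixed by the braiding,
    so only the product of the two middle matrices matters. *)
Lemma transfer_Lambda_braids A b0 b1 b0' b1' :
  (forall a b, braids i (pair_mx b0 b1 a b) (pair_mx b0' b1' a b)) ->
  braids i (transfer_Lambda R n (set_pair A b0 b1))
           (transfer_Lambda R n (set_pair A b0' b1')).
Proof.
move=> bp.
have lt_i : (i.+1 < n)%N := strandS_lt i.
have row2 b : braids i (left_row R n (set_pair A b0 b1) i.+2 0 b)
                       (left_row R n (set_pair A b0' b1') i.+2 0 b).
  rewrite !left_row_pair; apply: (rel_mulmx (@braidsD _ _ i) (@braidsM _ _ i)) => // a c.
  by rewrite (ord1 a); exact: left_row_braids.
have row j b : (i.+2 <= j <= n)%N -> braids i
    (left_row R n (set_pair A b0 b1) j 0 b) (left_row R n (set_pair A b0' b1') j 0 b).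
  elim: j b => // j IH b; rewrite leq_eqVlt => /andP[/orP[/eqP [<-]|ij] jn]; first exact: row2.
  apply: (rel_mulmx (@braidsD _ _ i) (@braidsM _ _ i)) => [a c|a c].
    by rewrite (ord1 a); apply: IH; rewrite -ltnS ij ltnW.
  have -> : site_mx R n (set_pair A b0' b1') j = site_mx R n (set_pair A b0 b1) j.
    by rewrite /site_mx /set_pair; do 2 (case: eqP => [|_]; first by lia).
  by apply: far_site_braids; lia.
apply: (rel_mulmx (@braidsD _ _ i) (@braidsM _ _ i)) => a b.
  by rewrite (ord1 a); apply: row; rewrite lt_i leqnn.
exact: (rel_counit cs cs (@braids_scal _ _ i)).
Qed.

Lemma transfer_Lambda_braids_eq A b :
  braids i (transfer_Lambda R n (set_pair A b b)) (transfer_Lambda R n (set_pair A b b)).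
Proof.
apply: transfer_Lambda_braids => a c.
by have [_ ? ?] := braids_resolution (pair_resolution a c); case: b.
Qed.

Lemma transfer_Lambda_braids_swap A :
  braids i (transfer_Lambda R n (set_pair A true false))
           (transfer_Lambda R n (set_pair A false true)).
Proof.
apply: transfer_Lambda_braids => a c.
by have [? _ _] := braids_resolution (pair_resolution a c).
Qed.

Local Notation ccas := (commutes_cas (q : qfield R) us pair_letter).

Lemma commutes_casD x y : ccas x -> ccas y -> ccas (x + y).
Proof. by move=> [a b c] [a' b' c']; split; apply: commrD. Qed.
Lemma commutes_casM x y : ccas x -> ccas y -> ccas (x * y).
Proof. by move=> [a b c] [a' b' c']; split; apply: commrM. Qed.
Lemma commutes_cas_scal c : ccas (us c).
Proof. by split; apply/esym/(csC cs). Qed.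

Lemma commutes_cas_far a j : j != i0 -> j != i1 -> ccas (ug a j).
Proof.
move=> j0 j1; have c0 s g : GRing.comm (ug a j : U) (pair_letter (s, g)).
  by case: s; exact: ug_comm.
have cS c : GRing.comm (ug a j : U) (us c) by exact/esym/(csC cs).
by split; apply: commr_sym; rewrite /cas01;
  repeat first [exact: c0 | exact: cS | apply: commrD | apply: commrM].
Qed.

(** [rel_transfer] is applied to a relation that ignores its second argument, which makes it a
    closure property of a predicate. *)
Lemma far_site_commutes A j a b : (j < n)%N -> j != i -> j != i.+1 ->
  ccas (site_mx R n A j a b).
Proof.
move=> jn ji ji1.
apply: (@rel_transfer _ q U U us us (fun x _ => ccas x) cs cs
  (fun x _ x' _ => @commutes_casD x x') (fun x _ x' _ => @commutes_casM x x')
  commutes_cas_scal _ _ (fun g => @gen_at R n g j)) => g.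
rewrite -[j]/(nat_of_ord (Ordinal jn)) gen_atE.
by have [? ?] := far_gen jn ji ji1; exact: commutes_cas_far.
Qed.

Lemma left_row_commutes A b : ccas (left_row R n A i 0 b).
Proof.
suff row j b' : (j <= i)%N -> ccas (left_row R n A j 0 b') by exact: row.
have lt_i : (i < n)%N := strand_lt i.
have GD x y x' y' := fun c c' => @commutes_casD x x' c c'.
elim: j b' => [|j IH] b' ji.
  exact: (@rel_start _ q U U us us (fun x _ => ccas x) cs cs commutes_cas_scal 0 b').
apply: (@rel_mulmx U U (fun x _ => ccas x) (fun x _ x' _ => @commutes_casD x x')
  (fun x _ x' _ => @commutes_casM x x') _ _ _ _ (left_row R n A j) (site_mx R n A j)) => [a c|a c].
  by rewrite (ord1 a); apply: IH; exact: ltnW.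
by apply: far_site_commutes; lia.
Qed.

Local Notation rel4 := (aw_relation (q : qfield R) us pair_letter).

Lemma rel4_mulmxl m p (X : 'M[U]_(m, 4)) (Z Y V W : 'M[U]_(4, p)) a c :
  (forall b, ccas (X a b)) -> (forall b, rel4 (Z b c) (Y b c) (V b c) (W b c)) ->
  rel4 ((X *m Z) a c) ((X *m Y) a c) ((X *m V) a c) ((X *m W) a c).
Proof.
move=> cX r4; rewrite !mulmx4E.
have L b := aw_relation_mull pair_two_sites (cX b) (r4 b).
by do 3 (apply: aw_relationD; last exact: L).
Qed.

Lemma rel4_mulmxr m p (Z Y V W : 'M[U]_(m, 4)) (X : 'M[U]_(4, p)) a c :
  (forall b, ccas (X b c)) -> (forall b, rel4 (Z a b) (Y a b) (V a b) (W a b)) ->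
  rel4 ((Z *m X) a c) ((Y *m X) a c) ((V *m X) a c) ((W *m X) a c).
Proof.
move=> cX r4; rewrite !mulmx4E.
have L b := aw_relation_mulr (cX b) (r4 b).
by do 3 (apply: aw_relationD; last exact: L).
Qed.

Lemma transfer_Lambda_relation A :
  rel4 (transfer_Lambda R n (set_pair A true false))
       (transfer_Lambda R n (set_pair A false true))
       (transfer_Lambda R n (set_pair A true true))
       (transfer_Lambda R n (set_pair A false false)).
Proof.
have lt_i : (i.+1 < n)%N := strandS_lt i.
have rowj j c : (i.+2 <= j <= n)%N ->
  rel4 (left_row R n (set_pair A true false) j 0 c)
       (left_row R n (set_pair A false true) j 0 c)
       (left_row R n (set_pair A true true) j 0 c)
       (left_row R n (set_pair A false false) j 0 c).
  elim: j c => // j IH c; rewrite leq_eqVlt => /andP[/orP[/eqP [<-]|ij] jn].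
    rewrite !left_row_pair; apply: rel4_mulmxl => b; first exact: left_row_commutes.
    exact: (resolution_relation q0 qgen pair_two_sites (pair_resolution b c)).
  have siteE b b' : site_mx R n (set_pair A b b') j = site_mx R n A j.
    by rewrite /site_mx /set_pair; do 2 (case: eqP => [|_]; first by lia).
  rewrite /= !siteE; apply: rel4_mulmxr => b.
    by apply: far_site_commutes; lia.
  by apply: IH; rewrite -ltnS ij ltnW.
apply: rel4_mulmxr => b; last by apply: rowj; rewrite lt_i leqnn.
have c0 := commutes_cas_scal 0; have c1 := commutes_cas_scal 1.
rewrite (cs0 cs) in c0; rewrite (cs1 cs) in c1.
by elim/forall4: b; rewrite mxE /=; [exact: c0 | exact: c0 | exact: c0 | exact: c1].
Qed.

Lemma left_row_none A j : (forall l, (l < j)%N -> A l = false) ->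
  left_row R n A j = start_row q us.
Proof.
elim: j => //= j IH Aj; rewrite IH => [|l lj]; last by apply: Aj; exact: ltnW.
rewrite /site_mx Aj ?ltnSn //; exact: (start_coact cs q0).
Qed.

(** Sites before i are absorbed by the start row and sites after i+1 by the counit column; the
    Casimirs of the two factors and of the pair are read off from what is left. *)
Lemma transfer_Lambda_pair b b' :
  transfer_Lambda R n (set_pair pred0 b b') =
  (start_row q us *m (pair_mx b b' *m counit_col U)) 0 0.
Proof.
have lt_i : (i.+1 < n)%N := strandS_lt i.
rewrite /transfer_Lambda mulmxA; congr (fun_of_matrix _ 0 0).
suff row j : (i.+2 <= j <= n)%N -> left_row R n (set_pair pred0 b b') j *m counit_col U =
    start_row q us *m pair_mx b b' *m counit_col U.
  by apply: row; rewrite lt_i leqnn.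
elim: j => // j IH; rewrite leq_eqVlt => /andP[/orP[/eqP [<-]|ij] jn].
  by rewrite left_row_pair left_row_none.
have siteE : set_pair pred0 b b' j = false.
  by rewrite /set_pair; do 2 (case: eqP => [|_]; first by lia).
by rewrite /= /site_mx siteE -mulmxA coact_counit; apply: IH; rewrite -ltnS ij ltnW.
Qed.

Lemma transfer_Lambda_first :
  transfer_Lambda R n (set_pair pred0 true false) = casimir i0.
Proof.
rewrite transfer_Lambda_pair /pair_mx /= -mulmxA coact_counit.
by rewrite (start_coprod_counit _ cs) /casimir !palgZ.
Qed.

Lemma transfer_Lambda_second :
  transfer_Lambda R n (set_pair pred0 false true) = casimir i1.
Proof.
rewrite transfer_Lambda_pair /pair_mx /= 2!mulmxA (start_coact cs q0) -mulmxA.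
by rewrite (start_coprod_counit _ cs) /casimir !palgZ.
Qed.

Lemma transfer_Lambda_both :
  transfer_Lambda R n (set_pair pred0 true true) = cas01 (q : qfield R) us pair_letter.
Proof.
rewrite transfer_Lambda_pair /pair_mx /= -mulmxA.
exact: (start_coprod_gens q0 pair_two_sites).
Qed.

Lemma transfer_Lambda_aw A :
  us q * (transfer_Lambda R n (set_pair pred0 true true) *
          transfer_Lambda R n (set_pair A true false)) -
  us q^-1 * (transfer_Lambda R n (set_pair A true false) *
          transfer_Lambda R n (set_pair pred0 true true)) =
  us (q ^- 2 - q ^+ 2) * transfer_Lambda R n (set_pair A false true) +
  us (q - q^-1) *
    (transfer_Lambda R n (set_pair pred0 true false) *
       transfer_Lambda R n (set_pair A true true) +
     transfer_Lambda R n (set_pair pred0 false true) *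
       transfer_Lambda R n (set_pair A false false)).
Proof.
rewrite transfer_Lambda_both transfer_Lambda_first transfer_Lambda_second.
have := transfer_Lambda_relation A; rewrite /aw_relation /casimir !palgZ; exact: id.
Qed.

End TwoAdjacentSites.

(** * Curves in the punctured plane *)

Section Continuity.
Import numFieldNormedType.Exports.
Local Open Scope classical_set_scope.
Variables (R : realType) (T : topologicalType).
Implicit Types f g : T -> R.

Lemma cont_add f g : continuous f -> continuous g -> continuous (fun x => f x + g x).
Proof. by move=> cf cg x; apply: cvgD; [exact: cf | exact: cg]. Qed.

Lemma cont_opp f : continuous f -> continuous (fun x => - f x).
Proof. by move=> cf x; apply: cvgN; exact: cf. Qed.

Lemma cont_mul f g : continuous f -> continuous g -> continuous (fun x => f x * g x).
Proof. by move=> cf cg x; apply: cvgM; [exact: cf | exact: cg]. Qed.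

Lemma cont_exp f m : continuous f -> continuous (fun x => f x ^+ m).
Proof.
move=> cf; elim: m => [|m IHm]; first by move=> x; exact: cvg_cst.
have -> : (fun x => f x ^+ m.+1) = (fun x => f x * f x ^+ m).
  by apply/funext => x; rewrite exprS.
exact: cont_mul.
Qed.

Lemma cont_max f g : continuous f -> continuous g ->
  continuous (fun x => Num.max (f x) (g x)).
Proof. by move=> cf cg x; apply: (@continuous_max R T f g x (cf x) (cg x)). Qed.

Lemma cont_min f g : continuous f -> continuous g ->
  continuous (fun x => Num.min (f x) (g x)).
Proof. by move=> cf cg x; apply: (@continuous_min R T f g x (cf x) (cg x)). Qed.

Lemma cont_cst (c : R) : continuous (fun _ : T => c).
Proof. by move=> x; exact: cvg_cst. Qed.

Lemma cont_comp (S S' : topologicalType) (h : S -> S') (f : T -> S) :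
  continuous h -> continuous f -> continuous (fun x => h (f x)).
Proof. by move=> ch cf x; apply: (continuous_comp (cf x) (ch _)). Qed.

Lemma cont_pair (S S' : topologicalType) (f : T -> S) (g : T -> S') :
  continuous f -> continuous g -> continuous (fun x => (f x, g x)).
Proof. by move=> cf cg x; apply: cvg_pair; [exact: cf | exact: cg]. Qed.

Lemma cont_fst (S S' : topologicalType) (f : T -> S * S') :
  continuous f -> continuous (fun x => (f x).1).
Proof. by move=> cf x; apply: (continuous_comp (cf x)); exact: cvg_fst. Qed.

Lemma cont_snd (S S' : topologicalType) (f : T -> S * S') :
  continuous f -> continuous (fun x => (f x).2).
Proof. by move=> cf x; apply: (continuous_comp (cf x)); exact: cvg_snd. Qed.

Lemma cont_id : continuous (fun x : T => x).
Proof. by move=> x; exact: cvg_id. Qed.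

End Continuity.

Ltac cont := lazymatch goal with
  | |- continuous (fun x => x) => apply: cont_id
  | |- continuous (fun=> ?z) => apply: (@cont_cst _ _ z)
  | |- continuous (fun x => (@?f x, @?g x)) => apply: (@cont_pair _ _ _ f g); cont
  | |- continuous (fun x => (@?f x).1) => apply: (@cont_fst _ _ _ f); cont
  | |- continuous (fun x => (@?f x).2) => apply: (@cont_snd _ _ _ f); cont
  | |- continuous (fun x => @?f x + @?g x) => apply: (@cont_add _ _ f g); cont
  | |- continuous (fun x => - @?f x) => apply: (@cont_opp _ _ f); cont
  | |- continuous (fun x => @?f x * @?g x) => apply: (@cont_mul _ _ f g); cont
  | |- continuous (fun x => @?f x ^+ _) => apply: (@cont_exp _ _ f); cont
  | |- continuous (fun x => Num.max (@?f x) (@?g x)) => apply: (@cont_max _ _ f g); cont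
  | |- continuous (fun x => Num.min (@?f x) (@?g x)) => apply: (@cont_min _ _ f g); cont
  | |- continuous (fun x => cos (@?f x)) =>
      apply: (@cont_comp _ _ _ _ f (@continuous_cos _)); cont
  | |- continuous (fun x => sin (@?f x)) =>
      apply: (@cont_comp _ _ _ _ f (@continuous_sin _)); cont
  | |- continuous (fun x => Num.sqrt (@?f x)) =>
      apply: (@cont_comp _ _ _ _ f (@sqrt_continuous _)); cont
  | |- continuous (fun x => `|@?f x|) =>
      apply: (@cont_comp _ _ _ _ f (@norm_continuous _ _)); cont
  | |- continuous (fun x => ?h (@?f x)) => apply: (@cont_comp _ _ _ h f); [try assumption | cont]
  | |- _ => idtac
  end.

(** * Parametrised circles and bands along ellipses *)

Section CircleParameter.
Import numFieldNormedType.Exports.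
Local Open Scope classical_set_scope.
Variable R : realType.

(** From cos x = 1 - 2 sin(x/2)^2, the sine being positive strictly between 0 and pi. *)
Lemma cos_eq1 (x : R) : `|x| <= pi *+ 2 -> cos x = 1 -> x = 0 \/ `|x| = pi *+ 2.
Proof.
move=> x_le cosx; case: (eqVneq x 0) => [->|x0]; [by left | right].
apply/eqP; rewrite eq_le x_le /= leNgt; apply/negP => x_lt.
have xp : 0 < `|x| by rewrite normr_gt0.
have s0 : 0 < sin (`|x| / 2).
  by apply: sin_gt0_pi; rewrite divr_gt0 //= ltr_pdivrMr // mulr_natr.
have := cos_mulr2n (`|x| / 2).
rewrite -[`|x| / 2 *+ 2]mulr_natr divfK // cos_norm cosx cos2sin2.
have : 0 < sin (`|x| / 2) ^+ 2 by rewrite exprn_gt0.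
lra.
Qed.

Lemma cos_sin_inj (t t' : R) : 0 <= t <= 1 -> 0 <= t' <= 1 ->
  cos (pi *+ 2 * t) = cos (pi *+ 2 * t') -> sin (pi *+ 2 * t) = sin (pi *+ 2 * t') ->
  circ_eq t t'.
Proof.
move=> t01 t'01 ec es; have p2 : 0 < pi *+ 2 :> R by rewrite pmulrn_lgt0 // pi_gt0.
have d1 : `|t - t'| <= 1 by rewrite ler_norml; lra.
have : cos (pi *+ 2 * (t - t')) = 1.
  by rewrite mulrBr cosB ec es -!expr2 cos2Dsin2.
move/cos_eq1; rewrite normrM (gtr0_norm p2) => /(_ _) [].
- by rewrite -[leRHS]mulr1 ler_pM2l.
- move/eqP; rewrite mulf_eq0 (gt_eqF p2) subr_eq0 => /eqP ->; by left.
- move/eqP; rewrite -[X in _ == X]mulr1 (inj_eq (mulfI (lt0r_neq0 p2))) => /eqP.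
  case: ger0P => _ e; right; [right | left]; split; lra.
Qed.

Lemma circle_param (x y : R) : x ^+ 2 + y ^+ 2 = 1 ->
  exists2 t, 0 <= t <= 1 & x = cos (pi *+ 2 * t) /\ y = sin (pi *+ 2 * t).
Proof.
move=> xy1; have p2 : 0 < pi *+ 2 :> R by rewrite pmulrn_lgt0 // pi_gt0.
have x1 : -1 <= x <= 1.
  by rewrite -ler_norml -(@expr_le1 _ 2) // real_normK ?num_real // -xy1 lerDl sqr_ge0.
have sE : sin (acos x) = `|y|.
  by rewrite sin_acos // -xy1 [x ^+ 2 + _]addrC addrK sqrtr_sqr.
have t01 : 0 <= acos x / (pi *+ 2) <= 1.
  rewrite (divr_ge0 (acos_ge0 x1) (ltW p2)) ler_pdivrMr // mul1r.
  by apply: le_trans (acos_lepi x1) _; rewrite mulr2n lerDl pi_ge0.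
have tE : pi *+ 2 * (acos x / (pi *+ 2)) = acos x by rewrite mulrC divfK // lt0r_neq0.
case: (leP 0 y) => y0.
  exists (acos x / (pi *+ 2)) => //.
  by rewrite tE acosK // sE ger0_norm.
exists (1 - acos x / (pi *+ 2)); first by move: t01; lra.
rewrite mulrBr mulr1 tE addrC cosD2pi sinD2pi cosN sinN acosK // sE.
by rewrite ltr0_norm // opprK.
Qed.

End CircleParameter.

Section Curve.
Import numFieldNormedType.Exports.
Local Open Scope classical_set_scope.
Variables (R : realType) (n : nat) (c rho delta : R) (v : R -> R).
Hypotheses (rho0 : 0 < rho) (delta0 : 0 < delta) (cv : continuous v).
Local Notation R2 := (R * R)%type.
Local Notation R3 := (R * R * R)%type.

(* The ellipse of centre (c, 0) and half-axes rho and delta, sheared vertically by v. *)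
Definition gauge (p : R2) : R := ((p.1 - c) / rho) ^+ 2 + ((p.2 - v p.1) / delta) ^+ 2.

(** Polar coordinates adapted to [gauge]: the radius 1 + s/2 runs over [1/2, 3/2], so the thickened
    band occupies gauge values from 1/4 to 9/4. This is the origin of the two bounds imposed on the
    punctures. *)
Definition ribbon (p : R2) : R2 :=
  let r := 1 + p.2 / 2 in
  let x := c + rho * (r * cos (pi *+ 2 * p.1)) in
  (x, v x + delta * (r * sin (pi *+ 2 * p.1))).

Lemma gauge_cont : continuous gauge.
Proof. by rewrite /gauge; cont. Qed.

Lemma ribbon_cont : continuous ribbon.
Proof. by rewrite /ribbon /=; cont. Qed.

Lemma gauge_ribbon p : gauge (ribbon p) = (1 + p.2 / 2) ^+ 2.
Proof.
rewrite /gauge /ribbon /= !(addrAC _ _ (- _)) !subrr !add0r.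
rewrite !(mulrAC _ _ (_^-1)) !divff ?lt0r_neq0 // !mul1r !exprMn -mulrDr.
by rewrite cos2Dsin2 mulr1.
Qed.

Lemma ribbon_inj p p' : strip p -> strip p' -> ribbon p = ribbon p' ->
  circ_eq p.1 p'.1 /\ p.2 = p'.2.
Proof.
case: p p' => [t s] [t' s'] [] /= t01 s1 [] /= t'01 s'1 e.
have es : s = s'.
  have := congr1 gauge e; rewrite !gauge_ribbon /= => /eqP.
  by rewrite eqrXn2 //; [move/eqP; lra | lra | lra].
split => //; move: e; rewrite -es /ribbon /=.
set x := c + _; set x' := c + _; move=> -[] ex; rewrite ex => /addrI.
have r0 : 1 + s / 2 != 0 by rewrite lt0r_neq0 //; lra.
move/(mulfI (lt0r_neq0 delta0))/(mulfI r0) => esin.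
move/addrI/(mulfI (lt0r_neq0 rho0))/(mulfI r0): ex => ecos.
exact: cos_sin_inj.
Qed.

Lemma ribbon_ends s : ribbon (0, s) = ribbon (1, s).
Proof. by rewrite /ribbon /= mulr0 mulr1 cos0 sin0 cos2pi sin2pi. Qed.

Variables (h k : R2 -> R2).
Hypotheses (ch : continuous h) (ck : continuous k) (hK : cancel h k) (kK : cancel k h).

Definition band : set R3 :=
  [set p | exists t s, [/\ 0 <= t <= 1, - 2^-1 <= s <= 2^-1 & p = (h (ribbon (t, s)), 2^-1)]].

Definition curve : set R2 := [set p | exists2 t, 0 <= t <= 1 & p = h (ribbon (t, 0))].

Hypothesis punctures_off :
  forall j : 'I_n, gauge (k (puncture R j)) < 4^-1 \/ 9 / 4 < gauge (k (puncture R j)).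

Lemma band_link : exists m (F : 'I_m -> R3 -> R3), thick_embedding n F /\ band = annuli F.
Proof.
(* The thickening stays at heights between 1/4 and 3/4. *)
exists 1%N, (fun _ p => (h (ribbon p.1), 2^-1 + p.2 / 4)); split; last first.
  apply/seteqP; split=> [p [t [s [t01 s01 ->]]]|p [_ [t [s [t01 s01 ->]]]]].
    by exists ord0, t, s; split=> //=; rewrite mul0r addr0.
  by exists t, s; split=> //=; rewrite mul0r addr0.
split.
- move=> _; apply: continuous_subspaceT; cont; exact: ribbon_cont.
- move=> _ [[t s] u] [[/= t01 s1] /= u1]; split=> /=; first by lra.
  move=> j e; have := punctures_off j; rewrite -e hK gauge_ribbon /=.
  have : (1 + s / 2) ^+ 2 = 1 + s + (s * s) / 4 by field.
  have ss : 0 <= (1 - s) * (1 + s) by apply: mulr_ge0; lra.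
  nra.
- by move=> _ s u _ _ /=; rewrite ribbon_ends.
- move=> c1 c2 [ts u] [ts' u'] [/= S _] [/= S' _] [] /(can_inj hK)/(ribbon_inj S S') [e1 e2] e.
  by split=> //; [rewrite !ord1 | lra].
Qed.

Definition band_flink := FLink band_link.

Lemma curveE : curve = [set p | gauge (k p) = 1].
Proof.
apply/seteqP; split=> [p [t t01 ->]|p /= gp].
  by rewrite /= hK gauge_ribbon /= mul0r addr0 expr1n.
have [t t01 [ex ey]] := circle_param gp.
exists t => //; rewrite -[LHS]kK; congr h; rewrite /ribbon /= mul0r addr0 !mul1r -ex -ey.
rewrite [rho * _]mulrC divfK ?lt0r_neq0 // [delta * _]mulrC divfK ?lt0r_neq0 //.
by rewrite [c + _]addrC subrK addrC subrK; case: (k p).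
Qed.

Variable A : {set 'I_n}.
Variable C : R.
Hypothesis gauge_bounded : forall p, gauge (k p) <= 1 -> `|p| <= C.
Hypothesis A_inside : forall j : 'I_n, j \in A -> gauge (k (puncture R j)) < 1.
Hypothesis A_below : forall (j : 'I_n) y, j \notin A -> 0 <= y -> gauge (k (j%:R, y)) <> 1.

(** For an excluded puncture the upward ray is connected, unbounded and off the curve, so its
    component is unbounded. For a puncture in A the gauge takes an interval of values on the
    component, starting below 1 and avoiding 1, so the component stays in a bounded set. *)
Lemma curve_encloses (j : 'I_n) : encloses curve (puncture R j) <-> j \in A.
Proof.
rewrite /encloses curveE; split=> [[_ bnd]|jA].
  apply: contraT => jA.
  pose ray := (fun y => (j%:R, y) : R2) @` [set y | 0 <= y].
  have ray_conn : connected ray.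
    apply: connected_continuous_connected; last first.
      by apply: continuous_subspaceT; rewrite /=; cont.
    by apply/connected_intervalP => x y /= x0 y0 z /andP[xz _]; exact: le_trans xz.
  have ray_sub : ray `<=` connected_component (~` [set p | gauge (k p) = 1]) (puncture R j).
    apply: connected_component_max => //; first by exists 0 => //=.
    by move=> _ [y y0 <-] /=; exact: A_below.
  have [M [_ hM]] := bnd.
  have ltM : M < `|M| + 1 by rewrite ltr_pwDr // ler_norm.
  have /(hM _ ltM) : connected_component (~` [set p | gauge (k p) = 1]) (puncture R j) (j%:R, `|M| + 2).
    by apply: ray_sub; exists (`|M| + 2) => //=; rewrite addr_ge0.
  rewrite /= prod_normE /= ge_max => /andP[_].
  by rewrite ger0_norm ?addr_ge0 //; lra.
split; first by move=> /= e; have := A_inside jA; rewrite e ltxx.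
set CC := connected_component _ _.
suff sub : forall p, CC p -> gauge (k p) < 1.
  exists C; split; first exact: num_real.
  by move=> M CM p /sub gp; apply: le_trans (ltW CM); apply: gauge_bounded; exact: ltW.
have ival : is_interval ((gauge \o k) @` CC).
  apply/connected_intervalP/connected_continuous_connected; first exact: component_connected.
  by apply: continuous_subspaceT; exact: (@cont_comp _ _ _ gauge k gauge_cont ck).
move=> p Cp; rewrite ltNge; apply/negP => gp.
have jC : CC (puncture R j).
  by apply: connected_component_refl => /= e; have := A_inside jA; rewrite e ltxx.
have [x Cx ex] : ((gauge \o k) @` CC) 1.
  apply: (ival (gauge (k (puncture R j))) (gauge (k p))).
  - by exists (puncture R j).
  - by exists p.
  - by rewrite (ltW (A_inside jA)) gp.
by have := connected_component_sub Cx; apply.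
Qed.

Lemma band_is_s : is_s A band_flink.
Proof.
exists curve; split; last 1 first.
- by move=> j jA y y0; rewrite curveE; exact: A_below.
- exists (h \o ribbon), 2^-1; split=> //.
  + by apply: continuous_subspaceT; exact: (@cont_comp _ _ _ h ribbon ch ribbon_cont).
  + by move=> s _ /=; rewrite ribbon_ends.
  + by move=> p p' S S' /= /(can_inj hK); exact: ribbon_inj.
- exact: curve_encloses.
Qed.

End Curve.

(** * The half twist and its inverse *)

Section HalfTwist.
Import numFieldNormedType.Exports.
Local Open Scope classical_set_scope.
Variables (R : realType) (i : nat).
Local Notation R2 := (R * R)%type.
Local Notation m := (i%:R + 2^-1 : R).

Definition twist_angle (e : R) : R := pi * Num.min 1 (Num.max 0 (4 - 4 * Num.sqrt e)).

Lemma twist_angle_far e : 1 <= e -> twist_angle e = 0.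
Proof.
move=> e1; have s1 : 1 <= Num.sqrt e by rewrite -[leLHS]sqrtr1 ler_sqrt // (le_trans _ e1).
rewrite /twist_angle (max_idPl _) ?(min_idPr _) ?mulr0 //; lra.
Qed.

Lemma twist_angle_near e : e <= 9 / 16 -> twist_angle e = pi.
Proof.
move=> e1; have s1 : Num.sqrt e <= 3 / 4.
  have -> : 3 / 4 = Num.sqrt (9 / 16) :> R.
    by rewrite (_ : 9 / 16 = (3 / 4) ^+ 2 :> R) ?sqrtr_sqr ?ger0_norm //; field.
  by rewrite ler_wsqrtr.
rewrite /twist_angle (min_idPl _) ?mulr1 // le_max; apply/orP; right; lra.
Qed.

Lemma sin_twist_angle e : 0 <= sin (twist_angle e).
Proof.
apply: sin_ge0_pi; apply/andP; split.
  by apply: mulr_ge0 (pi_ge0 R) _; rewrite le_min ler01 le_max lexx.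
by rewrite -[leRHS]mulr1 ler_pM2l ?pi_gt0 // ge_min lexx.
Qed.

(** Rotation by the opposite angle: the angle depends only on the distance to the midpoint, which
    rotations preserve. *)
Definition untwist (p : R2) : R2 :=
  let u := p.1 - m in
  let a := twist_angle (u ^+ 2 + p.2 ^+ 2) in
  (m + (cos a * u + sin a * p.2), cos a * p.2 - sin a * u).

Lemma half_twistE (p : R2) : half_twist i p =
  let u := p.1 - m in
  let a := twist_angle (u ^+ 2 + p.2 ^+ 2) in
  (m + (cos a * u - sin a * p.2), sin a * u + cos a * p.2).
Proof. by []. Qed.

Lemma half_twist_cont : continuous (half_twist i : R2 -> R2).
Proof. by rewrite /half_twist /=; cont. Qed.

Lemma untwist_cont : continuous untwist.
Proof. by rewrite /untwist /twist_angle /=; cont. Qed.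

Lemma half_twistK : cancel (half_twist i) untwist.
Proof.
move=> [x y]; rewrite half_twistE /untwist /=.
set u := x - m; set a := twist_angle (u ^+ 2 + y ^+ 2).
have cs1 := cos2Dsin2 a.
rewrite ![m + _ - m]addrAC !subrr !add0r.
have -> : (cos a * u - sin a * y) ^+ 2 + (sin a * u + cos a * y) ^+ 2 = u ^+ 2 + y ^+ 2.
  transitivity ((cos a ^+ 2 + sin a ^+ 2) * (u ^+ 2 + y ^+ 2)); first by ring.
  by rewrite cs1 mul1r.
rewrite -/a; congr (_, _).
  transitivity (m + (cos a ^+ 2 + sin a ^+ 2) * u); first by ring.
  by rewrite cs1 mul1r addrC subrK.
transitivity ((cos a ^+ 2 + sin a ^+ 2) * y); first by ring.
by rewrite cs1 mul1r.
Qed.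

Lemma untwistK : cancel untwist (half_twist i).
Proof.
move=> [x y]; rewrite half_twistE /untwist /=.
set u := x - m; set a := twist_angle (u ^+ 2 + y ^+ 2).
have cs1 := cos2Dsin2 a.
rewrite ![m + _ - m]addrAC !subrr !add0r.
have -> : (cos a * u + sin a * y) ^+ 2 + (cos a * y - sin a * u) ^+ 2 = u ^+ 2 + y ^+ 2.
  transitivity ((cos a ^+ 2 + sin a ^+ 2) * (u ^+ 2 + y ^+ 2)); first by ring.
  by rewrite cs1 mul1r.
rewrite -/a; congr (_, _).
  transitivity (m + (cos a ^+ 2 + sin a ^+ 2) * u); first by ring.
  by rewrite cs1 mul1r addrC subrK.
transitivity ((cos a ^+ 2 + sin a ^+ 2) * y); first by ring.
by rewrite cs1 mul1r.
Qed.

Lemma untwist_far x y : 1 <= (x - m) ^+ 2 + y ^+ 2 -> untwist (x, y) = (x, y).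
Proof.
move=> far; rewrite /untwist /= twist_angle_far // cos0 sin0 !mul1r !mul0r addr0 subr0.
by rewrite addrC subrK.
Qed.

Lemma untwist_near x y : (x - m) ^+ 2 + y ^+ 2 <= 9 / 16 ->
  untwist (x, y) = (i%:R + i.+1%:R - x, - y).
Proof.
move=> near; rewrite /untwist /= twist_angle_near // cospi sinpi -natr1.
by congr (_, _); field.
Qed.

(** In the transition annulus, only the sign of the sine is kept from the angle: it records that the
    twist is anti-clockwise. *)
Lemma untwistE x y : exists co si : R,
  [/\ untwist (x, y) = (m + (co * (x - m) + si * y), co * y - si * (x - m)),
      co ^+ 2 + si ^+ 2 = 1 & 0 <= si].
Proof.
exists (cos (twist_angle ((x - m) ^+ 2 + y ^+ 2))), (sin (twist_angle ((x - m) ^+ 2 + y ^+ 2))).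
by split; [by [] | exact: cos2Dsin2 | exact: sin_twist_angle].
Qed.

Lemma half_twist_norm (p : R2) : `|half_twist i p| <= (m + m) + (`|p.1| + `|p.2|).
Proof.
rewrite half_twistE /= prod_normE /= ge_max.
set a := twist_angle _; have := cos_max a; have := sin_max a.
have ca (c z : R) : `|c| <= 1 -> `|c * z| <= `|z| by move=> c1; rewrite normrM ler_piMl.
have m0 : 0 <= m by rewrite addr_ge0.
have um : `|p.1 - m| <= `|p.1| + m by rewrite (le_trans (ler_normB _ _)) // (ger0_norm m0).
move=> s1 c1.
have := ler_normD m (cos a * (p.1 - m) - sin a * p.2).
have := ler_normB (cos a * (p.1 - m)) (sin a * p.2).
have := ler_normD (sin a * (p.1 - m)) (cos a * p.2).
have := ca _ (p.1 - m) c1; have := ca _ (p.1 - m) s1; have := ca _ p.2 c1; have := ca _ p.2 s1.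
by rewrite (ger0_norm m0); lra.
Qed.

End HalfTwist.

Section TwistedCurves.
Import numFieldNormedType.Exports.
Local Open Scope classical_set_scope.
Variables (R : realType) (n : nat) (i : 'I_n.-1).
Local Notation i0 := (strand i).
Local Notation i1 := (strandS i).
Local Notation s := (tperm i0 i1).

Lemma far_puncture (j : 'I_n) (y : R) : j != i0 -> j != i1 ->
  1 <= (j%:R - (i%:R + 2^-1)) ^+ 2 + y ^+ 2.
Proof.
move=> j0 j1; have y0 := sqr_ge0 y.
have : (j%:R + 1 <= i%:R :> R) || (i%:R + 1 + 1 <= j%:R :> R).
  rewrite !natr1 !ler_nat; move: j0 j1; rewrite -!val_eqE /=; lia.
by case/orP; nra.
Qed.

Lemma untwist_puncture (j : 'I_n) : untwist i (puncture R j) = puncture R (s j).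
Proof.
rewrite /puncture; case: tpermP => [->|->|/eqP j0 /eqP j1] /=.
- rewrite untwist_near; first by rewrite oppr0 addrAC subrr add0r.
  by rewrite [leLHS](_ : _ = 4^-1); [lra | field].
- rewrite untwist_near; first by rewrite oppr0 addrK.
  by rewrite -[i.+1%:R]natr1 [leLHS](_ : _ = 4^-1); [lra | field].
- by rewrite untwist_far // far_puncture.
Qed.

Section Gauge.
Variables (c rho delta C : R) (v : R -> R) (A : {set 'I_n}).
Hypotheses (rho0 : 0 < rho) (delta0 : 0 < delta) (cv : continuous v).
Local Notation gauge := (gauge c rho delta v).
Hypothesis gauge_bounded : forall p, gauge p <= 1 -> `|p| <= C.
Hypothesis gauge_in : forall j : 'I_n, j \in A -> gauge (puncture R j) < 4^-1.
Hypothesis gauge_out : forall j : 'I_n, j \notin A -> 9 / 4 < gauge (puncture R j).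
Hypothesis gauge_ray : forall (j : 'I_n) y, j \notin A -> 0 <= y -> gauge (j%:R, y) <> 1.
Hypothesis gauge_twisted_ray : forall (j : 'I_n) y,
  s j \notin A -> 0 <= y -> gauge (untwist i (j%:R, y)) <> 1.

(** Both links come from the same ribbon, composed with the identity or with the half twist, so the
    second is the image of the first by construction. To recognise it as a curve of the required
    type, the upward rays are pulled back by [untwist]. *)
Lemma twisted_curves : exists L L' : flink R n,
  [/\ is_s A L, is_s [set j | s j \in A]%SET L' & flink_set L' = half_twist3 i @` L].
Proof.
have off (j : 'I_n) : gauge (puncture R j) < 4^-1 \/ 9 / 4 < gauge (puncture R j).
  by case: (boolP (j \in A)) => jA; [left; exact: gauge_in | right; exact: gauge_out].
have off' (j : 'I_n) : gauge (untwist i (puncture R j)) < 4^-1 \/ 9 / 4 < gauge (untwist i (puncture R j)).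
  by rewrite untwist_puncture.
have inA (j : 'I_n) : j \in A -> gauge (puncture R j) < 1.
  by move=> /gauge_in /lt_trans; apply; lra.
pose L := @band_flink R n c rho delta v rho0 delta0 cv id id (@cont_id _) (fun p => erefl p) off.
pose L' := band_flink rho0 delta0 cv (@half_twist_cont R i) (@half_twistK R i) off'.
exists L, L'; split.
- by apply: band_is_s gauge_bounded inA gauge_ray => //; exact: cont_id.
- apply: (@band_is_s _ _ _ _ _ _ _ _ _ _ _ _ _ _ _ _ _ ((i%:R + 2^-1) + (i%:R + 2^-1) + (C + C))).
  + exact: untwist_cont.
  + exact: untwistK.
  + move=> p /gauge_bounded; rewrite -{2}(untwistK i p) prod_normE /= ge_max => /andP[b1 b2].
    by apply: le_trans (half_twist_norm _ _) _; rewrite lerD2l lerD.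
  + by move=> j; rewrite inE untwist_puncture; exact: inA.
  + by move=> j y; rewrite inE; exact: gauge_twisted_ray.
apply/seteqP; split=> [p [t [r [t01 r1 ->]]]|_ [p [t [r [t01 r1 ->]]] <-]].
  by exists (ribbon c rho delta v (t, r), 2^-1) => //; exists t, r.
by exists t, r.
Qed.
End Gauge.

(** A circle of radius 1/8 about puncture i+1 lies within 5/8 of the midpoint, hence in the disk of
    radius 3/4 that the twist rotates rigidly; its image is the circle about puncture i. *)
Lemma small_circle_curves : exists L L' : flink R n,
  [/\ is_s [set i1]%SET L, is_s [set i0]%SET L' & flink_set L' = half_twist3 i @` L].
Proof.
have gE (p : R * R) : gauge (i.+1%:R) (8^-1) (8^-1) (fun=> 0) p =
    64 * ((p.1 - i.+1%:R) ^+ 2 + p.2 ^+ 2).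
  by rewrite /gauge; field.
have far (j : 'I_n) (y : R) : j != i1 -> 1 <= (j%:R - i.+1%:R) ^+ 2 + y ^+ 2.
  move=> j1; have y0 := sqr_ge0 y.
  have : (j%:R + 1 <= i.+1%:R :> R) || (i.+1%:R + 1 <= j%:R :> R).
    rewrite !natr1 !ler_nat; move: j1; rewrite -!val_eqE /=; lia.
  by case/orP; nra.
have -> : [set i0]%SET = [set j | s j \in [set i1]]%SET.
  by apply/setP => j; rewrite !inE (canF_eq (tpermK _ _)) tpermR.
apply: (@twisted_curves (i.+1%:R) (8^-1) (8^-1) (i.+1%:R + 1) (fun=> 0) [set i1]%SET).
- by rewrite invr_gt0.
- by rewrite invr_gt0.
- exact: cont_cst.
- move=> [x y]; rewrite gE prod_normE /= ge_max !ler_norml => g1.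
  have : 0 <= i.+1%:R :> R by [].
  move: g1 => /=; set z := i.+1%:R => g1 z0.
  have sq (t : R) : t ^+ 2 <= 1 -> -1 <= t <= 1 by nra.
  have /sq : (x - z) ^+ 2 <= 1 by have := sqr_ge0 y; have := sqr_ge0 (x - z); lra.
  have /sq : y ^+ 2 <= 1 by have := sqr_ge0 y; have := sqr_ge0 (x - z); lra.
  by rewrite -/z; lra.
- by move=> j; rewrite inE gE => /eqP -> /=; rewrite subrr; lra.
- by move=> j; rewrite inE gE /= => /(far _ 0); lra.
- by move=> j y; rewrite inE gE /= => /(far _ y); lra.
- move=> j y; rewrite inE gE => sj y0.
  have [far1|near] := leP 1 (((j%:R : R) - (i%:R + 2^-1)) ^+ 2 + y ^+ 2).
    rewrite untwist_far //=; have [j1|/(far _ y)] := eqVneq j i1; last by lra.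
    move: far1; rewrite j1 /= -[i.+1%:R]natr1; nra.
  have j1 : j = i1.
    apply: contraTeq near => j1; rewrite -leNgt; apply: far_puncture => //.
    by apply: contraNneq sj => ->; rewrite tpermL.
  move: near; rewrite j1; case wE: (untwist _ _) => [x' y'] /=; move: wE.
  have hm : i.+1%:R - (i%:R + 2^-1) = 2^-1 :> R by rewrite -natr1; field.
  rewrite hm.
  have [near|nnear] := leP ((2^-1 : R) ^+ 2 + y ^+ 2) (9 / 16).
    rewrite untwist_near; last by rewrite hm.
    rewrite addrK => -[<- <-] _; rewrite -natr1; nra.
  (* In the transition annulus the distance to the midpoint exceeds 3/4, out of reach of the
     circle. *)
  have [co [si [-> cs1 _]]] := untwistE i (i.+1%:R) y; rewrite hm => -[<- <-] _.
  rewrite -[i.+1%:R]natr1; have [X eX] : exists X, X = co * 2^-1 + si * y by eexists.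
  rewrite -eX => eg.
  have e1 : X ^+ 2 + (co * y - si * 2^-1) ^+ 2 = (2^-1 : R) ^+ 2 + y ^+ 2.
    by rewrite eX -[RHS]mul1r -cs1; ring.
  have e2 : 64 * ((2^-1 : R) ^+ 2 + y ^+ 2 - X + 4^-1) = 1.
    by rewrite -e1 -[RHS]eg; field.
  have e3 : (X - 2^-1) ^+ 2 <= 64^-1.
    have := sqr_ge0 (co * y - si * 2^-1); move: eg.
    by rewrite (_ : _ + X - _ = X - 2^-1); [lra | field].
  nra.
Qed.

End TwistedCurves.

(** * Curves s_A avoiding the twisted rays *)

Section ShearedCurve.
Import numFieldNormedType.Exports.
Local Open Scope classical_set_scope.
Variables (R : realType) (n : nat) (A : {set 'I_n}).

(* The ellipse is wide and its axis is lowered to height -2, except for spikes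
   reaching the punctures in A: so the curve encloses these from below. *)
Definition spikes (x : R) : R := \big[Num.max/(-2)]_(j in A) (-4 * `|x - j%:R|).

Lemma spikes_cont : continuous spikes.
Proof.
pose F (t : seq 'I_n) (x : R) := \big[Num.max/(-2)]_(j <- t | j \in A) (-4 * `|x - j%:R|).
suff FC t : continuous (F t) by exact: FC.
elim: t => [|j t IHt].
  by rewrite (_ : F [::] = fun=> -2); [cont | apply/funext => x; rewrite /F big_nil].
have -> : F (j :: t) = if j \in A then fun x => Num.max (-4 * `|x - j%:R|) (F t x) else F t.
  by apply/funext => x; rewrite /F big_cons; case: ifP.
by case: ifP => // _; cont.
Qed.

Lemma spikes_ge x : -2 <= spikes x.
Proof. exact: bigmax_ge_id. Qed.

Lemma spikes_le x : spikes x <= 0.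
Proof. by apply: bigmax_le => [|j _]; [lra | have := normr_ge0 (x - j%:R); lra]. Qed.

Lemma spikes_in (j : 'I_n) : j \in A -> spikes j%:R = 0.
Proof.
move=> jA; apply/eqP; rewrite eq_le spikes_le /=.
by apply: (bigmax_sup j) => //; rewrite subrr normr0 mulr0.
Qed.

(** With slope 4 a spike comes down to the floor -2 at distance 1/2, so the spikes of neighbouring
    punctures meet at most at their feet. *)
Lemma spikes_out (x : R) : (forall j : 'I_n, j \in A -> 2^-1 <= `|x - j%:R|) ->
  spikes x = -2.
Proof.
move=> far; apply/eqP; rewrite eq_le spikes_ge andbT.
by apply: bigmax_le => // j /far; lra.
Qed.

Lemma spikes_notin (j : 'I_n) : j \notin A -> spikes j%:R = -2.
Proof.
move=> jA; apply: spikes_out => k kA; have kj : k != j by apply: contraNneq jA => <-.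
have : (j%:R + 1 <= k%:R :> R) || (k%:R + 1 <= j%:R :> R).
  rewrite !natr1 !ler_nat; move: kj; rewrite -!val_eqE /=; lia.
by case/orP => h; rewrite ler_normr; apply/orP; [right | left]; lra.
Qed.

Variable i : 'I_n.-1.
Local Notation i0 := (strand i).
Local Notation i1 := (strandS i).
Local Notation s := (tperm i0 i1).
(** Large enough for every puncture to have a first coordinate below half of it, as the bound 1/4 on
    the gauge requires. *)
Definition wide : R := n.*2.+2%:R.
Local Notation gauge := (gauge 0 wide (4^-1) spikes).

Lemma wide0 : 0 < wide. Proof. by rewrite ltr0n. Qed.

Lemma gaugeE (x y : R) : gauge (x, y) = (x / wide) ^+ 2 + 16 * (y - spikes x) ^+ 2.
Proof. by rewrite /gauge /= subr0; congr (_ + _); field. Qed.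

Lemma gauge_above x y : 4^-1 < y - spikes x -> gauge (x, y) <> 1.
Proof.
rewrite gaugeE; move: (y - _) (_ ^+ 2) (sqr_ge0 (x / wide)) => z w w0 z1 e.
have z2 : 16^-1 < z ^+ 2 by nra.
lra.
Qed.

Lemma gauge_puncture_in (j : 'I_n) : j \in A -> gauge (puncture R j) < 4^-1.
Proof.
move=> jA; rewrite gaugeE spikes_in // subrr expr0n mulr0 addr0.
have -> : 4^-1 = (2^-1) ^+ 2 :> R by field.
rewrite ltr_pXn2r ?nnegrE ?divr_ge0 ?invr_ge0 // ltr_pdivrMr ?wide0 //.
by rewrite mulrC ltr_pdivlMr // /wide -natrM ltr_nat; have := ltn_ord j; lia.
Qed.

Lemma gauge_puncture_out (j : 'I_n) : j \notin A -> 9 / 4 < gauge (puncture R j).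
Proof. move=> jA; rewrite gaugeE spikes_notin //; move: (_ ^+ 2) (sqr_ge0 (j%:R / wide)) => w w0; lra. Qed.

Lemma gauge_le1 p : gauge p <= 1 -> `|p| <= wide + 3.
Proof.
case: p => x y; rewrite gaugeE prod_normE /= ge_max.
have [z zE] : exists z, z = x / wide by eexists.
rewrite -zE => g1; have sq (t : R) : t ^+ 2 <= 1 -> -1 <= t <= 1 by nra.
have [sx sy] := (sqr_ge0 z, sqr_ge0 (y - spikes x)).
have /sq : z ^+ 2 <= 1 by lra.
rewrite -ler_norml zE normrM normfV (gtr0_norm wide0) ler_pdivrMr ?wide0 // mul1r => xw.
have /sq : (y - spikes x) ^+ 2 <= 1 by lra.
have := spikes_le x; have := spikes_ge x; have := wide0.
by move=> w0 v1 v2 y1; apply/andP; split; [lra | rewrite ler_norml; lra].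
Qed.

(** The work is to show that the untwisted upward ray of each puncture excluded after the twist
    misses the curve, which stays within 1/4 of the graph of [spikes]. *)
Lemma sheared_curves : (i1 \in A -> i0 \in A) -> exists L L' : flink R n,
  [/\ is_s A L, is_s [set j | s j \in A]%SET L' & flink_set L' = half_twist3 i @` L].
Proof.
move=> good; apply: twisted_curves gauge_le1 gauge_puncture_in gauge_puncture_out _ _.
- exact: wide0.
- by rewrite invr_gt0.
- exact: spikes_cont.
- by move=> j y jA y0; apply: gauge_above; rewrite spikes_notin //; lra.
move=> j y sjA y0.
have [far|near] := leP 1 (((j%:R : R) - (i%:R + 2^-1)) ^+ 2 + y ^+ 2).
  rewrite untwist_far //; apply: gauge_above; have [jA|jA] := boolP (j \in A); last first.
    by rewrite spikes_notin //; lra.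
  (* As j and [s j] differ in membership, j is one of the two exchanged punctures, at distance 1/2
     from the midpoint; so outside the unit disk its ray has height at least the square root of
     3/4. *)
  have yy : 3 / 4 <= y ^+ 2.
    have : (j == i0) || (j == i1).
      by apply: contraNT sjA; rewrite negb_or => /andP[j0 j1]; rewrite tpermD // eq_sym.
    by case/orP => /eqP je; move: far; rewrite je /= -?[i.+1%:R]natr1; nra.
  by rewrite spikes_in //; nra.
have far_in (x : R) (k : 'I_n) : `|x - (i%:R + 2^-1)| <= 1 -> k \in A -> k != i0 -> k != i1 ->
    2^-1 <= `|x - k%:R|.
  rewrite ler_norml => xm kA k0 k1; rewrite ler_normr.
  have : (k%:R + 1 <= i%:R :> R) || (i%:R + 1 + 1 <= k%:R :> R).
    rewrite !natr1 !ler_nat; move: k0 k1; rewrite -!val_eqE /=; lia.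
  by case/orP => h; apply/orP; [left | right]; lra.
case wE: (untwist i (j%:R, y)) => [x' y'].
have dE : (x' - (i%:R + 2^-1)) ^+ 2 + y' ^+ 2 = (j%:R - (i%:R + 2^-1)) ^+ 2 + y ^+ 2.
  have [co [si [wE' cs1 _]]] := untwistE i (j%:R) y; move: wE; rewrite wE' => -[<- <-].
  by rewrite -[RHS]mul1r -cs1; ring.
have sq (t : R) : t ^+ 2 <= 1 -> -1 <= t <= 1 by nra.
have [sx sy] := (sqr_ge0 (x' - (i%:R + 2^-1)), sqr_ge0 y').
have x1 : `|x' - (i%:R + 2^-1)| <= 1 by rewrite ler_norml; apply: sq; lra.
have y1 : -1 <= y' <= 1 by apply: sq; lra.
(* Over such x' there is no spike: the axis is at height -2, whereas y' is at least -1. *)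
have low : (i0 \in A -> i%:R + 2^-1 <= x') -> i1 \notin A -> gauge (x', y') <> 1.
  move=> x2 i1A; apply: gauge_above; rewrite spikes_out; first by lra.
  move=> k kA; have k1 : k != i1 by apply: contraNneq i1A => <-.
  have [ki|k0] := eqVneq k i0; last exact: far_in.
  by move: kA; rewrite ki => /x2 x3; rewrite ler_normr /=; apply/orP; left; lra.
(* For the ray over i+1 the hypothesis [good] excludes both punctures from A, so no spike is near.
   For the ray over i there may be a spike at i, and the direction of the rotation is needed. *)
have [j0|j0] := eqVneq j i0; last first.
  have j1 : j = i1 by apply: contraTeq near => j1; rewrite -leNgt; exact: far_puncture.
  move: sjA; rewrite j1 tpermR => i0A; apply: low; first by move=> i0A'; rewrite i0A' in i0A.
  exact: contra good i0A.
move: sjA wE near dE; rewrite j0 tpermL => i1A /=.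
have hm : i%:R - (i%:R + 2^-1) = - 2^-1 :> R by rewrite opprD addNKr.
rewrite hm => wE near dE; have [x2|x2] := leP (i%:R + 2^-1) x'; first exact: low.
have [d1|d1] := leP ((- 2^-1) ^+ 2 + y ^+ 2) (9 / 16 : R).
  move: wE; rewrite untwist_near ?hm // addrAC subrr add0r => -[ex _].
  by move: x2; rewrite -ex -natr1; lra.
(* For x' left of the midpoint, the nonnegative sine forces a positive cosine: then y' is
   nonnegative and x' is within 1/2 of the midpoint, while the distance exceeds 3/4. Hence y'^2 >
   5/16, and the point is above every spike. *)
have [co [si [wE' cs1 si0]]] := untwistE i (i%:R : R) y; move: wE; rewrite wE' hm => -[ex ey].
have siy : 0 <= si * y by exact: mulr_ge0.
have co0 : 0 < co by move: x2; rewrite -ex; lra.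
have co1 : co <= 1 by nra.
have y'0 : 0 <= y' by rewrite -ey; have := mulr_ge0 (ltW co0) y0; lra.
have x3 : - 2^-1 <= x' - (i%:R + 2^-1) by rewrite -ex; lra.
have y'1 : 4^-1 < y' by nra.
by apply: gauge_above; have := spikes_le x'; lra.
Qed.

End ShearedCurve.

(** * Equivariance *)

Section AlgMorphism.
Variables (F : fieldType) (X Y : Type).
Variables (r : pterm F X -> pterm F X -> Prop) (s : pterm F Y -> pterm F Y -> Prop).
Variable f : palg r -> palg s.
Hypothesis fP : alg_morphism f.

Lemma alg_morphismD x y : f (x + y) = f x + f y.
Proof. by have [lin _] := fP; have := lin 1 x y; rewrite !scale1r. Qed.

Lemma alg_morphism0 : f 0 = 0.
Proof. by apply: (addrI (f 0)); rewrite -alg_morphismD !addr0. Qed.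

Lemma alg_morphismZ c x : f (c *: x) = c *: f x.
Proof. by have [lin _] := fP; have := lin c x 0; rewrite alg_morphism0 !addr0. Qed.

Lemma alg_morphismN x : f (- x) = - f x.
Proof. by rewrite -!scaleN1r alg_morphismZ. Qed.

Lemma alg_morphismM x y : f (x * y) = f x * f y.
Proof. by have [_ [_ ->]] := fP. Qed.

Lemma alg_morphism1 : f 1 = 1.
Proof. by have [_ [-> _]] := fP. Qed.
End AlgMorphism.

Section BraidLambda.
Variables (R : realType) (n : nat) (i : 'I_n.-1).
Local Notation U := (Utens R n).
Local Notation us := (pscal (@urel R n)).
Local Notation cs := (palg_scalars (@urel R n)).
Local Notation i0 := (strand i).
Local Notation i1 := (strandS i).
Local Notation s := (tperm i0 i1).
Local Notation TL := (transfer_Lambda R n).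
Implicit Types (A : {set 'I_n}) (Q : pred nat).

Lemma eq_transfer_Lambda Q Q' : (forall l, (l < n)%N -> Q l = Q' l) -> TL Q = TL Q'.
Proof. by move=> QQ'; rewrite /transfer_Lambda (eq_left_row _ _ QQ'). Qed.

Lemma transfer_Lambda_set Q A : A != finset.set0 -> (forall l : 'I_n, Q l = (l \in A)) ->
  TL Q = Lambda A.
Proof.
move=> A0 QA; rewrite LambdaE //; apply: eq_transfer_Lambda => l ln /=.
rewrite -[l]/(nat_of_ord (Ordinal ln)) QA; apply/idP/existsP => [lA|[k /andP[kA /eqP kl]]].
  by exists (Ordinal ln); rewrite lA /=.
by rewrite -(val_inj kl : k = Ordinal ln).
Qed.

Definition mem_nat A : pred nat := fun j => [exists k in A, val k == j].

Lemma mem_natE A (k : 'I_n) : mem_nat A k = (k \in A).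
Proof.
apply/existsP/idP => [[l /andP[lA /eqP/val_inj <-]] //|kA].
by exists k; rewrite kA /=.
Qed.

Lemma set_pair_in Q b b' (l : 'I_n) : set_pair i Q b b' l =
  if l == i0 then b else if l == i1 then b' else Q l.
Proof. by []. Qed.

Lemma Lambda_set_pair A b b' : A != finset.set0 -> (i0 \in A) = b -> (i1 \in A) = b' ->
  TL (set_pair i (mem_nat A) b b') = Lambda A.
Proof.
move=> A0 b0 b1; apply: transfer_Lambda_set => // l; rewrite set_pair_in mem_natE.
by case: eqP => [->|_] //; case: eqP => [->|_].
Qed.

Lemma swapped_neq0 A : A != finset.set0 -> [set j | s j \in A]%SET != finset.set0.
Proof. by case/set0Pn => k kA; apply/set0Pn; exists (s k); rewrite inE tpermK. Qed.

Lemma swapped_set_pair A b b' : A != finset.set0 -> (i0 \in A) = b -> (i1 \in A) = b' ->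
  TL (set_pair i (mem_nat A) b' b) = Lambda [set j | s j \in A]%SET.
Proof.
move=> A0 b0 b1; apply: transfer_Lambda_set => [|l]; first exact: swapped_neq0.
rewrite set_pair_in mem_natE inE.
by case: tpermP => [->|->|/eqP/negbTE -> /eqP/negbTE ->]; rewrite ?eqxx // eq_sym (negbTE (strand_neq i)).
Qed.

Lemma braids_Lambda A : A != finset.set0 -> (i1 \in A -> i0 \in A) ->
  braids i (Lambda A : U) (Lambda [set j | s j \in A]%SET).
Proof.
move=> A0 good.
rewrite -(Lambda_set_pair A0 erefl erefl) -(swapped_set_pair A0 erefl erefl).
have [i1A|i1A] := boolP (i1 \in A); first by rewrite (good i1A); exact: transfer_Lambda_braids_eq.
case: (i0 \in A); [exact: transfer_Lambda_braids_swap | exact: transfer_Lambda_braids_eq].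
Qed.

Lemma Lambda_strand : Lambda [set i0]%SET = casimir i0 :> U.
Proof.
rewrite -transfer_Lambda_first; apply/esym/transfer_Lambda_set => [|l].
  by apply/set0Pn; exists i0; rewrite inE.
by rewrite set_pair_in !inE;  case: (l == i0) => //; case: (l == i1).
Qed.

Lemma Lambda_strandS : Lambda [set i1]%SET = casimir i1 :> U.
Proof.
rewrite -transfer_Lambda_second; apply/esym/transfer_Lambda_set => [|l].
  by apply/set0Pn; exists i1; rewrite inE.
rewrite set_pair_in !inE; have [->|_] := eqVneq l i0; last by case: (l == i1).
by rewrite (negbTE (strand_neq i)).
Qed.

Lemma braids_Lambda_strandS : braids i (Lambda [set i1]%SET : U) (Lambda [set i0]%SET).
Proof. by rewrite Lambda_strand Lambda_strandS; exact: (@braids_casimir_site _ _ i true). Qed.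

Lemma transfer_Lambda_none Q : (forall l, (l < n)%N -> Q l = false) ->
  TL Q = us (q + q^-1).
Proof.
by move=> Q0; rewrite /transfer_Lambda left_row_none // start_counit.
Qed.

End BraidLambda.

Section Equivariance.
Variables (R : realType) (n : nat) (phi : skein R n -> Utens R n).
Hypothesis hphi : skein_AW_iso phi.
Variable rhoS : braid n -> skein R n -> skein R n.
Hypothesis hS : skein_braid_action rhoS.
Variable i : 'I_n.-1.
Local Notation U := (Utens R n).
Local Notation us := (pscal (@urel R n)).
Local Notation cs := (palg_scalars (@urel R n)).
Local Notation i0 := (strand i).
Local Notation i1 := (strandS i).
Local Notation TL := (transfer_Lambda R n).
Implicit Types (A : {set 'I_n}) (Q : pred nat).

Let phiP : alg_morphism phi. Proof. by case: hphi. Qed.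
Let rhoP : alg_morphism (rhoS (bgen i)). Proof. by case: hS. Qed.

(** Carrying a preimage along makes equivariance a property of elements of AW(n), closed under the
    algebra operations, so that induction on [AW] applies. *)
Definition equivariant_at (y : U) : Prop :=
  exists2 x, phi x = y & braids i (phi x) (phi (rhoS (bgen i) x)).
Local Notation eqv := equivariant_at.

Lemma equivariant_add y y' : eqv y -> eqv y' -> eqv (y + y').
Proof.
move=> [x <- bx] [x' <- bx']; exists (x + x'); first by rewrite (alg_morphismD phiP).
by rewrite (alg_morphismD rhoP) !(alg_morphismD phiP); exact: braidsD.
Qed.

Lemma equivariant_mul y y' : eqv y -> eqv y' -> eqv (y * y').
Proof.
move=> [x <- bx] [x' <- bx']; exists (x * x'); first by rewrite (alg_morphismM phiP).
by rewrite (alg_morphismM rhoP) !(alg_morphismM phiP); exact: braidsM.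
Qed.

Lemma equivariant_scal c : eqv (us c).
Proof.
exists (c *: (1 : skein R n)); rewrite ?(alg_morphismZ rhoP) !(alg_morphismZ phiP).
  by rewrite (alg_morphism1 phiP).
by rewrite (alg_morphism1 rhoP) (alg_morphism1 phiP); exact: braids_scal.
Qed.

Lemma equivariant_sub y y' : eqv y -> eqv y' -> eqv (y - y').
Proof.
move=> ey ey'; rewrite -scaleN1r palgZ; apply: equivariant_add ey _.
exact: equivariant_mul (equivariant_scal _) ey'.
Qed.

(** One pair of links is enough, since [phi] takes the prescribed value on every link representing
    s_A. *)
Lemma equivariant_curve A A' (L L' : flink R n) : A != finset.set0 -> A' != finset.set0 ->
  is_s A L -> is_s A' L' -> flink_set L' = (half_twist3 i @` L)%classic ->
  braids i (Lambda A : U) (Lambda A') -> eqv (Lambda A).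
Proof.
move=> A0 A'0 sL sL' LL' bA; have [_ _ _ phiL] := hphi; have [_ _ rhoL] := hS.
exists (- skein_class L); rewrite ?(alg_morphismN rhoP) !(alg_morphismN phiP).
  by rewrite (phiL A L A0 sL) opprK.
rewrite (rhoL i L L' LL') (phiL A L A0 sL) (phiL A' L' A'0 sL') !opprK; exact: bA.
Qed.

Lemma equivariant_Lambda_good A : A != finset.set0 -> (i1 \in A -> i0 \in A) -> eqv (Lambda A).
Proof.
move=> A0 good; have [L [L' [sL sL' LL']]] := @sheared_curves R n A i good.
exact: (equivariant_curve A0 (swapped_neq0 i A0) sL sL' LL' (@braids_Lambda R n i A A0 good)).
Qed.

Lemma set1_neq0 (k : 'I_n) : [set k]%SET != finset.set0.
Proof. by apply/set0Pn; exists k; rewrite !inE. Qed.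

Lemma equivariant_Lambda_strandS : eqv (Lambda [set i1]%SET).
Proof.
have [L [L' [sL sL' LL']]] := @small_circle_curves R n i.
exact: (equivariant_curve (set1_neq0 _) (set1_neq0 _) sL sL' LL' (@braids_Lambda_strandS R n i)).
Qed.

Lemma equivariant_transfer_good Q (b b' : bool) : (b' -> b) -> eqv (TL (set_pair i Q b b')).
Proof.
move=> good; pose A := [set k : 'I_n | set_pair i Q b b' k]%SET.
have QA (l : 'I_n) : set_pair i Q b b' l = (l \in A) by rewrite inE.
(* The prescribed set may be empty; the transfer product is then the scalar q + q^-1. *)
have [A0|A0] := eqVneq A finset.set0.
  rewrite transfer_Lambda_none => [|l ln]; first exact: equivariant_scal.
  by rewrite -[l]/(nat_of_ord (Ordinal ln)) QA A0 !inE.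
rewrite (transfer_Lambda_set R A0 QA); apply: equivariant_Lambda_good => //.
by rewrite -!QA !set_pair_in eq_sym (negbTE (strand_neq i)) !eqxx.
Qed.

(* The class of a curve passing above a puncture is recovered from the others by the
   Askey-Wilson relation, whose coefficient q^-2 - q^2 is invertible. *)
Lemma equivariant_transfer_swapped Q : eqv (TL (set_pair i Q false true)).
Proof.
have := @transfer_Lambda_aw R n i Q.
set z := TL (set_pair i Q false true); set l := _ - _; set w := us (q - q^-1) * _ => e.
have el : eqv l.
  by apply: equivariant_sub; apply: equivariant_mul (equivariant_scal _) _;
    apply: equivariant_mul; exact: equivariant_transfer_good.
have ew : eqv w.
  apply: equivariant_mul (equivariant_scal _) _; apply: equivariant_add.
    by apply: equivariant_mul; exact: equivariant_transfer_good.
  apply: equivariant_mul; last exact: equivariant_transfer_good.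
  by rewrite transfer_Lambda_second -(@Lambda_strandS R n i); exact: equivariant_Lambda_strandS.
have d0 : q ^- 2 - q ^+ 2 != 0 :> qfield R.
  by rewrite -opprB oppr_eq0; exact: (generic_subV (q_neq0 R) (@q_expn_neq1 R)).
have -> : z = us (q ^- 2 - q ^+ 2)^-1 * (l - w).
  by rewrite e addrK mulrA -(csM cs) mulVf // (cs1 cs) mul1r.
exact: equivariant_mul (equivariant_scal _) (equivariant_sub el ew).
Qed.

Lemma equivariant_Lambda A : A != finset.set0 -> eqv (Lambda A).
Proof.
move=> A0; rewrite -(@Lambda_set_pair R n i A _ _ A0 erefl erefl).
case: (boolP (i1 \in A)) (boolP (i0 \in A)) => [_|_] [_|_];
  by [exact: equivariant_transfer_good | exact: equivariant_transfer_swapped].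
Qed.

Lemma braids_phi x : braids i (phi x) (phi (rhoS (bgen i) x)).
Proof.
have [_ phi_inj phiAW _] := hphi.
suff eqvAW y : AW y -> eqv y.
  (* Injectivity of [phi] identifies the preimage provided by [equivariant_at] with x itself. *)
  have [|x' /phi_inj <-] := eqvAW (phi x); last by [].
  by apply/phiAW; exists x.
elim=> {y} [y [A A0 ->]|c|y y' _ ey _ ey'|y y' _ ey _ ey'].
- exact: equivariant_Lambda.
- exact: equivariant_scal.
- exact: equivariant_add.
- exact: equivariant_mul.
Qed.

End Equivariance.

(** * From one Artin generator to the braid group *)

Lemma completion_eq (R : realType) n (x y : completion R n) :
  (forall V, x V = y V) -> x = y.
Proof.
case: x y => [x xP] [y yP] /= xy.
have e : x = y by apply: functional_extensionality_dep.
by rewrite e in xP *; congr Completion; exact: Prop_irrelevance.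
Qed.

Lemma braid_word_ind n (P : braid n -> Prop) :
  P 1%g -> (forall g h, P g -> P h -> P (g * h)%g) -> (forall g, P g -> P g^-1%g) ->
  (forall i, P (bgen i)) -> forall b, P b.
Proof.
move=> P1 PM PV Pgen b; rewrite -(bclK b).
elim: (generic_quotient.repr b) => [|[i c] u IHu]; first exact: P1.
rewrite -cat1s -bclM; apply: PM IHu.
case: c; first exact: Pgen.
by have := PV _ (Pgen i); rewrite /GRing.inv /= /bgen -[_^-1%g]/(braid_inv _) bclV.
Qed.

Section Intertwiner.
Variables (G : groupType) (X Y : Type) (a : G -> X -> X) (b : G -> Y -> Y) (f : X -> Y).
Hypotheses (aP : Defs.is_action a) (bP : Defs.is_action b).

Definition commutes_at g := forall x, f (a g x) = b g (f x).

Lemma commutes_at1 : commutes_at 1%g.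
Proof. by move=> x; rewrite aP.1 bP.1. Qed.

Lemma commutes_atM g h : commutes_at g -> commutes_at h -> commutes_at (g * h)%g.
Proof. by move=> gP hP x; rewrite aP.2 bP.2 gP hP. Qed.

Lemma commutes_atV g : commutes_at g -> commutes_at g^-1%g.
Proof.
move=> gP x; rewrite -[LHS]bP.1 -(mulVg g) bP.2; congr (b _ _).
by rewrite -gP -aP.2 mulgV aP.1.
Qed.
End Intertwiner.

Theorem proposition7p4 (R : realType) (n : nat) (hn : (2 <= n)%N)
    (phi : skein R n -> Utens R n) (hphi : skein_AW_iso phi)
    (rhoS : braid n -> skein R n -> skein R n)
    (hS : skein_braid_action rhoS)
    (rhoA : braid n -> completion R n -> completion R n)
    (hA : completion_braid_action rhoA) (b : braid n) (x : skein R n) :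
  to_completion (phi (rhoS b x)) = rhoA b (to_completion (phi x)).
Proof.
have [aS _ _] := hS; have [aA genA] := hA.
suff comm g : commutes_at rhoS rhoA (fun y => to_completion (phi y)) g by exact: comm.
elim/braid_word_ind: g => [|g h|g|i].
- exact: commutes_at1.
- exact: commutes_atM.
- exact: commutes_atV.
move=> y; apply: completion_eq => V; rewrite genA.
by rewrite (braid_op_eq V (braids_phi hphi hS i y)).
Qed.
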